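(* Let $\mathbb K\in\{\mathbb R,\mathbb C\}$ and let $G$ be a split Kac--Moody $\mathbb K$-group, or an almost split Kac--Moody $\mathbb K$-group satisfying the descent condition (DCS). Let $G(\mathbb K)$ be the group of $\mathbb K$-rational points of $G$, let $\Theta$ be the Cartan--Chevalley involution of $G(\mathbb K)$ (over $\mathbb R$), respectively the Cartan--Chevalley involution composed with the continuous field involution (over $\mathbb C$), and let $K(\mathbb K)=\{g\in G(\mathbb K)\mid \Theta(g)=g\}$. Then the quotient $$X(\mathbb K):=G(\mathbb K)/K(\mathbb K)$$ is a symmetric space in the sense of Loos with respect to the reflection map $$(gK(\mathbb K),hK(\mathbb K))\mapsto g\,\Theta(g)^{-1}\,\Theta(h)K(\mathbb K).$$ Moreover, there is a natural action of $G(\mathbb K)$ on this symmetric space by automorphisms, $$G(\mathbb K)\to \mathrm{Sym}(X(\mathbb K)),\qquad g\mapsto (hK(\mathbb K)\mapsto ghK(\mathbb K)).$$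
   Context: **Symmetric spaces (Loos).** A symmetric space is a topological space $X$ with a continuous map $\mu:X\times X\to X$, $\mu(x,y)=x.y$, such that for all $x,y,z\in X$: (S1) $x.x=x$; (S2) $x.(x.y)=y$; (S3) $x.(y.z)=(x.y).(x.z)$; (S4) every $x\in X$ has a neighbourhood $U$ such that $x.y=y$ with $y\in U$ implies $y=x$. A morphism is a continuous map commuting with the reflection maps; $\mathrm{Sym}(X)$ is the group of automorphisms of the symmetric space $X$. **Kac--Moody data.** A generalized Cartan matrix is $\mathbb A=(a_{ij})\in\mathbb Z^{n\times n}$ with $a_{ii}=2$, $a_{ij}\le 0$ for $i\neq j$, and $a_{ij}=0\iff a_{ji}=0$. Throughout $\mathbb A$ is indecomposable (not a non-trivial direct sum after reordering indices) and symmetrizable ($\mathbb A=DB$ with $D$ real invertible diagonal and $B$ real symmetric), of rank $l$; $I=\{1,\dots,n\}$. Fix the root datum $(I,\mathbb A,\Lambda,(c_i),(h_i))$: $\Lambda$ is a free $\mathbb Z$-module of rank $2n-l$ with $\mathbb Z$-dual $\Lambda^\vee$, $(c_i)_{i\in I}\subset\Lambda$ and $(h_i)_{i\in I}\subset\Lambda^\vee$ are linearly independent, $c_j(h_i)=a_{ij}$; $v_1,\dots,v_{2n-l}$ is a $\mathbb Z$-basis of $\Lambda^\vee$ with $v_i=h_i$ for $i\le n$. Put $\mathfrak h=\Lambda^\vee\otimes\mathbb C$, $\alpha_i=c_i\otimes1\in\mathfrak h^*$, $\alpha_i^\vee=h_i\otimes 1\in\mathfrak h$, $Q=\bigoplus_i\mathbb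 Z\alpha_i$. The Kac--Moody algebra $\mathfrak g(\mathbb A)$ is generated by $\mathfrak h,e_i,f_i$ with $[\mathfrak h,\mathfrak h]=0$, $[h,e_i]=c_i(h)e_i$, $[h,f_i]=-c_i(h)f_i$, $[e_i,f_j]=-\delta_{ij}h_i$, $(\mathrm{ad}\,e_i)^{1-a_{ij}}e_j=(\mathrm{ad}\,f_i)^{1-a_{ij}}f_j=0$ ($i\ne j$). The Weyl group $\mathcal W\le GL(\mathfrak h)$ is generated by $r_i^\vee(h)=h-\alpha_i(h)\alpha_i^\vee$; the real roots are $\Delta^{re}=\mathcal W\{\alpha_1,\dots,\alpha_n\}$, each positive or negative. **Split group.** Let $\mathcal G$ be the Tits functor (from commutative rings to groups) of this root datum: it comes with morphisms $\varphi_i:SL_2\to\mathcal G$ ($i\in I$) and $\eta:T\to\mathcal G$, where $T(R)=\Lambda^\vee\otimes_{\mathbb Z}R^\times\cong\mathrm{Hom}(\Lambda,R^\times)$ and $r^{v}:=v\otimes r$, such that: for a field $F$, $\mathcal G(F)$ is generated by the $\varphi_i(SL_2(F))$ and $\eta(T(F))$; $\eta$ is injective on $R$-points; $\varphi_i(\mathrm{diag}(r,r^{-1}))=\eta(r^{h_i})$; injections of rings into fields induce injections of groups; there is $\mathrm{Ad}:\mathcal G(\mathbb C)\to \mathrm{Aut}([\mathfrak g(\mathbb A),\mathfrak g(\mathbb A)])$ with kernel in $\eta(T(\mathbb C))$, $\mathrm{Ad}(\varphi_i\begin{pmatrix}1&c\\0&1\end{pmatrix})=\exp(\mathrm{ad}\,ce_i)$,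 $\mathrm{Ad}(\varphi_i\begin{pmatrix}1&0\\c&1\end{pmatrix})=\exp(\mathrm{ad}(-cf_i))$, $\mathrm{Ad}(\eta(t))e_i=t(c_i)e_i$, $\mathrm{Ad}(\eta(t))f_i=t(-c_i)f_i$. $\mathcal G$ is assumed non-degenerate, so over fields it agrees (uniquely up to isomorphism) with Tits's Kac--Moody group given by generators and relations. The split Kac--Moody $\mathbb K$-group has rational points $G(\mathbb K)=\mathcal G(\mathbb K)$. Write $T$ for $\eta(T(\mathbb K))$. Root groups: $x_{\alpha_i}(r)=\varphi_i\begin{pmatrix}1&r\\0&1\end{pmatrix}$, $x_{-\alpha_i}(r)=\varphi_i\begin{pmatrix}1&0\\-r&1\end{pmatrix}$, $U_{\pm\alpha_i}=x_{\pm\alpha_i}(\mathbb K)$; $U_{w\alpha_i}=\tilde wU_{\alpha_i}\tilde w^{-1}$ where $\tilde w$ is a lift of $w\in\mathcal W$ to the group generated by $\tilde s_i=\varphi_i\begin{pmatrix}0&1\\-1&0\end{pmatrix}$ (with $\tilde s_i\mapsto r_i^\vee$). $U_\pm$ is generated by the positive/negative root groups and $B_\pm=T\ltimes U_\pm$. $G(\mathbb K)$ carries the Kac--Peterson topology: the final group topology for the maps $\varphi_i:SL_2(\mathbb K)\to G(\mathbb K)$, $\eta:T(\mathbb K)\to G(\mathbb K)$ with Lie group topologies on the sources. $\Theta$ is the continuous involution with $\Theta(x_{\pm\alpha_i}(r))=x_{\mp\alpha_i}(\bar r)$, $\Theta(r^{v_j})=\bar r^{-v_j}$ (the bar is complex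 conjugation, trivial for $\mathbb K=\mathbb R$). **Almost split group ($\mathbb K=\mathbb R$; over $\mathbb C$ nothing new arises).** Here $G=\mathcal G(\mathbb C)$. An $\mathbb R$-form of $\mathcal G$ is a functor $\mathcal F$ from $\mathbb R$-algebras to groups with a functorial isomorphism $\mathcal F|_{\mathbb C\text{-alg}}\cong\mathcal G|_{\mathbb C\text{-alg}}$. Each $\sigma\in\mathrm{Gal}(\mathbb C/\mathbb R)$ then acts on $G=\mathcal F(\mathbb C)$ by $\mathcal F(\sigma)$; let $\Gamma$ be the induced group of automorphisms of $G$. A pair $(\mathcal F,\mathcal U_{\mathbb R})$, with $\mathcal U_{\mathbb R}$ an $\mathbb R$-form of the universal enveloping algebra of $\mathfrak g(\mathbb A)$, is a prealgebraic $\mathbb R$-form if the adjoint representation of $\mathcal G$ on the enveloping algebra is Galois-equivariant and $\mathcal F(k)\le\mathcal G(\mathbb C)$ for subfields $k$ of $\mathbb C$. For each Galois automorphism $\sigma$ there is $g\in G$ such that the rectified automorphism $\bar\sigma=c_{g^{-1}}\circ\sigma$ ($c_g$ = conjugation by $g$) stabilizes $T$. The form is algebraic if rectified automorphisms map root groups relative to $T$ to root groups relative to $T$ (condition (SGR)), respect the $Q$-gradation of the enveloping algebra with induced permutation satisfying $\bar\sigma(m\alpha)=m\bar\sigma(\alpha)$ for $\alpha\in\Delta^{re}$, $m\in\mathbb N$, and stabilize $\Lambda$ and $\Lambda^\vee$. It is an almost split Kac--Moody $\mathbb R$-group if moreover the Galois action stabilizes the conjugacy class of $B_+$. Rational points: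 $G(\mathbb R)=\mathcal F(\mathbb R)$; (DCS) is the condition $G(\mathbb R)=G^\Gamma$. Convention: after conjugation by a diagonal automorphism (one that is trivial on $T$ and multiplies the parameter of each root group by a nonzero constant) rectified Galois automorphisms commute with the involution $\Theta$ of $\mathcal G(\mathbb C)$; $\Gamma$ denotes the group of Galois automorphisms rectified and conjugated in this way, so $G(\mathbb R)=G^\Gamma$ is $\Theta$-stable, $\Theta$ on $G(\mathbb R)$ is the restriction of $\Theta$ on $\mathcal G(\mathbb C)$, and $G(\mathbb R)$ carries the topology induced from $\mathcal G(\mathbb C)$. Quotients carry the quotient topology. *)

(* Defs.v *)
From HB Require Import structures.
From mathcomp Require Import all_boot all_order all_algebra.
From mathcomp Require Import all_classical all_reals topology normedtype.
From mathcomp Require Import complex.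

Set Implicit Arguments.
Unset Strict Implicit.
Unset Printing Implicit Defensive.

Import Order.TTheory GRing.Theory Num.Theory.
Import numFieldNormedType.Exports.

Local Open Scope classical_set_scope.
Local Open Scope quotient_scope.
Local Open Scope ring_scope.

Record loos_symmetric_space (X : topologicalType) (mu : X -> X -> X) : Prop := {
  loos_continuous : continuous (fun p : (X * X)%type => mu p.1 p.2);
  loos_S1 : forall x, mu x x = x;
  loos_S2 : forall x y, mu x (mu x y) = y;
  loos_S3 : forall x y z, mu x (mu y z) = mu (mu x y) (mu x z);
  loos_S4 : forall x, exists2 U : set X, nbhs x U &
    forall y, U y -> mu x y = y -> y = x }.

(* Sym(X), as a set of self-maps of X: a morphism with a continuous inverse. *)
Definition Sym (X : topologicalType) (mu : X -> X -> X) : set (X -> X) :=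
  [set f | [/\ continuous f,
      exists f' : X -> X, [/\ continuous f', cancel f f' & cancel f' f]
    & forall x y, f (mu x y) = mu (f x) (f y)]].

Definition is_subgroup (G : groupType) (H : set G) : Prop :=
  H 1%g /\ forall x y, H x -> H y -> H (x * y^-1)%g.

Definition generated (G : groupType) (S : set G) : set G :=
  [set x | forall H : set G, is_subgroup H -> S `<=` H -> H x].

Record subgroup (G : groupType) := Subgroup {
  subgroup_set :> set G;
  subgroupP : is_subgroup subgroup_set }.

(* A group together with a topology on its carrier; continuity of the group
   operations is not part of this interface. *)
#[short(type="groupSpaceType")]
HB.structure Definition GroupSpace := {G of Group G & Topological G}.

Section SubgroupType.
Variables (G : groupType) (H : subgroup G).

Definition subgroup_type : Type := set_type H.
HB.instance Definition _ := Choice.copy subgroup_type (set_type H).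

Lemma subgroup1 : subgroup_set H 1%g. Proof. by case: (subgroupP H). Qed.
Lemma subgroupV x : subgroup_set H x -> subgroup_set H x^-1%g.
Proof.
move=> Hx; rewrite -[_^-1%g]mul1g.
by apply: (subgroupP H).2 => //; exact: subgroup1.
Qed.
Lemma subgroupM x y :
  subgroup_set H x -> subgroup_set H y -> subgroup_set H (x * y)%g.
Proof.
move=> Hx Hy; rewrite -[y]invgK.
by apply: (subgroupP H).2 => //; exact: subgroupV.
Qed.

Definition subgroup_mk (x : G) (Hx : subgroup_set H x) : subgroup_type :=
  SigSub (mem_set Hx).
Definition subgroup_val (x : subgroup_type) : G := set_val (x : set_type H).

Lemma subgroup_valP (x : subgroup_type) :
  subgroup_set H (subgroup_val x).
Proof. exact: set_valP. Qed.
Lemma subgroup_val_inj : injective subgroup_val.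
Proof. exact: val_inj. Qed.

Let one := subgroup_mk subgroup1.
Let inv x := subgroup_mk (subgroupV (subgroup_valP x)).
Let mul x y := subgroup_mk (subgroupM (subgroup_valP x) (subgroup_valP y)).

Let mulA : associative mul.
Proof. by move=> x y z; apply: subgroup_val_inj; exact: mulgA. Qed.
Let mul1 : left_id one mul.
Proof. by move=> x; apply: subgroup_val_inj; exact: mul1g. Qed.
Let mulr1 : right_id one mul.
Proof. by move=> x; apply: subgroup_val_inj; exact: mulg1. Qed.
Let mulVr : left_inverse one inv mul.
Proof. by move=> x; apply: subgroup_val_inj; exact: mulVg. Qed.
Let mulrV : right_inverse one inv mul.
Proof. by move=> x; apply: subgroup_val_inj; exact: mulgV. Qed.

HB.instance Definition _ :=
  isGroup.Build subgroup_type mulA mul1 mulr1 mulVr mulrV.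

End SubgroupType.

HB.instance Definition _ (G : groupSpaceType) (H : subgroup G) :=
  Topological.copy (subgroup_type H) (set_type H).

Section CosetSpace.
Variables (G : groupSpaceType) (H : subgroup G).

Definition coset_rel : rel G := fun x y => `[< subgroup_set H (x^-1 * y)%g >].

Lemma coset_rel_refl : reflexive coset_rel.
Proof. by move=> x; apply/asboolP; rewrite mulVg; exact: subgroup1. Qed.
Lemma coset_rel_sym : symmetric coset_rel.
Proof.
move=> x y; apply/asboolP/asboolP => /subgroupV; by rewrite invgM invgK.
Qed.
Lemma coset_rel_trans : transitive coset_rel.
Proof.
move=> y x z /asboolP xy /asboolP yz; apply/asboolP.
by have := subgroupM xy yz; rewrite -mulgA mulVKg.
Qed.

Canonical coset_equiv :=
  EquivRel coset_rel coset_rel_refl coset_rel_sym coset_rel_trans.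

Definition coset_space : topologicalType :=
  quotient_topology {eq_quot coset_equiv}.
Definition coset (x : G) : coset_space :=
  \pi_({eq_quot coset_equiv}) x.
End CosetSpace.

Record group_involution (G : groupType) := GroupInvolution {
  inv_fun :> G -> G;
  inv_funM : forall x y, inv_fun (x * y)%g = (inv_fun x * inv_fun y)%g;
  inv_funK : forall x, inv_fun (inv_fun x) = x }.

Section Fixed.
Variables (G : groupType) (Theta : group_involution G).

Lemma inv_fun1 : Theta 1%g = 1%g.
Proof. by apply: (@mulgI _ (Theta 1%g)); rewrite -inv_funM !mulg1. Qed.

Lemma inv_funV x : Theta x^-1%g = ((Theta x)^-1)%g.
Proof. by apply: (@mulgI _ (Theta x)); rewrite -inv_funM !mulgV inv_fun1. Qed.

Lemma fixed_is_subgroup : is_subgroup [set x | Theta x = x].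
Proof.
split => /= [|x y hx hy]; first exact: inv_fun1.
by rewrite inv_funM inv_funV hx hy.
Qed.

Definition fixed_subgroup : subgroup G := Subgroup fixed_is_subgroup.
End Fixed.

(* X = G/K, K = G^Theta, is a symmetric space on which G acts by automorphisms;
   mu and act are determined by their values since coset is surjective. *)
Definition symmetric_coset_space (G : groupSpaceType)
    (Theta : group_involution G) : Prop :=
  let K := fixed_subgroup Theta in
  exists (mu : coset_space K -> coset_space K -> coset_space K)
         (act : G -> coset_space K -> coset_space K),
  [/\ forall g h : G,
        mu (coset K g) (coset K h) = coset K (g * (Theta g)^-1 * Theta h)%g,
      loos_symmetric_space mu,
      forall g h : G, act g (coset K h) = coset K (g * h)%g,
      forall g : G, Sym mu (act g)
    & act 1%g =1 id /\ forall g h : G, act (g * h)%g =1 act g \o act h].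

Definition is_group_topology (G : groupType) (Tc : Topological G) : Prop :=
  let TG := Topological.Pack Tc in
  continuous (fun p : (TG * TG)%type => ((p.1 : G) * (p.2 : G))%g : TG) /\
  continuous (fun x : TG => ((x : G)^-1)%g : TG).

(* Group topologies are stable under suprema, so the finest one satisfying
   a family of continuity conditions for maps into G is the supremum of all
   those that do.  (Universe levels prevent indexing sup_topology by these
   topologies, hence the explicit subbase.) *)
Section FinalGroup.
Variables (G : groupType) (adm : Topological G -> Prop).

Definition final_group (_ : Topological G -> Prop) : Type := G.
HB.instance Definition _ := Group.copy (final_group adm) G.

Definition final_subbase : set (set G) :=
  [set U : set G | exists Tc : Topological G,
    [/\ is_group_topology Tc, adm Tc & @open (Topological.Pack Tc) U]].

HB.instance Definition _ :=
  isSubBaseTopological.Build (final_group adm) final_subbase id.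
End FinalGroup.

Record generalized_cartan n (A : 'M[int]_n) : Prop := {
  gcm_diag : forall i, A i i = 2;
  gcm_offdiag : forall i j, i != j -> A i j <= 0;
  gcm_zero : forall i j, A i j = 0 <-> A j i = 0 }.

Definition indecomposable n (A : 'M[int]_n) : Prop :=
  forall J : {set 'I_n},
    (forall i j, i \in J -> j \notin J -> A i j = 0 /\ A j i = 0) ->
    J = finset.set0 \/ J = [set: 'I_n]%SET.

Definition symmetrizable (R : realType) n (A : 'M[int]_n) : Prop :=
  exists (d : 'rV[R]_n) (B : 'M[R]_n),
    [/\ forall i, d 0 i != 0, B^T = B
      & map_mx (intr : int -> R) A = diag_mx d *m B].

Definition lattice_rank n (A : 'M[int]_n) : nat :=
  (2 * n - \rank (map_mx (intr : int -> rat) A))%N.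

(* Lambda = 'rV[int]_m and its Z-dual 'cV[int]_m, i.e. a basis of Lambda has
   been chosen; the pairing is the matrix product. *)
Definition pairing m (lam : 'rV[int]_m) (v : 'cV[int]_m) : int := (lam *m v) 0 0.

Record root_datum n (A : 'M[int]_n) := RootDatum {
  rd_c : 'I_n -> 'rV[int]_(lattice_rank A);
  rd_h : 'I_n -> 'cV[int]_(lattice_rank A);
  rd_v : 'I_(lattice_rank A) -> 'cV[int]_(lattice_rank A);
  rd_c_free : forall k : 'I_n -> int,
    \sum_i k i *: rd_c i = 0 -> forall i, k i = 0;
  rd_h_free : forall k : 'I_n -> int,
    \sum_i k i *: rd_h i = 0 -> forall i, k i = 0;
  rd_cartan : forall i j, pairing (rd_c j) (rd_h i) = A i j;
  rd_v_basis : (\matrix_(i, j) rd_v j i 0) \in unitmx;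
  rd_v_h : forall (j : 'I_(lattice_rank A)) (i : 'I_n),
    j = i :> nat -> rd_v j = rd_h i }.

(* (w, i, true) stands for w(alpha_i), (w, i, false) for w(- alpha_i). *)
Definition root_index (n : nat) : Type := (seq 'I_n * 'I_n * bool)%type.
HB.instance Definition _ n :=
  Equality.copy (root_index n) (seq 'I_n * 'I_n * bool)%type.

Section Weyl.
Variables (n : nat) (A : 'M[int]_n) (D : root_datum A).
Local Notation m := (lattice_rank A).
Local Notation c := (rd_c D).
Local Notation h := (rd_h D).

Definition simple_reflection (i : 'I_n) (lam : 'rV[int]_m) : 'rV[int]_m :=
  lam - pairing lam (h i) *: c i.

Definition weyl_word (w : seq 'I_n) (lam : 'rV[int]_m) : 'rV[int]_m :=
  foldr simple_reflection lam w.

Definition root_lattice (q : 'rV[int]_n) : 'rV[int]_m :=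
  \sum_i q 0 i *: c i.

Definition is_real_root (lam : 'rV[int]_m) : Prop :=
  exists w i, lam = weyl_word w (c i).

Definition is_positive (lam : 'rV[int]_m) : Prop :=
  exists k : 'I_n -> nat, lam = \sum_i (k i : int) *: c i.

Definition prenilpotent (lam mu : 'rV[int]_m) : Prop :=
  (exists w, is_positive (weyl_word w lam) /\ is_positive (weyl_word w mu)) /\
  (exists w, is_positive (- weyl_word w lam) /\
             is_positive (- weyl_word w mu)).

Definition root_of (a : root_index n) : 'rV[int]_m :=
  let: (w, i, pos) := a in weyl_word w (if pos then c i else - c i).

End Weyl.

(* T(F) = Hom(Lambda, F^* ) in the coordinates of Lambda^vee = Z^m. *)
Section Torus.
Variables (m : nat) (F : comUnitRingType).

Definition torus : set 'rV[F]_m := [set t | forall j, t 0 j \is a GRing.unit].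

Definition torus_mul (s t : 'rV[F]_m) : 'rV[F]_m := map2_mx *%R s t.

(* t, as a homomorphism from Lambda to the units *)
Definition torus_eval (t : 'rV[F]_m) (lam : 'rV[int]_m) : F :=
  \prod_j t 0 j ^ lam 0 j.

(* r^v *)
Definition torus_pow (r : F) (v : 'cV[int]_m) : 'rV[F]_m :=
  \row_j r ^ v j 0.

End Torus.

Definition torus_reflection n (A : 'M[int]_n) (D : root_datum A)
    (F : comUnitRingType) (i : 'I_n) (t : 'rV[F]_(lattice_rank A)) :
    'rV[F]_(lattice_rank A) :=
  \row_j torus_eval t (simple_reflection D i (delta_mx 0 j)).

Record lieAlgType (k : fieldType) := LieAlgType {
  lie_sort :> lmodType k;
  bracket : lie_sort -> lie_sort -> lie_sort;
  bracket_linear_l : forall z (a : k) x y,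
    bracket (a *: x + y) z = a *: bracket x z + bracket y z;
  bracket_linear_r : forall z (a : k) x y,
    bracket z (a *: x + y) = a *: bracket z x + bracket z y;
  bracketxx : forall x, bracket x x = 0;
  jacobi : forall x y z,
    bracket x (bracket y z) + bracket y (bracket z x)
      + bracket z (bracket x y) = 0 }.

Definition lie_morphism (k : fieldType) (L L' : lieAlgType k)
    (f : L -> L') : Prop :=
  linear f /\ forall x y, f (bracket x y) = bracket (f x) (f y).

Definition derived_algebra (k : fieldType) (L : lieAlgType k) : set L :=
  [set x | exists s : seq (L * L), x = \sum_(p <- s) bracket p.1 p.2].

(* exp(ad x) y, for y killed by a power of ad x *)
Definition exp_ad (k : fieldType) (L : lieAlgType k) (x y : L) : L :=
  xget 0 [set z | exists N : nat, iter N (bracket x) y = 0 /\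
    z = \sum_(j < N) (j`!%:R)^-1 *: iter j (bracket x) y].

Section KacMoodyAlgebra.
Variables (n : nat) (A : 'M[int]_n) (D : root_datum A) (k : fieldType).
Local Notation m := (lattice_rank A).

Definition cartan_eval (lam : 'rV[int]_m) (h : 'cV[k]_m) : k :=
  (map_mx (intr : int -> k) lam *m h) 0 0.

Definition coroot (i : 'I_n) : 'cV[k]_m := map_mx (intr : int -> k) (rd_h D i).

Record kac_moody_relations (L : lieAlgType k)
    (h : 'cV[k]_m -> L) (e f : 'I_n -> L) : Prop := {
  km_h_linear : linear h;
  km_hh : forall x y, bracket (h x) (h y) = 0;
  km_he : forall x i, bracket (h x) (e i) = cartan_eval (rd_c D i) x *: e i;
  km_hf : forall x i, bracket (h x) (f i) = - cartan_eval (rd_c D i) x *: f i;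
  km_ef : forall i j, bracket (e i) (f j) = - ((i == j)%:R *: h (coroot i));
  km_serre_e : forall i j, i != j ->
    iter `|1 - A i j|%N (bracket (e i)) (e j) = 0;
  km_serre_f : forall i j, i != j ->
    iter `|1 - A i j|%N (bracket (f i)) (f j) = 0 }.

(* Generators and relations, through the universal property. *)
Record kac_moody_algebra := KacMoodyAlgebra {
  km_lie :> lieAlgType k;
  km_h : 'cV[k]_m -> km_lie;
  km_e : 'I_n -> km_lie;
  km_f : 'I_n -> km_lie;
  km_rel : kac_moody_relations km_h km_e km_f;
  km_universal : forall (L : lieAlgType k) h e f,
    @kac_moody_relations L h e f ->
    exists phi : km_lie -> L,
      let extends psi := [/\ lie_morphism psi, forall x, psi (km_h x) = h x,
        forall i, psi (km_e i) = e i & forall i, psi (km_f i) = f i] in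
      extends phi /\ forall psi, extends psi -> psi =1 phi }.

Variable g : kac_moody_algebra.

(* s_i^* = exp(ad e_i) exp(ad f_i) exp(ad e_i) *)
Definition lie_reflection (i : 'I_n) (x : g) : g :=
  exp_ad (km_e g i) (exp_ad (km_f g i) (exp_ad (km_e g i) x)).

Definition root_vector (a : root_index n) : g :=
  let: (w, i, pos) := a in
  foldr lie_reflection (if pos then km_e g i else km_f g i) w.

End KacMoodyAlgebra.

Section TitsPresentation.
Variables (n : nat) (A : 'M[int]_n) (D : root_datum A) (k : fieldType).
Variable g : kac_moody_algebra D k.
Local Notation m := (lattice_rank A).

Section RootSubgroups.
Variables (F : comUnitRingType) (H : groupType) (x y : 'I_n -> F -> H).

Definition tits_s (i : 'I_n) (r : F) : H := (x i r * y i r^-1 * x i r)%g.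

Definition tits_word (w : seq 'I_n) : H :=
  foldr (fun i z => tits_s i 1 * z)%g 1%g w.

Definition root_elt (a : root_index n) (r : F) : H :=
  let: (w, i, pos) := a in
  (tits_word w * (if pos then x i r else y i r) * (tits_word w)^-1)%g.

End RootSubgroups.

(* Root subgroups are parametrized by root_elt.  Two indices of one root give
   parameters that agree up to the sign relating the root vectors, and the
   integral constants of the commutator relations of prenilpotent pairs are
   those of the corresponding identity of automorphisms of g(A): an entry
   (p, q, d, u) of s stands for x_d(u r^p t^q), where d has root p a + q b. *)
Record tits_relations (F : fieldType) (H : groupType) (x y : 'I_n -> F -> H)
    (eta : 'rV[F]_m -> H) : Prop := {
  tits_xD : forall i r t, x i (r + t) = (x i r * x i t)%g;
  tits_yD : forall i r t, y i (r + t) = (y i r * y i t)%g;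
  tits_etaM : forall s t, torus s -> torus t ->
    eta (torus_mul s t) = (eta s * eta t)%g;
  tits_tx : forall i t r, torus t ->
    (eta t * x i r * (eta t)^-1)%g = x i (torus_eval t (rd_c D i) * r);
  tits_ty : forall i t r, torus t ->
    (eta t * y i r * (eta t)^-1)%g = y i (torus_eval t (- rd_c D i) * r);
  tits_st : forall i t, torus t ->
    (tits_s x y i 1 * eta t * (tits_s x y i 1)^-1)%g
      = eta (torus_reflection D i t);
  tits_sr : forall i r, r != 0 ->
    tits_s x y i r^-1 = (tits_s x y i 1 * eta (torus_pow r (rd_h D i)))%g;
  tits_coherent : forall (a b : root_index n) (eps : bool) r,
    root_vector g a = (-1) ^+ eps *: root_vector g b ->
    root_elt x y a r = root_elt x y b ((-1) ^+ eps * r);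
  tits_commutator : forall (a b : root_index n)
      (s : seq (nat * nat * root_index n * int)),
    prenilpotent D (root_of D a) (root_of D b) ->
    (forall p q d u, (p, q, d, u) \in s ->
       [/\ (0 < p)%N, (0 < q)%N
         & root_of D d = root_of D a *+ p + root_of D b *+ q]) ->
    (forall (r t : k) (z : g),
       exp_ad (r *: root_vector g a) (exp_ad (t *: root_vector g b)
         (exp_ad (- r *: root_vector g a)
           (exp_ad (- t *: root_vector g b) z)))
       = foldr (fun '(p, q, d, u) =>
                  exp_ad ((u%:~R * r ^+ p * t ^+ q) *: root_vector g d))
               z s) ->
    forall r t : F,
      (root_elt x y a r * root_elt x y b t
         * (root_elt x y a r)^-1 * (root_elt x y b t)^-1)%g
      = foldr (fun '(p, q, d, u) z =>
                 (root_elt x y d (u%:~R * r ^+ p * t ^+ q) * z)%g) 1%g s }.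

Definition tits_presented (F : fieldType) (H : groupType)
    (x y : 'I_n -> F -> H) (eta : 'rV[F]_m -> H) : Prop :=
  tits_relations x y eta /\
  forall (H' : groupType) x' y' eta', @tits_relations F H' x' y' eta' ->
  exists phi : H -> H',
    let extends (psi : H -> H') :=
      [/\ forall u v, psi (u * v)%g = (psi u * psi v)%g,
          forall i r, psi (x i r) = x' i r, forall i r, psi (y i r) = y' i r
        & forall t, torus t -> psi (eta t) = eta' t] in
    extends phi /\ forall psi, extends psi -> psi =1 phi.

End TitsPresentation.

(* Commutative rings are comUnitRingType: non-zero, with a unit test. *)
Record group_functor := GroupFunctor {
  gf_obj :> comUnitRingType -> groupType;
  gf_map : forall S S' : comUnitRingType,
    {rmorphism S -> S'} -> gf_obj S -> gf_obj S';
  gf_mapM : forall (S S' : comUnitRingType) (f : {rmorphism S -> S'}) x y,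
    gf_map f (x * y)%g = (gf_map f x * gf_map f y)%g;
  gf_map_id : forall (S : comUnitRingType) (f : {rmorphism S -> S}),
    f =1 id -> gf_map f =1 id;
  gf_map_comp : forall (S S' S'' : comUnitRingType)
      (f : {rmorphism S -> S'}) (f' : {rmorphism S' -> S''})
      (f'' : {rmorphism S -> S''}),
    f'' =1 f' \o f -> gf_map f'' =1 gf_map f' \o gf_map f }.
Arguments gf_map G {S S'} f x : rename.

Definition mx22 (F : pzRingType) (a b c d : F) : 'M[F]_2 :=
  \matrix_(i, j) if i == 0 then (if j == 0 then a else b)
                 else (if j == 0 then c else d).

Definition SL2 (F : comPzRingType) : set 'M[F]_2 := [set M | \det M = 1].

Section TitsFunctor.
Variables (R : realType) (n : nat) (A : 'M[int]_n) (D : root_datum A).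
Local Notation m := (lattice_rank A).
Variable g : kac_moody_algebra D R[i].

(* phi and eta are only meaningful on SL2 and torus. *)
Record tits_data := TitsData {
  td_functor :> group_functor;
  td_phi : forall F : comUnitRingType, 'I_n -> 'M[F]_2 -> td_functor F;
  td_eta : forall F : comUnitRingType, 'rV[F]_m -> td_functor F;
  td_phiM : forall (F : comUnitRingType) (i : 'I_n) (M N : 'M[F]_2),
    SL2 M -> SL2 N ->
    td_phi i (M *m N) = (td_phi i M * td_phi i N)%g;
  td_phi_natural : forall (F F' : comUnitRingType) (f : {rmorphism F -> F'})
    (i : 'I_n) (M : 'M[F]_2), SL2 M ->
    gf_map td_functor f (td_phi i M) = td_phi i (map_mx f M);
  td_etaM : forall (F : comUnitRingType) (s t : 'rV[F]_m), torus s -> torus t ->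
    td_eta (torus_mul s t) = (td_eta s * td_eta t)%g;
  td_eta_natural : forall (F F' : comUnitRingType) (f : {rmorphism F -> F'})
    (t : 'rV[F]_m), torus t ->
    gf_map td_functor f (td_eta t) = td_eta (map_mx f t) }.
Arguments td_phi G {F} i M : rename.
Arguments td_eta G {F} t : rename.

Section RootGroups.
Variables (G : tits_data) (F : comUnitRingType).

Definition x_pos (i : 'I_n) (r : F) : G F := td_phi G i (mx22 1 r 0 1).
Definition x_neg (i : 'I_n) (r : F) : G F := td_phi G i (mx22 1 0 (- r) 1).

Definition torus_subgroup : set (G F) :=
  [set x | exists2 t, torus t & x = td_eta G t].

(* U_(w alpha_i); it does not depend on the word chosen for w *)
Definition root_group (w : seq 'I_n) (i : 'I_n) : set (G F) :=
  [set x | exists r, x = root_elt x_pos x_neg (w, i, true) r].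

Definition U_plus : set (G F) :=
  generated [set x | exists w i,
    is_positive D (weyl_word D w (rd_c D i)) /\ root_group w i x].

Definition B_plus : set (G F) :=
  [set x | exists t u, [/\ torus_subgroup t, U_plus u & x = (t * u)%g]].

End RootGroups.

(* Ad g is an automorphism of [g(A), g(A)], given as a map on g(A) whose
   values matter on [g(A), g(A)] only. *)
Record is_adjoint (G : tits_data) (Ad : G R[i] -> g -> g) : Prop := {
  ad_stable : forall u x, derived_algebra x -> derived_algebra (Ad u x);
  ad_linear : forall u (a : R[i]) x y,
    derived_algebra x -> derived_algebra y ->
    Ad u (a *: x + y) = a *: Ad u x + Ad u y;
  ad_bracket : forall u x y, derived_algebra x -> derived_algebra y ->
    Ad u (bracket x y) = bracket (Ad u x) (Ad u y);
  ad_one : forall x, derived_algebra x -> Ad 1%g x = x;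
  ad_mul : forall u v x, derived_algebra x -> Ad (u * v)%g x = Ad u (Ad v x);
  ad_kernel : forall u, (forall x, derived_algebra x -> Ad u x = x) ->
    torus_subgroup u;
  ad_upper : forall i c x, derived_algebra x ->
    Ad (td_phi G i (mx22 1 c 0 1)) x = exp_ad (c *: km_e g i) x;
  ad_lower : forall i c x, derived_algebra x ->
    Ad (td_phi G i (mx22 1 0 c 1)) x = exp_ad (- c *: km_f g i) x;
  ad_torus_e : forall t i, torus t ->
    Ad (td_eta G t) (km_e g i) = torus_eval t (rd_c D i) *: km_e g i;
  ad_torus_f : forall t i, torus t ->
    Ad (td_eta G t) (km_f g i) = torus_eval t (- rd_c D i) *: km_f g i }.

Record tits_functor := TitsFunctor {
  tf_data :> tits_data;
  tf_generated : forall (F : fieldType) (x : tf_data F),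
    generated ([set x | exists i M, SL2 M /\ x = td_phi tf_data i M]
                 `|` @torus_subgroup tf_data F) x;
  tf_eta_inj : forall (F : comUnitRingType) (s t : 'rV[F]_m),
    torus s -> torus t -> td_eta tf_data s = td_eta tf_data t -> s = t;
  tf_phi_diag : forall (F : comUnitRingType) i (r : F), r \is a GRing.unit ->
    td_phi tf_data i (mx22 r 0 0 r^-1)
      = td_eta tf_data (torus_pow r (rd_h D i));
  tf_map_inj : forall (S : comUnitRingType) (F : fieldType)
    (f : {rmorphism S -> F}), injective f -> injective (gf_map tf_data f);
  tf_adjoint : exists Ad, @is_adjoint tf_data Ad;
  (* non-degeneracy, in the form of agreement with Tits's presentation *)
  tf_nondegenerate : forall F : fieldType,
    tits_presented g (@x_pos tf_data F) (@x_neg tf_data F)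
      (fun t => td_eta tf_data t) }.

(* The Kac-Peterson topology is the final group topology for phi_i and eta. *)
Section KacPeterson.
Variables (G : tits_functor) (K : numFieldType).

Definition kac_peterson_admissible (Tc : Topological (G K)) : Prop :=
  (forall i, {within @SL2 K, continuous
     (fun M : 'M[K]_2 => td_phi G i M : Topological.Pack Tc)}) /\
  {within @torus m K, continuous
     (fun t : 'rV[K]_m => td_eta G t : Topological.Pack Tc)}.

Definition kac_peterson : groupSpaceType :=
  final_group kac_peterson_admissible.

Record cartan_chevalley (bar : K -> K) := CartanChevalley {
  cc_fun :> group_involution kac_peterson;
  cc_continuous : continuous cc_fun;
  cc_pos : forall i r, cc_fun (x_pos G i r) = x_neg G i (bar r);
  cc_neg : forall i r, cc_fun (x_neg G i r) = x_pos G i (bar r);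
  cc_torus : forall j (r : K), r != 0 ->
    cc_fun (td_eta G (torus_pow r (rd_v D j)))
      = td_eta G (torus_pow (bar r) (- rd_v D j)) }.

End KacPeterson.

(* Commutative k-algebras, as commutative rings under k. *)
Record comAlg (k : comUnitRingType) := ComAlg {
  ca_ring :> comUnitRingType;
  ca_struct : {rmorphism k -> ca_ring} }.

Record comAlg_hom (k : comUnitRingType) (S S' : comAlg k) := ComAlgHom {
  ca_fun :> {rmorphism S -> S'};
  ca_funP : forall a, ca_fun (ca_struct S a) = ca_struct S' a }.

Definition restrict_scalars (S : comAlg R[i]) : comAlg R :=
  @ComAlg R S (ca_struct S \o real_complex R : {rmorphism R -> S}).

Definition restrict_hom (S S' : comAlg R[i]) (f : comAlg_hom S S') :
    comAlg_hom (restrict_scalars S) (restrict_scalars S') :=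
  @ComAlgHom R (restrict_scalars S) (restrict_scalars S') f
    (fun a => ca_funP f (real_complex R a)).

Definition real_alg : comAlg R := @ComAlg R R (idfun : {rmorphism R -> R}).
Definition complex_calg : comAlg R[i] :=
  @ComAlg R[i] R[i] (idfun : {rmorphism R[i] -> R[i]}).
Definition complex_alg : comAlg R := restrict_scalars complex_calg.
Definition real_to_complex : comAlg_hom real_alg complex_alg :=
  @ComAlgHom R real_alg complex_alg (real_complex R : {rmorphism R -> R[i]})
    (fun=> erefl).

(* Gal(C/R): every R-algebra endomorphism of C is an automorphism. *)
Definition galois : Type := comAlg_hom complex_alg complex_alg.

Record alg_group_functor := AlgGroupFunctor {
  af_obj :> comAlg R -> groupType;
  af_map : forall S S' : comAlg R, comAlg_hom S S' -> af_obj S -> af_obj S';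
  af_mapM : forall (S S' : comAlg R) (f : comAlg_hom S S') x y,
    af_map f (x * y)%g = (af_map f x * af_map f y)%g;
  af_map_id : forall (S : comAlg R) (f : comAlg_hom S S),
    f =1 id -> af_map f =1 id;
  af_map_comp : forall (S S' S'' : comAlg R) (f : comAlg_hom S S')
      (f' : comAlg_hom S' S'') (f'' : comAlg_hom S S''),
    f'' =1 f' \o f -> af_map f'' =1 af_map f' \o af_map f }.
Arguments af_map F {S S'} f x : rename.

Record real_form (G : tits_functor) := RealForm {
  rf_functor :> alg_group_functor;
  rf_to : forall S : comAlg R[i], rf_functor (restrict_scalars S) -> G S;
  rf_from : forall S : comAlg R[i], G S -> rf_functor (restrict_scalars S);
  rf_toK : forall S, cancel (@rf_to S) (@rf_from S);
  rf_fromK : forall S, cancel (@rf_from S) (@rf_to S);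
  rf_toM : forall S (x y : rf_functor (restrict_scalars S)),
    rf_to (x * y)%g = (rf_to x * rf_to y)%g;
  rf_natural : forall (S S' : comAlg R[i]) (f : comAlg_hom S S')
    (x : rf_functor (restrict_scalars S)),
    rf_to (af_map rf_functor (restrict_hom f) x)
      = gf_map G (ca_fun f) (rf_to x) }.

Section Forms.
Variables (G : tits_functor) (F : real_form G).
Local Notation GC := (G R[i]).

(* the action of a Galois automorphism on G(C) = F(C) *)
Definition galois_act (s : galois) (x : GC) : GC :=
  @rf_to _ F complex_calg (af_map F s (@rf_from _ F complex_calg x)).

Definition form_points (x : F real_alg) : GC :=
  @rf_to _ F complex_calg (af_map F real_to_complex x).

Record enveloping_algebra := EnvelopingAlgebra {
  ea_alg :> algType R[i];
  ea_in : g -> ea_alg;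
  ea_in_linear : linear ea_in;
  ea_in_bracket : forall x y,
    ea_in (bracket x y) = ea_in x * ea_in y - ea_in y * ea_in x;
  ea_universal : forall (B : algType R[i]) (f : g -> B), linear f ->
    (forall x y, f (bracket x y) = f x * f y - f y * f x) ->
    exists phi : {lrmorphism ea_alg -> B}, (forall x, phi (ea_in x) = f x) /\
      forall psi : {lrmorphism ea_alg -> B},
        (forall x, psi (ea_in x) = f x) -> psi =1 phi }.

Definition real_subalgebra_form (U : algType R[i]) (UR : set U) : Prop :=
  [/\ UR 1,
      forall x y, UR x -> UR y -> UR (x * y),
      forall (a : R) x y, UR x -> UR y -> UR (a%:C%C *: x + y)
    & forall u, exists! p : U * U,
        [/\ UR p.1, UR p.2 & u = p.1 + 'i%C *: p.2]].

(* the semilinear action of s on U = UR (x) C *)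
Definition is_galois_on (U : algType R[i]) (UR : set U) (s : galois)
    (f : U -> U) : Prop :=
  [/\ forall u, UR u -> f u = u, forall u v, f (u + v) = f u + f v
    & forall (z : R[i]) u, f (z *: u) = (s z : R[i]) *: f u].

Record is_adjoint_env (U : enveloping_algebra) (AdU : GC -> {lrmorphism U -> U})
    : Prop := {
  adU_one : AdU 1%g =1 id;
  adU_mul : forall u v, AdU (u * v)%g =1 AdU u \o AdU v;
  adU_upper : forall i c x,
    AdU (td_phi G i (mx22 1 c 0 1)) (ea_in U x)
      = ea_in U (exp_ad (c *: km_e g i) x);
  adU_lower : forall i c x,
    AdU (td_phi G i (mx22 1 0 c 1)) (ea_in U x)
      = ea_in U (exp_ad (- c *: km_f g i) x);
  adU_torus_h : forall t h, torus t ->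
    AdU (td_eta G t) (ea_in U (km_h g h)) = ea_in U (km_h g h);
  adU_torus_e : forall t i, torus t ->
    AdU (td_eta G t) (ea_in U (km_e g i))
      = torus_eval t (rd_c D i) *: ea_in U (km_e g i);
  adU_torus_f : forall t i, torus t ->
    AdU (td_eta G t) (ea_in U (km_f g i))
      = torus_eval t (- rd_c D i) *: ea_in U (km_f g i) }.

Record prealgebraic := Prealgebraic {
  pa_env : enveloping_algebra;
  pa_real : set pa_env;
  pa_realP : real_subalgebra_form pa_real;
  pa_act : galois -> pa_env -> pa_env;
  pa_actP : forall s, is_galois_on pa_real s (pa_act s);
  pa_Ad : GC -> {lrmorphism pa_env -> pa_env};
  pa_AdP : is_adjoint_env pa_Ad;
  pa_equivariant : forall s x u,
    pa_act s (pa_Ad x u) = pa_Ad (galois_act s x) (pa_act s u);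
  pa_injective : forall (k : fieldType) (i : {rmorphism R -> k})
    (j : comAlg_hom (@ComAlg R k i) complex_alg), injective (af_map F j) }.

(* c_{x^-1} o s *)
Definition rectified (s : galois) (x : GC) (y : GC) : GC :=
  (x^-1 * galois_act s y * x)%g.

Definition stabilizes_torus (f : GC -> GC) : Prop :=
  forall y, torus_subgroup y <-> torus_subgroup (f y).

(* the component of degree q of the Q-gradation: weight spaces of ad h *)
Definition graded (U : enveloping_algebra) (q : 'rV[int]_n) : set U :=
  [set u | forall h, ea_in U (km_h g h) * u - u * ea_in U (km_h g h)
                     = cartan_eval (root_lattice D q) h *: u].

Record algebraic (P : prealgebraic) : Prop := {
  al_rectifiable : forall s, exists x, stabilizes_torus (rectified s x);
  al_SGR : forall s x, stabilizes_torus (rectified s x) ->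
    forall w i, exists w' i', forall y,
      root_group w i y <-> root_group w' i' (rectified s x y);
  (* rectified s x acts on the enveloping algebra as Ad(x^-1) o s *)
  al_gradation : forall s x, stabilizes_torus (rectified s x) ->
    exists pi : 'rV[int]_n -> 'rV[int]_n,
      [/\ bijective pi,
          forall q (u : pa_env P), graded q u <->
            graded (pi q) (pa_Ad P x^-1%g (pa_act s u))
        & forall q k, is_real_root D (root_lattice D q) ->
            pi (q *+ k) = pi q *+ k];
  (* s acts on characters by s o lam o s^-1, on cocharacters by s o v o s^-1 *)
  al_characters : forall s x, stabilizes_torus (rectified s x) ->
    let compatible lam lam' := forall t t' : 'rV[R[i]]_m,
      torus t -> torus t' -> td_eta G t' = rectified s x (td_eta G t) ->
      torus_eval t' lam' = s (torus_eval t lam) in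
    (forall lam, exists lam', compatible lam lam') /\
    (forall lam', exists lam, compatible lam lam');
  al_cocharacters : forall s x, stabilizes_torus (rectified s x) ->
    let compatible v v' := forall r : R[i], r != 0 ->
      rectified s x (td_eta G (torus_pow r v))
        = td_eta G (torus_pow (s r : R[i]) v') in
    (forall v, exists v', compatible v v') /\
    (forall v', exists v, compatible v v') }.

Record almost_split := AlmostSplit {
  as_prealgebraic : prealgebraic;
  as_algebraic : algebraic as_prealgebraic;
  as_borel : forall s, exists x : GC, forall y : GC,
    B_plus y <-> B_plus (x^-1 * galois_act s y * x)%g }.

Record is_diagonal (d d' : GC -> GC) : Prop := {
  dg_K : cancel d d';
  dg_K' : cancel d' d;
  dg_M : forall x y, d (x * y)%g = (d x * d y)%g;
  dg_torus : forall x, torus_subgroup x -> d x = x;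
  dg_root : forall w i, exists2 k : R[i], k != 0 & forall r,
    let xa := root_elt (@x_pos G R[i]) (@x_neg G R[i]) (w, i, true) in
    d (xa r) = xa (k * r) }.

(* The Galois automorphisms, rectified and conjugated by a diagonal
   automorphism d so as to commute with Theta. *)
Record normalization (Theta : GC -> GC) := Normalization {
  nm_rect : galois -> GC;
  nm_diag : GC -> GC;
  nm_diag' : GC -> GC;
  nm_diagP : is_diagonal nm_diag nm_diag';
  nm_rectP : forall s, stabilizes_torus (rectified s (nm_rect s));
  nm_act : galois -> GC -> GC :=
    fun s y => nm_diag (rectified s (nm_rect s) (nm_diag' y));
  nm_group : forall s t, exists u, forall y,
    nm_act s (nm_act t y) = nm_act u y;
  nm_Theta : forall s y, nm_act s (Theta y) = Theta (nm_act s y) }.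

Section Fixed.
Variables (Theta : GC -> GC) (N : normalization Theta).

Definition gamma_fixed : set GC := [set y | forall s, nm_act N s y = y].

(* Rectification and diagonal conjugation replace the embedding of F(R) in
   G(C) by its composite with an inner automorphism and with d. *)
Definition DCS : Prop := exists x : GC,
  gamma_fixed = [set nm_diag N (x^-1 * form_points y * x)%g | y in setT].

Lemma rf_fromM (S : comAlg R[i]) (x y : G S) :
  @rf_from _ F S (x * y)%g = (@rf_from _ F S x * @rf_from _ F S y)%g.
Proof. by apply: (can_inj (@rf_toK _ F S)); rewrite rf_toM !rf_fromK. Qed.

Lemma nm_actM s x y : nm_act N s (x * y)%g = (nm_act N s x * nm_act N s y)%g.
Proof.
have dM' u v : nm_diag' N (u * v)%g = (nm_diag' N u * nm_diag' N v)%g.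
  apply: (can_inj (dg_K (nm_diagP N))).
  by rewrite (dg_M (nm_diagP N)) !(dg_K' (nm_diagP N)).
rewrite /nm_act -(dg_M (nm_diagP N)) dM'; congr (nm_diag N _).
by rewrite /rectified /galois_act rf_fromM af_mapM rf_toM !mulgA mulgK.
Qed.

Lemma gamma_fixed_subgroup : is_subgroup gamma_fixed.
Proof.
have act1 s : nm_act N s 1%g = 1%g.
  by apply: (@mulgI _ (nm_act N s 1%g)); rewrite -nm_actM !mulg1.
have actV s x : nm_act N s x^-1%g = ((nm_act N s x)^-1)%g.
  by apply: (@mulgI _ (nm_act N s x)); rewrite -nm_actM !mulgV act1.
by split => [s|x y hx hy s] //; rewrite nm_actM actV hx hy.
Qed.

End Fixed.

Section AlmostSplitPoints.
Variables (Theta : cartan_chevalley G (@conjc R)) (N : normalization Theta).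

Definition almost_split_subgroup : subgroup (kac_peterson G R[i]) :=
  @Subgroup (kac_peterson G R[i]) (gamma_fixed N) (gamma_fixed_subgroup N).

(* G(R) = G^Gamma with the topology induced from G(C) *)
Definition almost_split_points : groupSpaceType :=
  subgroup_type almost_split_subgroup.

Lemma Theta_gamma_fixed (x : almost_split_points) :
  gamma_fixed N (Theta (subgroup_val x)).
Proof. by move=> s; rewrite nm_Theta (subgroup_valP x s). Qed.

Definition almost_split_Theta_fun (x : almost_split_points) :
    almost_split_points :=
  @subgroup_mk _ almost_split_subgroup _ (Theta_gamma_fixed x).

Lemma almost_split_ThetaM x y :
  almost_split_Theta_fun (x * y)%g
    = (almost_split_Theta_fun x * almost_split_Theta_fun y)%g.
Proof. by apply: subgroup_val_inj; exact: inv_funM. Qed.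

Lemma almost_split_ThetaK x :
  almost_split_Theta_fun (almost_split_Theta_fun x) = x.
Proof. by apply: subgroup_val_inj; exact: inv_funK. Qed.

Definition almost_split_Theta : group_involution almost_split_points :=
  GroupInvolution almost_split_ThetaM almost_split_ThetaK.

End AlmostSplitPoints.
End Forms.
End TitsFunctor.

(* Main.v *)
(** Only Loos' axiom (S4) is difficult.  If the coset of h near 1 is fixed by
    the reflection at the base point, then k = h^-1 Theta(h) satisfies k^2 = 1,
    so one needs a neighbourhood of 1 in which no such k is non-trivial.

    (1) On G(C) there is a group topology, coarser than the Kac--Peterson one,
    in which the elements u with (Ad(u)^2 = 1 implies Ad(u) = 1) form a
    neighbourhood of 1.  The basic neighbourhoods consist of products of
    conjugates of letters x_i(z), x_{-i}(z), eta(1 + z), each letter being small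
    in terms of the length and the parameters of the conjugating word, with a
    total size bounded as in the construction of a final group topology.  The
    bounds are chosen one after the other by compactness: if no bound were
    possible, an ultralimit of words in which Ad is an involution F_q <> 1 would
    be a word w with Ad(w) = 1; but a normalized limit of x - F_q x is non-zero
    and is negated by Ad(w).

    (2) If moreover Ad(k) = 1, the Iwasawa decomposition h = kappa u t gives
    Theta(ut) = ut k.  Comparing heights, Ad(u) = 1, so that u, and hence ut, is
    in the torus; then the coordinates of k are positive, and k^2 = 1 gives
    k = 1.  The Iwasawa decomposition follows from that of SL_2, because U_+ is
    the product of the root group of alpha_i and of a subgroup normalized by
    phi_i(SL_2).  Here U_+ is replaced by the group of all elements whose adjoint
    action is unipotent with respect to the height.

    The almost split case follows by restriction to a subgroup of G(C). *)
Require Import Defs.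
From HB Require Import structures.
From mathcomp Require Import all_boot all_order all_algebra.
From mathcomp Require Import all_classical all_reals topology normedtype.
From mathcomp Require Import complex zify ring lra.

Set Implicit Arguments.
Unset Strict Implicit.
Unset Printing Implicit Defensive.

Import Order.TTheory GRing.Theory Num.Theory.
Import numFieldNormedType.Exports.
Local Open Scope ring_scope.

(** * Lie algebras given by generators and relations *)

(** The obstacle is twofold. The Kac--Peterson topology is only known as a supremum of group
    topologies, so neighbourhoods of 1 cannot be described directly; they have to be imported from a
    coarser group topology built by hand. And the adjoint representation is infinite-dimensional,
    with no operator norm at hand. What survives is that a word of fixed shape moves a fixed vector
    inside one finite-dimensional subspace, whatever its parameters. This is why shapes and lengths
    of words are frozen along an ultrafilter before any limit is taken.

    [Ad] is meaningful on the derived algebra only, so gradings and inductions live there. No linear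
    independence of root vectors is established beforehand: arguments transport a defining relation
    by an automorphism, compare homogeneous components, and conclude that a multiple of a generator
    vanishes, not that its coefficient does.

    Real and complex points are treated together, through a field [K] embedded in the complex
    numbers by [j]. *)

Section LieBasics.
Variables (k : fieldType) (L : lieAlgType k).
Implicit Types x y z : L.

Lemma bracketDl x y z : bracket (x + y) z = bracket x z + bracket y z.
Proof. by have := bracket_linear_l z 1 x y; rewrite !scale1r. Qed.

Lemma bracketDr x y z : bracket z (x + y) = bracket z x + bracket z y.
Proof. by have := bracket_linear_r z 1 x y; rewrite !scale1r. Qed.

Lemma bracket0l z : bracket 0 z = 0 :> L.
Proof. by apply: (@addrI _ (bracket 0 z)); rewrite -bracketDl !addr0. Qed.

Lemma bracket0r z : bracket z 0 = 0 :> L.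
Proof. by apply: (@addrI _ (bracket z 0)); rewrite -bracketDr !addr0. Qed.

Lemma bracketZl a x z : bracket (a *: x) z = a *: bracket x z.
Proof. by have := bracket_linear_l z a x 0; rewrite !addr0 bracket0l addr0. Qed.

Lemma bracketZr a x z : bracket z (a *: x) = a *: bracket z x.
Proof. by have := bracket_linear_r z a x 0; rewrite !addr0 bracket0r addr0. Qed.

Lemma bracketNl x z : bracket (- x) z = - bracket x z.
Proof. by rewrite -scaleN1r bracketZl scaleN1r. Qed.

Lemma bracketNr x z : bracket z (- x) = - bracket z x.
Proof. by rewrite -scaleN1r bracketZr scaleN1r. Qed.

Lemma bracketBl x y z : bracket (x - y) z = bracket x z - bracket y z.
Proof. by rewrite bracketDl bracketNl. Qed.

Lemma bracketBr x y z : bracket z (x - y) = bracket z x - bracket z y.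
Proof. by rewrite bracketDr bracketNr. Qed.

Lemma bracketC x y : bracket x y = - bracket y x.
Proof.
apply/eqP; rewrite -addr_eq0; apply/eqP.
have := bracketxx (x + y).
by rewrite bracketDl !bracketDr !bracketxx add0r addr0.
Qed.

Lemma bracket_suml (I : Type) (s : seq I) (F : I -> L) z :
  bracket (\sum_(i <- s) F i) z = \sum_(i <- s) bracket (F i) z.
Proof.
elim: s => [|i s IH]; first by rewrite !big_nil bracket0l.
by rewrite !big_cons bracketDl IH.
Qed.

Lemma bracket_sumr (I : Type) (s : seq I) (F : I -> L) z :
  bracket z (\sum_(i <- s) F i) = \sum_(i <- s) bracket z (F i).
Proof.
elim: s => [|i s IH]; first by rewrite !big_nil bracket0r.
by rewrite !big_cons bracketDr IH.
Qed.

Lemma leibniz x y z :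
  bracket x (bracket y z) = bracket (bracket x y) z + bracket y (bracket x z).
Proof.
have := jacobi x y z; rewrite (bracketC z x) bracketNr (bracketC z).
by rewrite -addrA -opprD => /eqP; rewrite subr_eq0 addrC => /eqP.
Qed.

Lemma bracket2l x y z :
  bracket (bracket x y) z = bracket x (bracket y z) - bracket y (bracket x z).
Proof. by rewrite leibniz addrK. Qed.

(** [exp_ad] picks some order of nilpotency; two orders give sums that differ by zero terms, so any
    order computes it. *)
Lemma exp_adE x y N : iter N (bracket x) y = 0 ->
  exp_ad x y = \sum_(j < N) (j`!%:R)^-1 *: iter j (bracket x) y.
Proof.
have iter0 j : iter j (bracket x) (0 : L) = 0.
  by elim: j => //= j ->; rewrite bracket0r.
have mono M M' : (M <= M')%N -> iter M (bracket x) y = 0 ->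
    \sum_(j < M') (j`!%:R)^-1 *: iter j (bracket x) y
    = \sum_(j < M) (j`!%:R)^-1 *: iter j (bracket x) y.
  move=> le H0; rewrite -(big_mkord xpredT
    (fun j => (j`!%:R)^-1 *: iter j (bracket x) y)) (big_cat_nat _ le) //=.
  rewrite big_mkord [X in _ + X]big_nat_cond [X in _ + X]big1 ?addr0 //.
  move=> j /andP[/andP[le' _] _].
  by rewrite -(subnK le') iterD H0 iter0 scaler0.
move=> HN; rewrite /exp_ad; case: xgetP => [z _ [M [HM ->]]|H].
  by case: (leqP M N) => [|/ltnW] le; [rewrite (mono _ _ le HM)|rewrite (mono _ _ le HN)].
by case: (H (\sum_(j < N) (j`!%:R)^-1 *: iter j (bracket x) y)); exists N.
Qed.

End LieBasics.

Definition lin_closed (k : fieldType) (L : lmodType k) (P : L -> Prop) : Prop :=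
  P 0 /\ forall a x y, P x -> P y -> P (a *: x + y).

Section LinClosed.
Variables (k : fieldType) (L : lmodType k) (P : L -> Prop).
Hypothesis HP : lin_closed P.

Lemma linc0 : P 0. Proof. by case: HP. Qed.
Lemma lincD x y : P x -> P y -> P (x + y).
Proof. by move=> Hx Hy; have := HP.2 1 x y Hx Hy; rewrite scale1r. Qed.
Lemma lincZ a x : P x -> P (a *: x).
Proof. by move=> Hx; have := HP.2 a x 0 Hx linc0; rewrite addr0. Qed.
Lemma lincN x : P x -> P (- x).
Proof. by move=> /(lincZ (-1)); rewrite scaleN1r. Qed.
Lemma lincB x y : P x -> P y -> P (x - y).
Proof. by move=> Hx Hy; apply: lincD => //; exact: lincN. Qed.
Lemma linc_sum (I : eqType) (s : seq I) (F : I -> L) :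
  (forall i, i \in s -> P (F i)) -> P (\sum_(i <- s) F i).
Proof.
elim: s => [_|i s IH H]; first by rewrite big_nil; exact: linc0.
rewrite big_cons; apply: lincD; first by apply: H; rewrite mem_head.
by apply: IH => j js; apply: H; rewrite in_cons js orbT.
Qed.
End LinClosed.

(** * Subalgebras cut out by a predicate *)

Section Subalgebra.
Variables (k : fieldType) (L : lieAlgType k) (P : L -> Prop).
Hypothesis HP : lin_closed P.
Hypothesis HB : forall x y, P x -> P y -> P (bracket x y).

Definition subalg_pred : {pred L} := fun x => `[< P x >].

Lemma subalg_submod_closed : submod_closed subalg_pred.
Proof.
split; first by apply/asboolP; exact: linc0 HP.
by move=> a x y /asboolP Hx /asboolP Hy; apply/asboolP; exact: HP.2.
Qed.
HB.instance Definition _ :=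
  GRing.isSubmodClosed.Build k L subalg_pred subalg_submod_closed.

Record subalg := Subalg { subalg_val : L; subalg_valP : subalg_val \in subalg_pred }.
HB.instance Definition _ := [isSub for subalg_val].
HB.instance Definition _ := [Choice of subalg by <:].
HB.instance Definition _ := [SubChoice_isSubLmodule of subalg by <:].

Lemma subalg_bracketP (x y : subalg) :
  bracket (subalg_val x) (subalg_val y) \in subalg_pred.
Proof.
apply/asboolP; apply: HB; apply/asboolP; exact: subalg_valP.
Qed.
Definition subalg_bracket (x y : subalg) : subalg := Subalg (subalg_bracketP x y).

Lemma subalg_linear : linear subalg_val.
Proof. exact: (linearP (val : subalg -> L)). Qed.

Lemma subalg_val_inj : injective subalg_val.
Proof. exact: (@val_inj _ _ subalg). Qed.

Lemma subalg_val0 : subalg_val 0 = 0.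
Proof. exact: (raddf0 (val : subalg -> L)). Qed.

Lemma subalg_valD x y : subalg_val (x + y) = subalg_val x + subalg_val y.
Proof. exact: (raddfD (val : subalg -> L)). Qed.

Lemma subalg_bracketE x y :
  subalg_val (subalg_bracket x y) = bracket (subalg_val x) (subalg_val y).
Proof. by []. Qed.

Definition subalg_lie : lieAlgType k.
Proof.
apply: (@LieAlgType k subalg subalg_bracket).
- move=> z a x y; apply: subalg_val_inj.
  by rewrite subalg_linear !subalg_bracketE subalg_linear bracket_linear_l.
- move=> z a x y; apply: subalg_val_inj.
  by rewrite subalg_linear !subalg_bracketE subalg_linear bracket_linear_r.
- move=> x; apply: subalg_val_inj.
  by rewrite subalg_bracketE bracketxx subalg_val0.
- move=> x y z; apply: subalg_val_inj.
  by rewrite !subalg_valD !subalg_bracketE jacobi subalg_val0.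
Defined.

End Subalgebra.

(** * Induction principles drawn from the universal property *)

Section Generation.
Variables (n : nat) (A : 'M[int]_n) (D : root_datum A) (k : fieldType).
Variable g : kac_moody_algebra D k.

Lemma km_hD x y : km_h g (x + y) = km_h g x + km_h g y.
Proof. by have := km_h_linear (km_rel g) 1 x y; rewrite !scale1r. Qed.
Lemma km_h0 : km_h g 0 = 0.
Proof. by apply: (@addrI _ (km_h g 0)); rewrite -km_hD !addr0. Qed.
Lemma km_hZ a x : km_h g (a *: x) = a *: km_h g x.
Proof. by have := km_h_linear (km_rel g) a x 0; rewrite km_h0 !addr0. Qed.

(** The subalgebra carved out by [P] satisfies the defining relations, so the universal property
    maps [g] into it. Followed by the inclusion, this map fixes the generators, hence is the
    identity by uniqueness; every element therefore lies in the subalgebra. *)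
Lemma km_ind (P : g -> Prop) :
  (forall a x y, P x -> P y -> P (a *: x + y)) ->
  (forall x y, P x -> P y -> P (bracket x y)) ->
  (forall v, P (km_h g v)) -> (forall i, P (km_e g i)) ->
  (forall i, P (km_f g i)) -> forall x, P x.
Proof.
move=> HZ HB Hh He Hf.
have HP : lin_closed P by split; [rewrite -km_h0|].
pose S := subalg_lie HP HB.
pose vl : S -> g := @subalg_val _ g P.
pose mk (x : g) (Hx : P x) : S := @Subalg _ _ P x (asboolT Hx).
have valI (x y : S) : vl x = vl y -> x = y by exact: subalg_val_inj.
have lin : linear vl by move=> a x y; exact: (@subalg_linear _ _ _ HP a x y).
have v0 : vl 0 = 0 by exact: (@subalg_val0 _ _ _ HP).
have vZ a (x : S) : vl (a *: x) = a *: vl x.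
  by have := lin a x 0; rewrite addr0 => ->; rewrite v0 addr0.
have vN (x : S) : vl (- x) = - vl x by rewrite -scaleN1r vZ scaleN1r.
have iterv N (x y : S) : vl (iter N (bracket x) y)
    = iter N (bracket (vl x)) (vl y).
  by elim: N => // N IH; rewrite !iterS -IH.
have rel : kac_moody_relations D (L := S) (fun v => mk _ (Hh v))
    (fun i => mk _ (He i)) (fun i => mk _ (Hf i)).
  split => [a x y|x y|x i|x i|i j|i j ij|i j ij]; apply: valI.
  - by rewrite lin /= (km_h_linear (km_rel g)).
  - by rewrite v0 /= (km_hh (km_rel g)).
  - by rewrite vZ /= (km_he (km_rel g)).
  - by rewrite vZ /= (km_hf (km_rel g)).
  - by rewrite vN vZ /= (km_ef (km_rel g)).
  - by rewrite iterv v0 /= (km_serre_e (km_rel g)).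
  - by rewrite iterv v0 /= (km_serre_f (km_rel g)).
have [phi [[[plin pbr] ph pe pf] _]] := km_universal g rel.
have [psi [_ uniq]] := km_universal g (km_rel g).
have E1 : id =1 psi by apply: uniq; split.
have E2 : (fun x => vl (phi x)) =1 psi.
  apply: uniq; split => [|x|i|i]; last 3 first.
  - by rewrite ph.
  - by rewrite pe.
  - by rewrite pf.
  by split=> [a x y|x y]; [rewrite plin lin|rewrite pbr].
move=> x; have <- : vl (phi x) = x by rewrite E2 -E1.
by apply/asboolP; exact: (subalg_valP (phi x)).
Qed.

(** Stability under the generators propagates to [ad x] for all [x], because [ad [x, y]] is the
    commutator of [ad x] and [ad y]. *)
Lemma km_ideal_ind (P : g -> Prop) :
  (forall a x y, P x -> P y -> P (a *: x + y)) ->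
  (forall v, P (km_h g v)) -> (forall i, P (km_e g i)) ->
  (forall i, P (km_f g i)) ->
  (forall v x, P x -> P (bracket (km_h g v) x)) ->
  (forall i x, P x -> P (bracket (km_e g i) x)) ->
  (forall i x, P x -> P (bracket (km_f g i) x)) -> forall x, P x.
Proof.
move=> HZ Hh He Hf adh ade adf.
have ideal x : forall y, P y -> P (bracket x y).
  move: x; apply: km_ind => // [a x y Hx Hy z Hz|x y Hx Hy z Hz].
    by rewrite bracket_linear_l; apply: HZ; [exact: Hx|exact: Hy].
  by rewrite bracket2l addrC -scaleN1r; apply: HZ; [apply: Hy; exact: Hx|apply: Hx; exact: Hy].
by apply: km_ind => // x y _; exact: ideal.
Qed.

End Generation.

Section Twist.
Variables (k : fieldType) (sg : {rmorphism k -> k}) (L : lieAlgType k).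

(** Scalars act through [sg]: a semilinear map into [L] is a linear map into the twist, so the
    universal property also produces semilinear maps. *)
Definition twist : Type := L.
HB.instance Definition _ := GRing.Zmodule.on twist.

Definition twist_scale (a : k) (x : twist) : twist := sg a *: (x : L).

Lemma twist_scaleA a b x :
  twist_scale a (twist_scale b x) = twist_scale (a * b) x.
Proof. by rewrite /twist_scale scalerA rmorphM. Qed.
Lemma twist_scale1 : left_id 1 twist_scale.
Proof. by move=> x; rewrite /twist_scale rmorph1 scale1r. Qed.
Lemma twist_scaleDr : right_distributive twist_scale +%R.
Proof. by move=> a x y; exact: scalerDr. Qed.
Lemma twist_scaleDl x : {morph twist_scale^~ x : a b / a + b}.
Proof. by move=> a b; rewrite /twist_scale rmorphD; exact: scalerDl. Qed.

HB.instance Definition _ := GRing.Zmodule_isLmodule.Build k twist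
  twist_scaleA twist_scale1 twist_scaleDr twist_scaleDl.

Definition twist_lie : lieAlgType k.
Proof.
apply: (@LieAlgType k twist (fun x y => bracket (x : L) (y : L))).
- by move=> z a x y; exact: bracket_linear_l.
- by move=> z a x y; exact: bracket_linear_r.
- by move=> x; exact: bracketxx.
- by move=> x y z; exact: jacobi.
Defined.

End Twist.

Section SemilinearExtension.
Variables (n : nat) (A : 'M[int]_n) (D : root_datum A) (k : fieldType).
Variables (g : kac_moody_algebra D k) (sg : {rmorphism k -> k}).
Variable L : lieAlgType k.

Definition semi_morphism (psi : g -> L) : Prop :=
  (forall a x y, psi (a *: x + y) = sg a *: psi x + psi y) /\
  (forall x y, psi (bracket x y) = bracket (psi x) (psi y)).

Lemma km_semi_extend (h' : 'cV[k]_(lattice_rank A) -> L) (e' f' : 'I_n -> L) :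
  (forall a x y, h' (a *: x + y) = sg a *: h' x + h' y) ->
  (forall x y, bracket (h' x) (h' y) = 0) ->
  (forall x i, bracket (h' x) (e' i)
     = sg (cartan_eval (rd_c D i) x) *: e' i) ->
  (forall x i, bracket (h' x) (f' i)
     = - sg (cartan_eval (rd_c D i) x) *: f' i) ->
  (forall i j, bracket (e' i) (f' j) = - ((i == j)%:R *: h' (coroot D k i))) ->
  (forall i j, i != j -> iter `|1 - A i j|%N (bracket (e' i)) (e' j) = 0) ->
  (forall i j, i != j -> iter `|1 - A i j|%N (bracket (f' i)) (f' j) = 0) ->
  exists psi : g -> L, [/\ semi_morphism psi,
    forall x, psi (km_h g x) = h' x, forall i, psi (km_e g i) = e' i
    & forall i, psi (km_f g i) = f' i].
Proof.
move=> hlin hhh hhe hhf hef serre_e serre_f.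
have rel : kac_moody_relations D (L := twist_lie sg L) h' e' f'.
  split; [exact: hlin|exact: hhh|exact: hhe| | |exact: serre_e|exact: serre_f].
  - move=> x i; rewrite -[RHS]/(sg (- cartan_eval (rd_c D i) x) *: (f' i : L)).
    by rewrite rmorphN; exact: hhf.
  - move=> i j; rewrite -[RHS]/(- (sg (i == j)%:R *: (h' (coroot D k i) : L))).
    by rewrite rmorph_nat; exact: hef.
have [phi [[[plin pbr] ph pe pf] _]] := km_universal g rel.
by exists phi.
Qed.

End SemilinearExtension.

(** * Gradings of the derived algebra *)

Section Gradings.
Variables (n : nat) (A : 'M[int]_n) (D : root_datum A) (k : numFieldType).
Variable g : kac_moody_algebra D k.
Hypothesis hcartan : generalized_cartan A.
Local Notation m := (lattice_rank A).
Local Notation c := (rd_c D).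

(** Supplies the grading elements: every integral degree function on the simple roots is evaluation
    at some Cartan element, since the simple roots are linearly independent. *)
Lemma root_functional (d : 'I_n -> int) :
  exists x : 'cV[k]_m, forall i, cartan_eval (c i) x = (d i)%:~R.
Proof.
pose C : 'M[int]_(n, m) := \matrix_(i, j) c i 0 j.
pose CQ : 'M[rat]_(n, m) := map_mx (intr : int -> rat) C.
have CQ_free : row_free CQ.
  rewrite -kermx_eq0; apply/eqP/row_matrixP => r; rewrite row0.
  set u := row r _; have uC : u *m CQ = 0.
    by apply/eqP; rewrite -sub_kermx row_sub.
  (* A rational relation between the simple roots, multiplied by the product of its denominators,
     becomes an integral one, and [rd_c_free] applies. *)
  clearbody u; pose N : rat := (\prod_j denq (u 0 j))%:~R.
  have N0 : N != 0.
    rewrite intr_eq0; apply/prodf_neq0 => j _; exact: denq_neq0.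
  pose z (j : 'I_n) : int := numq (u 0 j) * \prod_(l | l != j) denq (u 0 l).
  have zE j : (z j)%:~R = N * u 0 j.
    by rewrite /N (bigD1 j) //= !intrM numqE -mulrA mulrC.
  have z0 : \sum_j z j *: c j = 0.
    apply/rowP => l; apply: (@intr_inj rat); rewrite summxE rmorph_sum /= mxE.
    rewrite (_ : 0%:~R = N * (u *m CQ) 0 l); last by rewrite uC mxE mulr0.
    rewrite mxE mulr_sumr; apply: eq_bigr => j _.
    by rewrite !mxE intrM zE mulrA.
  apply/rowP => j; rewrite [RHS]mxE; apply/eqP.
  by have := zE j; rewrite (rd_c_free z0) => /esym/eqP; rewrite mulf_eq0 (negPf N0).
have [B CB] : exists B, CQ *m B = 1%:M by apply/row_freeP.
pose x : 'cV[k]_m := map_mx ratr (B *m (\col_i (d i)%:~R)).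
exists x => i; rewrite /cartan_eval /x.
have -> : map_mx (intr : int -> k) (c i) = map_mx ratr (row i CQ).
  by apply/rowP => j; rewrite !mxE ratr_int.
rewrite -map_mxM mulmxA -row_mul CB row1 -rowE mxE.
by rewrite /= [row _ _ _ _]mxE mxE ratr_int.
Qed.

Lemma cartan_eval_coroot i j : cartan_eval (c j) (coroot D k i) = (A i j)%:~R.
Proof.
rewrite /cartan_eval /coroot -map_mxM mxE -(rd_cartan D i j).
by [].
Qed.

Definition gen (b : bool) (i : 'I_n) : g := if b then km_e g i else km_f g i.

(* Right-normed brackets [x_i1, [x_i2, ... x_i]] in the e's (true) or in the
   f's (false), together with the coroots. *)
Definition monomial : Type := ('I_n + (bool * seq 'I_n * 'I_n))%type.
HB.instance Definition _ := Equality.copy monomial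
  ('I_n + (bool * seq 'I_n * 'I_n))%type.

Definition word_val (b : bool) (w : seq 'I_n) (i : 'I_n) : g :=
  foldr (fun j z => bracket (gen b j) z) (gen b i) w.

Definition monomial_val (x : monomial) : g :=
  match x with
  | inl i => km_h g (coroot D k i)
  | inr (b, w, i) => word_val b w i
  end.

Definition monomial_deg (d : 'I_n -> int) (x : monomial) : int :=
  match x with
  | inl i => 0
  | inr (b, w, i) => (-1) ^+ (~~ b) * \sum_(j <- i :: w) d j
  end.

Definition grades (x : 'cV[k]_m) (d : 'I_n -> int) : Prop :=
  forall i, cartan_eval (c i) x = (d i)%:~R.

Lemma bracket_h_gen x b i :
  bracket (km_h g x) (gen b i) = ((-1) ^+ (~~ b) * cartan_eval (c i) x) *: gen b i.
Proof.
case: b; rewrite /gen /=.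
  by rewrite (km_he (km_rel g)) expr0 mul1r.
by rewrite (km_hf (km_rel g)) expr1 mulN1r.
Qed.

Lemma bracket_h_word x b w i :
  bracket (km_h g x) (word_val b w i)
  = ((-1) ^+ (~~ b) * \sum_(j <- i :: w) cartan_eval (c j) x) *: word_val b w i.
Proof.
elim: w => [|j w IH] /=; first by rewrite big_seq1; exact: bracket_h_gen.
rewrite leibniz IH bracket_h_gen bracketZl bracketZr -scalerDl -mulrDr.
by congr ((_ * _) *: _); rewrite !big_cons addrCA.
Qed.

Lemma bracket_h_monomial x d y : grades x d ->
  bracket (km_h g x) (monomial_val y) = (monomial_deg d y)%:~R *: monomial_val y.
Proof.
move=> xd; case: y => [i|[[b w] i]] /=.
  by rewrite (km_hh (km_rel g)) scale0r.
rewrite bracket_h_word intrM rmorphXn rmorphN1 rmorph_sum /=.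
by congr ((_ * _) *: _); apply: eq_bigr => j _; exact: xd.
Qed.

Definition span (P : g -> Prop) (x : g) : Prop :=
  exists2 s : seq (k * g), (forall p, p \in s -> P p.2)
    & x = \sum_(p <- s) p.1 *: p.2.

Lemma span_lin_closed P : lin_closed (span P).
Proof.
split; first by exists [::]; rewrite ?big_nil.
move=> a x y [s sP ->] [t tP ->].
exists ([seq (a * p.1, p.2) | p <- s] ++ t).
  by move=> p; rewrite mem_cat => /orP[/mapP[q qs ->]|/tP] //; exact: (sP q).
rewrite big_cat /= big_map scaler_sumr; congr (_ + _).
by apply: eq_bigr => p _; rewrite scalerA.
Qed.

Lemma span_in P x : P x -> span P x.
Proof.
by move=> Px; exists [:: (1, x)] => [p|]; rewrite ?inE ?big_seq1 ?scale1r // => /eqP ->.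
Qed.

Lemma span_ind (P Q : g -> Prop) : lin_closed Q -> (forall x, P x -> Q x) ->
  forall x, span P x -> Q x.
Proof.
move=> HQ PQ x [s sP ->]; apply: (linc_sum HQ) => p /sP/PQ.
exact: lincZ.
Qed.

Definition is_monomial (x : g) : Prop := exists y, x = monomial_val y.

(** Words of one sign together with the coroots. Generators of that sign preserve this span, and a
    generator of the other sign sends a word back into it, which is how the span of all monomials is
    seen to be stable. *)
Definition half_monomial (b : bool) (x : g) : Prop :=
  (exists i, x = km_h g (coroot D k i)) \/ exists w i, x = word_val b w i.

Lemma bracket_span (P Q : g -> Prop) z :
  (forall x, P x -> span Q (bracket z x)) ->
  forall x, span P x -> span Q (bracket z x).
Proof.
move=> H; apply: span_ind => //; split.
  by rewrite bracket0r; exact: linc0 (span_lin_closed Q).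
by move=> a x y Hx Hy; rewrite bracket_linear_r; exact: (span_lin_closed Q).2.
Qed.

Lemma bracket_gen_half b i x :
  span (half_monomial b) x -> span (half_monomial b) (bracket (gen b i) x).
Proof.
have lc := span_lin_closed (half_monomial b).
move: x; apply: bracket_span => x [[j ->]|[w [j ->]]].
  rewrite bracketC bracket_h_gen; apply: (lincN lc); apply: (lincZ lc).
  by apply: span_in; right; exists [::], i.
by apply: span_in; right; exists (i :: w), j.
Qed.

Lemma bracket_gen_opp b i j : exists a : k,
  bracket (gen b i) (gen (~~ b) j) = a *: km_h g (coroot D k j).
Proof.
case: b; rewrite /gen /=.
  rewrite (km_ef (km_rel g)); case: (eqVneq i j) => [->|_].
    by exists (-1); rewrite scale1r scaleN1r.
  by exists 0; rewrite !scale0r oppr0.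
rewrite bracketC (km_ef (km_rel g)) opprK; case: (eqVneq j i) => [->|_].
  by exists 1.
by exists 0; rewrite !scale0r.
Qed.

(** By the Leibniz rule the opposite generator meets each letter in turn, turning it into a multiple
    of a coroot, which acts on the rest of the word by a scalar. *)
Lemma bracket_gen_opp_word b i w j :
  span (half_monomial (~~ b)) (bracket (gen b i) (word_val (~~ b) w j)).
Proof.
have lc := span_lin_closed (half_monomial (~~ b)).
elim: w => [|l w IH] /=.
  have [a ->] := bracket_gen_opp b i j; apply: (lincZ lc).
  by apply: span_in; left; exists j.
rewrite leibniz; apply: (lincD lc); last exact: bracket_gen_half.
have [a ->] := bracket_gen_opp b i l; rewrite bracketZl bracket_h_word.
by do 2 apply: (lincZ lc); apply: span_in; right; exists w, j.
Qed.

Lemma span_half b x : span (half_monomial b) x -> span is_monomial x.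
Proof.
move: x; apply: span_ind; first exact: span_lin_closed.
move=> x H; apply: span_in; case: H => [[i ->]|[w [i ->]]].
  by exists (inl i).
by exists (inr (b, w, i)).
Qed.

Lemma bracket_gen_span b i x :
  span is_monomial x -> span is_monomial (bracket (gen b i) x).
Proof.
move: x; apply: bracket_span => _ [[j|[[b' w] j]] ->] /=.
  apply: (@span_half b); apply: bracket_gen_half; apply: span_in.
  by left; exists j.
apply: (@span_half b'); have [->|neq] := eqVneq b' b.
  by apply: bracket_gen_half; apply: span_in; right; exists w, j.
have -> : b = ~~ b' by case: b b' neq => [] [].
by have := bracket_gen_opp_word (~~ b') i w j; rewrite negbK.
Qed.

Lemma bracket_h_span v x :
  span is_monomial x -> span is_monomial (bracket (km_h g v) x).
Proof.
have lc := span_lin_closed is_monomial.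
move: x; apply: bracket_span => _ [[j|[[b w] j]] ->] /=.
  by rewrite (km_hh (km_rel g)); exact: linc0 lc.
rewrite bracket_h_word; apply: (lincZ lc); apply: span_in.
by exists (inr (b, w, j)).
Qed.

Lemma gen_span b i : span is_monomial (gen b i).
Proof. by apply: span_in; exists (inr (b, [::], i)). Qed.

(** The separate Cartan summand is there because the Cartan subalgebra may be larger than the span
    of the coroots. *)
Lemma cartan_add_span x : exists v y, span is_monomial y /\ x = km_h g v + y.
Proof.
have lc := span_lin_closed is_monomial.
pose P x := exists v y, span is_monomial y /\ x = km_h g v + y.
have Pspan y : span is_monomial y -> P y.
  by exists 0, y; rewrite km_h0 add0r.
have bgen b i v : span is_monomial (bracket (gen b i) (km_h g v)).
  rewrite bracketC bracket_h_gen; apply: (lincN lc); apply: (lincZ lc).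
  exact: gen_span.
move: x; apply: km_ideal_ind => [a x y [v [x' [Hx ->]]] [w [y' [Hy ->]]]|v|i|i
  |v x [w [y [Hy ->]]]|i x [w [y [Hy ->]]]|i x [w [y [Hy ->]]]].
- exists (a *: v + w), (a *: x' + y'); split; first exact: lc.2.
  by rewrite km_hD km_hZ scalerDr addrACA.
- by exists v, 0; split; [exact: linc0 lc|rewrite addr0].
- by apply: Pspan; exact: (gen_span true).
- by apply: Pspan; exact: (gen_span false).
- apply: Pspan; rewrite bracketDr (km_hh (km_rel g)) add0r.
  exact: bracket_h_span.
- apply: Pspan; rewrite bracketDr; apply: (lincD lc); first exact: (bgen true).
  exact: (@bracket_gen_span true).
- apply: Pspan; rewrite bracketDr; apply: (lincD lc); first exact: (bgen false).
  exact: (@bracket_gen_span false).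
Qed.

Lemma span_bracket x y :
  span is_monomial x -> span is_monomial y -> span is_monomial (bracket x y).
Proof.
have lc := span_lin_closed is_monomial.
pose Q x := forall y, span is_monomial y -> span is_monomial (bracket x y).
move=> Hx; move: y; move: x Hx; apply: (@span_ind _ Q).
  split => [y _|a x y Hx Hy z Hz]; first by rewrite bracket0l; exact: linc0 lc.
  by rewrite bracket_linear_l; apply: lc.2; [exact: Hx|exact: Hy].
have Qgen b i : Q (gen b i) by move=> y; exact: bracket_gen_span.
move=> _ [[j|[[b w] j]] ->] /=; first by move=> y; exact: bracket_h_span.
elim: w => [|i w IH] /=; first exact: Qgen.
move=> y Hy; rewrite bracket2l; apply: (lincB lc).
  by apply: Qgen; exact: IH.
by apply: IH; exact: Qgen.
Qed.

(** In a bracket of two elements split as Cartan part plus monomials, the Cartan parts commute and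
    all other terms fall into the span. *)
Lemma derived_span x : derived_algebra x -> span is_monomial x.
Proof.
have lc := span_lin_closed is_monomial.
move: x => _ [s ->]; apply: (linc_sum lc) => -[x y] _ /=.
have [v [x' [Hx ->]]] := cartan_add_span x.
have [w [y' [Hy ->]]] := cartan_add_span y.
rewrite bracketDl !bracketDr (km_hh (km_rel g)) add0r; apply: (lincD lc).
  exact: bracket_h_span.
apply: (lincD lc); last exact: span_bracket.
by rewrite bracketC; apply: (lincN lc); exact: bracket_h_span.
Qed.

Lemma derived_bracket (x y : g) : derived_algebra (bracket x y).
Proof. by exists [:: (x, y)]; rewrite big_seq1. Qed.

Lemma derived_lin_closed : lin_closed (@derived_algebra k g).
Proof.
split; first by exists [::]; rewrite big_nil.
move=> a x y [s ->] [t ->]; exists ([seq (a *: p.1, p.2) | p <- s] ++ t).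
rewrite big_cat /= big_map scaler_sumr; congr (_ + _).
by apply: eq_bigr => p _; rewrite bracketZl.
Qed.

(** The diagonal entry 2 of the Cartan matrix makes each generator a multiple of its bracket with
    the coroot. *)
Lemma derived_gen b i : derived_algebra (gen b i).
Proof.
have -> : gen b i
    = ((-1) ^+ (~~ b) * 2)^-1 *: bracket (km_h g (coroot D k i)) (gen b i).
  rewrite bracket_h_gen cartan_eval_coroot (gcm_diag hcartan) scalerA.
  by rewrite mulVf ?scale1r // mulf_neq0 ?signr_eq0 ?pnatr_eq0.
by apply: (lincZ derived_lin_closed); exact: derived_bracket.
Qed.

Lemma coroot_bracket i :
  km_h g (coroot D k i) = - bracket (km_e g i) (km_f g i).
Proof. by rewrite (km_ef (km_rel g)) eqxx scale1r opprK. Qed.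

Lemma derived_monomial x : derived_algebra (monomial_val x).
Proof.
case: x => [i|[[b w] i]] /=.
  rewrite coroot_bracket.
  by apply: (lincN derived_lin_closed); exact: derived_bracket.
case: w => [|j w] /=; [exact: derived_gen|exact: derived_bracket].
Qed.

Lemma derived_ind (P : g -> Prop) :
  (forall a x y, derived_algebra x -> derived_algebra y -> P x -> P y ->
     P (a *: x + y)) ->
  (forall x y, derived_algebra x -> derived_algebra y -> P x -> P y ->
     P (bracket x y)) ->
  P 0 -> (forall b i, P (gen b i)) -> forall x, derived_algebra x -> P x.
Proof.
move=> HZ HB H0 Hgen x dx.
have lc : lin_closed (fun x => derived_algebra x /\ P x).
  split; first by split => //; exact: linc0 derived_lin_closed.
  move=> a u v [du Pu] [dv Pv]; split; last exact: HZ.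
  exact: derived_lin_closed.2.
suff [] : derived_algebra x /\ P x by [].
apply: (span_ind lc _ (derived_span dx)) => _ [y ->].
split; first exact: derived_monomial.
have Pw b w i : P (word_val b w i).
  elim: w => [|j w IH] /=; first exact: Hgen.
  apply: HB => //; first exact: derived_gen.
  exact: (derived_monomial (inr (b, w, i))).
case: y => [i|[[b w] i]] //=; rewrite coroot_bracket -scaleN1r -[_ *: _]addr0.
apply: HZ => //; first exact: derived_bracket.
  exact: linc0 derived_lin_closed.
by apply: HB; [exact: (derived_gen true)|exact: (derived_gen false)
  |exact: (Hgen true)|exact: (Hgen false)].
Qed.

End Gradings.
Arguments gen : simpl never.

Section GradedPieces.
Variables (n : nat) (A : 'M[int]_n) (D : root_datum A) (k : numFieldType).
Variable g : kac_moody_algebra D k.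
Hypothesis hcartan : generalized_cartan A.
Local Notation m := (lattice_rank A).
Local Notation c := (rd_c D).

(* Sums of eigenvectors, with eigenvalues in P, of a derivation ad (h x) for
   which e_i has degree d i. *)
Definition homogeneous (d : 'I_n -> int) (l : int) (x : g) : Prop :=
  forall v : 'cV[k]_m, grades D v d -> bracket (km_h g v) x = l%:~R *: x.

Definition gr (d : 'I_n -> int) (P : int -> Prop) (x : g) : Prop :=
  exists2 s : seq (int * g), (forall p, p \in s -> P p.1 /\ homogeneous d p.1 p.2)
    & x = \sum_(p <- s) p.2.

Lemma homogeneous_lin_closed d l : lin_closed (homogeneous d l).
Proof.
split=> [v _|a x y Hx Hy v Hv]; first by rewrite bracket0r scaler0.
by rewrite bracket_linear_r Hx // Hy // scalerDr !scalerA mulrC.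
Qed.

Lemma gr_lin_closed d P : lin_closed (gr d P).
Proof.
split; first by exists [::]; rewrite ?big_nil.
move=> a x y [s sP ->] [t tP ->].
exists ([seq (p.1, a *: p.2) | p <- s] ++ t).
  move=> p; rewrite mem_cat => /orP[/mapP[q qs ->]|/tP] //.
  have [Pq hq] := sP q qs; split => //.
  exact: (lincZ (homogeneous_lin_closed _ _)).
by rewrite big_cat /= big_map scaler_sumr.
Qed.

Lemma gr_sub d (P Q : int -> Prop) x : (forall l, P l -> Q l) -> gr d P x -> gr d Q x.
Proof.
by move=> PQ [s sP ->]; exists s => // p /sP[Pp hp]; split => //; exact: PQ.
Qed.

Lemma gr_in d (P : int -> Prop) l x : P l -> homogeneous d l x -> gr d P x.
Proof.
move=> Pl hx; exists [:: (l, x)]; last by rewrite big_seq1.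
by move=> p; rewrite inE => /eqP ->.
Qed.

(** Independence of eigenvectors: [ad h - l0] kills the first term and multiplies the others by
    non-zero differences of eigenvalues. *)
Lemma homogeneous_sum0 d (ls : seq int) (v : int -> g) : uniq ls ->
  (forall l, l \in ls -> homogeneous d l (v l)) -> \sum_(l <- ls) v l = 0 ->
  forall l, l \in ls -> v l = 0.
Proof.
have [w Hw] := root_functional D k d.
elim: ls v => // l0 ls IH v /= /andP[l0s us] Hv S0.
have Hv' l : l \in l0 :: ls -> bracket (km_h g w) (v l) = l%:~R *: v l.
  by move=> /Hv; apply.
have Z l : l \in ls -> v l = 0.
  move=> lin.
  have : (l%:~R - l0%:~R) *: v l = 0.
    apply: (IH (fun l => (l%:~R - l0%:~R) *: v l)) => //.
      move=> i ils; apply: (lincZ (homogeneous_lin_closed _ _)).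
      by apply: Hv; rewrite inE ils orbT.
    have := congr1 (bracket (km_h g w)) S0.
    rewrite bracket0r bracket_sumr big_cons.
    move=> /(congr1 (fun z => z - l0%:~R *: (\sum_(l <- l0 :: ls) v l))).
    rewrite S0 scaler0 !subr0 => E.
    have : \sum_(j <- l0 :: ls) (j%:~R - l0%:~R) *: v j = 0.
      under eq_big_seq => j js do rewrite scalerBl -Hv' //.
      by rewrite sumrB -scaler_sumr S0 scaler0 subr0 big_cons.
    by rewrite big_cons subrr scale0r add0r.
  move/eqP; rewrite scaler_eq0 subr_eq0 eqr_int => /orP[/eqP ll|/eqP //].
  by move: l0s; rewrite -ll lin.
move=> l; rewrite inE => /orP[/eqP ->|/Z //].
by move: S0; rewrite big_cons big_seq big1 ?addr0.
Qed.

Lemma homogeneous_family0 d (I : finType) (lam : I -> int) (x : I -> g) :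
  injective lam -> (forall i, homogeneous d (lam i) (x i)) ->
  \sum_i x i = 0 -> forall i, x i = 0.
Proof.
move=> inj Hx S0 i.
pose v l := \sum_(j | lam j == l) x j.
have vE j : v (lam j) = x j.
  rewrite /v (bigD1 j) //= big1 ?addr0 // => j' /andP[/eqP/inj -> ].
  by rewrite eqxx.
rewrite -vE; apply: (@homogeneous_sum0 d [seq lam j | j <- index_enum I]).
- by rewrite map_inj_uniq // index_enum_uniq.
- by move=> l /mapP[j _ ->]; rewrite vE; exact: Hx.
- by rewrite big_map -[RHS]S0; apply: eq_bigr => j _; exact: vE.
- by apply: map_f; rewrite mem_index_enum.
Qed.

(** The tool for comparing components: to kill a term it is placed in one range of degrees and
    rewritten, through a relation, as an element of a disjoint range. *)
Lemma gr_disjoint d (P Q : int -> Prop) x : gr d P x -> gr d Q x ->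
  (forall l, P l -> Q l -> False) -> x = 0.
Proof.
move=> [s sP Ex] [t tP Ey] PQ.
pose v l : g := \sum_(p <- s | p.1 == l) p.2 - \sum_(p <- t | p.1 == l) p.2.
pose ls := undup ([seq p.1 | p <- s] ++ [seq p.1 | p <- t]).
have part (r : seq (int * g)) : {subset [seq p.1 | p <- r] <= ls} ->
    \sum_(p <- r) p.2 = \sum_(l <- ls) \sum_(p <- r | p.1 == l) p.2.
  move=> sub; under [RHS]eq_bigr => l _ do rewrite big_mkcond.
  rewrite exchange_big /=; apply: eq_big_seq => p pr.
  rewrite (bigD1_seq p.1) ?undup_uniq //=; last by apply: sub; exact: map_f.
  by rewrite eqxx big1 ?addr0 // => l; rewrite eq_sym => /negPf ->.
have hs (r : seq (int * g)) l : (forall p, p \in r -> homogeneous d p.1 p.2) ->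
    homogeneous d l (\sum_(p <- r | p.1 == l) p.2).
  move=> Hr; rewrite -big_filter; apply: (linc_sum (homogeneous_lin_closed _ _)).
  by move=> p; rewrite mem_filter => /andP[/eqP <- /Hr].
have v0 l : l \in ls -> v l = 0.
  apply: (@homogeneous_sum0 d) => [|j _|]; first exact: undup_uniq.
    apply: (lincB (homogeneous_lin_closed _ _)); apply: hs => p pin.
      by case: (sP p pin).
    by case: (tP p pin).
  rewrite /v sumrB -!part -?Ex -?Ey ?subrr //.
    by move=> z zs; rewrite mem_undup mem_cat zs orbT.
  by move=> z zs; rewrite mem_undup mem_cat zs.
rewrite Ex part; last by move=> z zs; rewrite mem_undup mem_cat zs.
apply: big1_seq => l /= lin; have := v0 l lin; rewrite /v.
have [/hasP[p pt /eqP pl]|no] := boolP (has (fun p => p.1 == l) t).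
  move=> _; rewrite -big_filter big_seq big1 // => q.
  rewrite mem_filter => /andP[/eqP ql qs].
  have [Pl _] := sP q qs; have [Ql _] := tP p pt.
  by case: (PQ l); rewrite -?ql // ql -pl.
by rewrite [X in _ - X]big_hasC ?subr0.
Qed.

Lemma homogeneous_bracket d a b x y : homogeneous d a x -> homogeneous d b y ->
  homogeneous d (a + b) (bracket x y).
Proof.
move=> Hx Hy v Hv; rewrite leibniz Hx // Hy // bracketZl bracketZr.
by rewrite -scalerDl intrD.
Qed.

Lemma gr_bracket d (P Q S : int -> Prop) x y : gr d P x -> gr d Q y ->
  (forall a b, P a -> Q b -> S (a + b)) -> gr d S (bracket x y).
Proof.
move=> [s sP ->] [t tP ->] H.
rewrite bracket_suml; apply: (linc_sum (gr_lin_closed _ _)) => p ps.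
rewrite bracket_sumr; apply: (linc_sum (gr_lin_closed _ _)) => q qs.
have [Pp hp] := sP p ps; have [Qq hq] := tP q qs.
apply: (@gr_in d S (p.1 + q.1)); first exact: H.
exact: homogeneous_bracket.
Qed.

Lemma homogeneous_monomial d y : homogeneous d (monomial_deg d y) (monomial_val g y).
Proof. by move=> v; exact: bracket_h_monomial. Qed.

Lemma gr_monomial d (P : int -> Prop) y : P (monomial_deg d y) ->
  gr d P (monomial_val g y).
Proof. by move=> Py; apply: (gr_in Py); exact: homogeneous_monomial. Qed.

Lemma gr_gen d (P : int -> Prop) b i : P ((-1) ^+ (~~ b) * d i) -> gr d P (gen g b i).
Proof.
move=> Pi; apply: (@gr_monomial d P (inr (b, [::], i))) => /=.
by rewrite big_seq1.
Qed.

Lemma gr_coroot d (P : int -> Prop) i : P 0 -> gr d P (km_h g (coroot D k i)).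
Proof. by move=> P0; apply: (@gr_monomial d P (inl i)). Qed.

(** In any monomial expansion, the terms of degree outside [P] add up to an element lying both in
    the [P]-part and in its complement, hence to 0. *)
Lemma gr_span d (P : int -> Prop) x : derived_algebra x -> gr d P x ->
  span (fun y => exists2 z, P (monomial_deg d z) & y = monomial_val g z) x.
Proof.
move=> /(derived_span) [s sM Ex] grx.
set T := span _; have lc : lin_closed T by exact: span_lin_closed.
pose inP (y : g) := `[< exists2 z, P (monomial_deg d z) & y = monomial_val g z >].
pose a := \sum_(p <- s | inP p.2) p.1 *: p.2.
have Ta : T a.
  rewrite /a -big_filter; apply: (linc_sum lc) => p.
  rewrite mem_filter => /andP[/asboolP H _]; apply: (lincZ lc).
  exact: span_in.
have gra : gr d P a.
  rewrite /a -big_filter; apply: (linc_sum (gr_lin_closed _ _)) => p.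
  rewrite mem_filter => /andP[/asboolP [z Pz ->] _].
  by apply: (lincZ (gr_lin_closed _ _)); exact: gr_monomial.
suff -> : x = a by [].
apply/eqP; rewrite -subr_eq0; apply/eqP.
apply: (@gr_disjoint d P (fun l => ~ P l)) => //.
  exact: (lincB (gr_lin_closed _ _)).
rewrite Ex (bigID (fun p => inP p.2)) /= addrC addrK -big_filter.
apply: (linc_sum (gr_lin_closed _ _)) => p.
rewrite mem_filter => /andP[/asboolPn H ps]; apply: (lincZ (gr_lin_closed _ _)).
have [z Ez] := sM p ps; rewrite Ez; apply: gr_monomial => Pz.
by apply: H; exists z.
Qed.

End GradedPieces.

(** * Unipotent endomorphisms of the derived algebra *)

Section Raising.
Variables (n : nat) (A : 'M[int]_n) (D : root_datum A) (k : numFieldType).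
Variable g : kac_moody_algebra D k.
Hypothesis hcartan : generalized_cartan A.
Local Notation m := (lattice_rank A).
Local Notation c := (rd_c D).
Local Notation der := (@derived_algebra k g).
Local Notation e := (km_e g).
Local Notation f := (km_f g).
Local Notation hh i := (km_h g (coroot D k i)).
Local Notation coroot_grading i := (fun j => A i j).

Definition ge (l j : int) : Prop := l <= j.
Definition deg_eq (l j : int) : Prop := j = l.
Definition height : 'I_n -> int := fun=> 1.
(** The height with the simple root [i] discarded. In the derived algebra its non-negative part is
    the minimal parabolic subalgebra of [i], and its positive part the nilradical of that
    parabolic. *)
Definition coheight (i j : 'I_n) : int := if j == i then 0 else 1.

Record derived_endo (F : g -> g) : Prop := DerivedEndo {
  de_stable : forall x, der x -> der (F x);
  de_linear : forall a x y, der x -> der y -> F (a *: x + y) = a *: F x + F y;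
  de_bracket : forall x y, der x -> der y ->
    F (bracket x y) = bracket (F x) (F y) }.

(** Unipotence with respect to the decreasing filtration by degree; [nonlowering] only asks that the
    filtration be preserved. *)
Definition raising (d : 'I_n -> int) (F : g -> g) : Prop :=
  forall l x, der x -> gr d (ge l) x -> gr d (ge (l + 1)) (F x - x).

Definition nonlowering (d : 'I_n -> int) (F : g -> g) : Prop :=
  forall l x, der x -> gr d (ge l) x -> gr d (ge l) (F x).

Lemma gr_family d P x : gr (g := g) d P x -> exists ls v, [/\ uniq ls,
  forall l, l \in ls -> P l /\ homogeneous d l (v l) & x = \sum_(l <- ls) v l].
Proof.
move=> [s sP ->].
exists (undup [seq p.1 | p <- s]), (fun l => \sum_(p <- s | p.1 == l) p.2).
split; first exact: undup_uniq.
  move=> l; rewrite mem_undup => /mapP[p ps ->]; have [Pp _] := sP p ps.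
  split=> //; rewrite -big_filter.
  apply: (linc_sum (homogeneous_lin_closed _ _ _)) => q.
  by rewrite mem_filter => /andP[/eqP <- /sP[]].
under [RHS]eq_bigr => l _ do rewrite big_mkcond.
rewrite exchange_big /=; apply: eq_big_seq => p pr.
rewrite (bigD1_seq p.1) ?undup_uniq //=; last by rewrite mem_undup map_f.
by rewrite eqxx big1 ?addr0 // => l; rewrite eq_sym => /negPf ->.
Qed.

Lemma gr_eigen0 d P x v l : gr (g := g) d P x -> grades D v d ->
  bracket (km_h g v) x = l%:~R *: x -> (forall j, P j -> j != l) -> x = 0.
Proof.
move=> /gr_family [ls [w [us wP ->]]] Hv E Pl.
have Z : \sum_(j <- ls) (j%:~R - l%:~R) *: w j = 0.
  under eq_big_seq => j js do rewrite scalerBl -((wP j js).2 v Hv).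
  by rewrite sumrB -bracket_sumr -scaler_sumr E subrr.
rewrite big_seq big1 // => j js.
have : (j%:~R - l%:~R) *: w j = 0.
  apply: (homogeneous_sum0 us _ Z) => // i ils.
  by apply: (lincZ (homogeneous_lin_closed _ _ _)); exact: (wP i ils).2.
move/eqP; rewrite scaler_eq0 subr_eq0 eqr_int (negPf (Pl j (wP j js).1)).
by move/eqP.
Qed.

(** Passes from one grading to another by inspecting monomials. The clause for zero values takes
    care of repeated letters, whose formal degree would spoil the comparison. *)
Lemma gr_compare d d' (P Q : int -> Prop) x :
  (forall y, P (monomial_deg d y) -> monomial_val g y = 0 \/ Q (monomial_deg d' y)) ->
  der x -> gr d P x -> gr d' Q x.
Proof.
move=> PQ dx /(gr_span dx); apply: span_ind; first exact: gr_lin_closed.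
move=> y [z /PQ [-> ->|Qz ->]]; first exact: (linc0 (gr_lin_closed _ _ _)).
exact: gr_monomial.
Qed.

Lemma word_degE (d : 'I_n -> int) b w i : monomial_deg d (inr (b, w, i)) =
  (-1) ^+ (~~ b) * \sum_(j <- i :: w) d j.
Proof. by []. Qed.

Lemma sum_coheight i s : \sum_(j <- s) coheight i j = (count (predC1 i) s)%:Z.
Proof.
elim: s => [|j s IH]; first by rewrite big_nil.
by rewrite big_cons IH /= /coheight; case: eqP => //=; rewrite add0r.
Qed.

Lemma sum_height s : \sum_(j <- s) height j = (size s)%:Z.
Proof. by elim: s => [|j s IH]; rewrite ?big_nil // big_cons IH. Qed.

Lemma sign_b b (x : int) : (-1) ^+ (~~ b) * x = if b then x else - x.
Proof. by case: b; rewrite /= ?expr0 ?mul1r ?expr1 ?mulN1r. Qed.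

Lemma height_deg (y : monomial n) : monomial_deg height y =
  match y with inl _ => 0 | inr (b, w, i) => if b then (size w).+1%:Z else - (size w).+1%:Z end.
Proof. by case: y => [//|[[b w] i]]; rewrite word_degE sum_height sign_b. Qed.

Lemma coheight_deg i (y : monomial n) : monomial_deg (coheight i) y =
  match y with inl _ => 0 | inr (b, w, j) =>
    let s := count (predC1 i) (j :: w) in if b then s%:Z else - s%:Z end.
Proof. by case: y => [//|[[b w] j]]; rewrite word_degE sum_coheight sign_b. Qed.

(** The innermost bracket is that of a generator with itself. In terms of roots, no proper multiple
    of a simple root occurs; this is what lets a height of at least 2 force a positive coheight. *)
Lemma word_const0 b i j w : (0 < size w)%N -> count (predC1 i) (j :: w) = 0%N ->
  word_val g b w j = 0.
Proof.
have [<-|] := eqVneq j i; last by move=> /= ->.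
elim: w => // l w IH _; rewrite /= eqxx /=; have [->|//] := eqVneq l j.
case: w IH => [_ _|l' w IH] /=; first by rewrite bracketxx.
by rewrite /= in IH; rewrite eqxx /= in IH; move=> H; rewrite IH // bracket0r.
Qed.

Lemma height_ge0_coheight i x : der x -> gr height (ge 0) x -> gr (coheight i) (ge 0) x.
Proof.
apply: gr_compare => -[j|[[[] w] j]] H; right; rewrite coheight_deg //=.
by move: H; rewrite height_deg /ge oppr_ge0.
Qed.

Lemma height_ge2_coheight i x : der x -> gr height (ge 2) x -> gr (coheight i) (ge 1) x.
Proof.
apply: gr_compare => -[j|[[[] w] j]]; rewrite height_deg coheight_deg /ge //.
case: (posnP (count (predC1 i) (j :: w))) => [E|]; last by right.
by move=> H; left; apply: word_const0 E; case: w H.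
Qed.

Lemma coheight_height i l x : 0 < l ->
  der x -> gr (coheight i) (ge l) x -> gr height (ge l) x.
Proof.
move=> l0; apply: gr_compare => -[j|[[[] w] j]]; rewrite height_deg coheight_deg /ge.
- by rewrite leNgt l0.
- move=> H; right; apply: le_trans H _.
  by rewrite lez_nat; exact: count_size.
- by move=> H; have := lt_le_trans l0 H; rewrite oppr_gt0.
Qed.

Lemma endo0 F : derived_endo F -> F 0 = 0.
Proof.
have d0 : der 0 by exact: linc0 (derived_lin_closed g).
move=> /de_linear /(_ 1 0 0 d0 d0).
by rewrite scaler0 addr0 scale1r -{1}[F 0]addr0 => /addrI.
Qed.

Lemma endoN F x : derived_endo F -> der x -> F (- x) = - F x.
Proof.
move=> HF dx; rewrite -scaleN1r -[_ *: _]addr0 (de_linear HF) //.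
  by rewrite endo0 // addr0 scaleN1r.
exact: linc0 (derived_lin_closed g).
Qed.

(** The excess [F [x, y] - [x, y]] is the sum of three brackets in each of which at least one
    argument is an excess, so the gain of one degree passes to brackets. *)
Lemma raise_gen d F : derived_endo F ->
  (forall b i, gr d (ge ((-1) ^+ (~~ b) * d i + 1)) (F (gen g b i) - gen g b i)) ->
  raising d F.
Proof.
move=> [Fst Flin Fbr] Hgen.
have F0 := endo0 (DerivedEndo Fst Flin Fbr).
have step a b x y : der x -> der y -> gr d (ge a) x -> gr d (ge b) y ->
    gr d (ge (a + 1)) (F x - x) -> gr d (ge (b + 1)) (F y - y) ->
    gr d (ge (a + b + 1)) (F (bracket x y) - bracket x y).
  move=> dx dy gx gy Hx Hy.
  have -> : F (bracket x y) - bracket x y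
      = bracket (F x - x) (F y - y) + bracket (F x - x) y + bracket x (F y - y).
    rewrite Fbr // -bracketDr subrK bracketBr bracketBl.
    by rewrite addrA subrK.
  have lc := gr_lin_closed g d (ge (a + b + 1)).
  apply: (lincD lc); first apply: (lincD lc).
  - apply: (gr_bracket Hx Hy) => p q; rewrite /ge => Hp Hq; lia.
  - apply: (gr_bracket Hx gy) => p q; rewrite /ge => Hp Hq; lia.
  - apply: (gr_bracket gx Hy) => p q; rewrite /ge => Hp Hq; lia.
have grg b i : gr d (ge ((-1) ^+ (~~ b) * d i)) (gen g b i).
  by apply: gr_gen; rewrite /ge.
have Hmon y : gr d (ge (monomial_deg d y + 1)) (F (monomial_val g y) - monomial_val g y).
  have dm := derived_monomial g hcartan.
  case: y => [i|[[b w] i]] /=.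
    rewrite coroot_bracket -scaleN1r -[X in F X]addr0 Flin; first last.
    - exact: linc0 (derived_lin_closed g).
    - exact: derived_bracket.
    rewrite F0 addr0 -scalerBr; apply: (lincZ (gr_lin_closed _ _ _)).
    have := step _ _ _ _ (derived_gen g hcartan true i) (derived_gen g hcartan false i)
      (grg true i) (grg false i) (Hgen true i) (Hgen false i).
    by rewrite /= expr0 expr1 mul1r mulN1r subrr.
  elim: w => [|j w IH] /=; first by rewrite big_seq1; exact: Hgen.
  have gw : gr d (ge (monomial_deg d (inr (b, w, i)))) (word_val g b w i).
    by apply: (@gr_monomial _ _ _ _ g d _ (inr (b, w, i))); rewrite /ge.
  have := step _ _ _ _ (derived_gen g hcartan b j) (dm (inr (b, w, i)))
      (grg b j) gw (Hgen b j) IH.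
  by rewrite /= !big_cons -mulrDr addrCA.
move=> l x dx /(gr_span dx).
pose Q y := der y /\ gr d (ge (l + 1)) (F y - y).
suff lc : lin_closed Q.
  move=> Hs; suff [] : Q x by [].
  move: x Hs {dx}; apply: span_ind => // y [z lz ->].
  split; first exact: derived_monomial.
  by apply: gr_sub (Hmon z) => j; rewrite /ge; move: lz; rewrite /ge; lia.
have lc := gr_lin_closed g d (ge (l + 1)).
split; first by split; [exact: linc0 (derived_lin_closed g)|rewrite F0 subrr; exact: linc0 lc].
move=> a y z [dy Hy] [dz Hz]; split; first exact: (derived_lin_closed g).2.
by rewrite Flin // opprD addrACA -scalerBr; exact: lc.2.
Qed.

Lemma endo_coroot F i : derived_endo F -> F (hh i) = - bracket (F (e i)) (F (f i)).
Proof.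
move=> HF; rewrite coroot_bracket endoN //; last exact: derived_bracket.
by rewrite (de_bracket HF) //; [exact: (derived_gen g hcartan true)
  |exact: (derived_gen g hcartan false)].
Qed.

Lemma nonlowering_gen d F : derived_endo F ->
  (forall b i, gr d (ge ((-1) ^+ (~~ b) * d i)) (F (gen g b i))) ->
  nonlowering d F.
Proof.
move=> HF Hgen.
have step a b x y : der x -> der y -> gr d (ge a) (F x) -> gr d (ge b) (F y) ->
    gr d (ge (a + b)) (F (bracket x y)).
  move=> dx dy Hx Hy; rewrite (de_bracket HF) //.
  by apply: (gr_bracket Hx Hy) => p q; exact: lerD.
have Hmon y : gr d (ge (monomial_deg d y)) (F (monomial_val g y)).
  case: y => [i|[[b w] i]] /=.
    rewrite endo_coroot // -(de_bracket HF); last 2 first.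
    - exact: (derived_gen g hcartan true).
    - exact: (derived_gen g hcartan false).
    apply: (lincN (gr_lin_closed _ _ _)).
    have := step _ _ _ _ (derived_gen g hcartan true i)
      (derived_gen g hcartan false i) (Hgen true i) (Hgen false i).
    by rewrite /= expr0 expr1 mul1r mulN1r subrr.
  elim: w => [|j w IH] /=; first by rewrite big_seq1; exact: Hgen.
  have := step _ _ _ _ (derived_gen g hcartan b j)
    (derived_monomial g hcartan (inr (b, w, i))) (Hgen b j) IH.
  by rewrite /= !big_cons -mulrDr addrCA.
move=> l x dx /(gr_span dx).
pose Q y := der y /\ gr d (ge l) (F y).
suff lc : lin_closed Q.
  move=> Hs; suff [] : Q x by [].
  move: x Hs {dx}; apply: span_ind => // y [z lz ->].
  split; first exact: derived_monomial.
  by apply: gr_sub (Hmon z) => j; exact: le_trans lz.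
have lc := gr_lin_closed g d (ge l).
split; first by split; [exact: linc0 (derived_lin_closed g)|rewrite endo0 //; exact: linc0 lc].
move=> a y z [dy Hy] [dz Hz]; split; first exact: (derived_lin_closed g).2.
by rewrite (de_linear HF) //; exact: lc.2.
Qed.

Lemma raising_nonlowering d F : raising d F -> nonlowering d F.
Proof.
move=> H l x dx gx; rewrite -[F x](subrK x).
apply: (lincD (gr_lin_closed _ _ _)) => //.
by apply: gr_sub (H l x dx gx) => j; rewrite /ge; lia.
Qed.

Lemma add_eq_sub (V : zmodType) (x y z t : V) : x + y = z + t -> x - z = t - y.
Proof. by move=> E; rewrite -[x](addrK y) E addrAC [z + t]addrC addrK. Qed.

Lemma endo_rel_h F b i j : derived_endo F ->
  bracket (F (hh i)) (F (gen g b j)) = ((-1) ^+ (~~ b) * (A i j)%:~R) *: F (gen g b j).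
Proof.
move=> HF; have dg := derived_gen g hcartan b j.
rewrite -(de_bracket HF) //; last exact: (derived_monomial g hcartan (inl i)).
rewrite bracket_h_gen cartan_eval_coroot -[_ *: _]addr0 (de_linear HF) //.
  by rewrite endo0 // addr0.
exact: linc0 (derived_lin_closed g).
Qed.

Lemma coroot_grades i : grades D (coroot D k i) (coroot_grading i).
Proof. by move=> j; exact: cartan_eval_coroot. Qed.

Lemma gr_genE d b i : gr d (deg_eq ((-1) ^+ (~~ b) * d i)) (gen g b i).
Proof. exact: gr_gen. Qed.

(** The unipotent radical of the minimal parabolic of [i] lies in the full unipotent group. The
    coheight alone would let [f_j] acquire a multiple of [f_i], or [e_i] a combination of the other
    [e_l]; the weights under the coroot of [i] exclude both. *)
Lemma raising_coheight_height i F : derived_endo F ->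
  raising (coheight i) F -> raising height F.
Proof.
move=> HF HR.
have dg b j := derived_gen g hcartan b j.
have dF x : der x -> der (F x - x).
  by move=> dx; apply: (lincB (derived_lin_closed g)) => //; exact: (de_stable HF).
have dh : der (hh i) by exact: (derived_monomial g hcartan (inl i)).
have ci j : j != i -> coheight i j = 1 by rewrite /coheight => /negPf ->.
have cii : coheight i i = 0 by rewrite /coheight eqxx.
have R b j : gr (coheight i) (ge ((-1) ^+ (~~ b) * coheight i j + 1)) (F (gen g b j) - gen g b j).
  by apply: HR => //; apply: gr_gen; rewrite /ge.
have Rh : gr height (ge 1) (F (hh i) - hh i).
  apply: (@coheight_height i) => //; first exact: dF.
  by rewrite -[1]add0r; apply: HR => //; apply: gr_coroot; rewrite /ge.
have ghh b j : gr height (deg_eq ((-1) ^+ (~~ b))) (gen g b j).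
  by rewrite -[_ ^+ _]mulr1; exact: gr_genE.
apply: raise_gen => // b j; rewrite mulr1.
have ch b' l x : der x -> gr (coheight i) (ge l) x -> 0 < l ->
    (-1) ^+ (~~ b') + 1 <= l -> gr height (ge ((-1) ^+ (~~ b') + 1)) x.
  move=> dx Hx l0 le; apply: gr_sub (coheight_height l0 dx Hx) => p.
  exact: le_trans.
have [Ej|ji] := eqVneq j i; last first.
  case: b; first by apply: (ch true _ _ _ (R true j)); rewrite ?ci //; exact: dF.
  set y := F _ - _; have dy : der y by exact: dF.
  have gy : gr (coheight i) (ge 0) y.
    by have := R false j; rewrite ci.
  (* The only non-zero monomial of coheight at least 0 and negative height is [f_i] itself; [y1] is
     the multiple of it in [y]. *)
  have [y1 [y2 [Ey y1f y1h y2h]]] : exists y1 y2, [/\ y = y1 + y2,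
      gr (coroot_grading i) (deg_eq (-2)) y1, gr height (deg_eq (-1)) y1
      & gr height (ge 0) y2].
    have := gr_span dy gy.
    move: {dy gy} y; apply: span_ind.
      split; first exists 0, 0; first by split; rewrite ?addr0 //; exact: (linc0 (gr_lin_closed _ _ _)).
      move=> a u v [u1 [u2 [-> ? ? ?]]] [v1 [v2 [-> ? ? ?]]].
      exists (a *: u1 + v1), (a *: u2 + v2); split; last 3 first.
      - exact: (gr_lin_closed _ _ _).2.
      - exact: (gr_lin_closed _ _ _).2.
      - exact: (gr_lin_closed _ _ _).2.
      by rewrite scalerDr addrACA.
    move=> y [z Hz ->]; move: Hz; case: z => [l|[[[] w] l]].
    - exists 0, (hh l); split; rewrite ?add0r //; try exact: (linc0 (gr_lin_closed _ _ _)).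
      exact: gr_coroot.
    - move=> _; exists 0, (word_val g true w l); split; rewrite ?add0r //; try exact: (linc0 (gr_lin_closed _ _ _)).
      by apply: (@gr_monomial _ _ _ _ g _ _ (inr (true, w, l))); rewrite height_deg.
    rewrite coheight_deg /ge oppr_ge0 lez_nat leqn0 => /eqP cnt.
    case: w cnt => [|a w] cnt.
      move: cnt => /=; case: eqP => //= -> _; exists (gen g false i), 0.
      split; rewrite ?addr0 //.
      + by apply: gr_gen; rewrite /deg_eq (gcm_diag hcartan).
      + exact: (ghh false).
      + exact: (linc0 (gr_lin_closed _ _ _)).
    have -> : monomial_val g (inr (false, a :: w, l)) = 0 by apply: word_const0 cnt.
    by exists 0, 0; split; rewrite ?addr0 //; exact: (linc0 (gr_lin_closed _ _ _)).
  suff y10 : y1 = 0 by rewrite Ey y10 add0r.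
  (* Transporting the relation [[h_i, f_j] = - a_ij f_j] and reading height -1 makes [y1] an
     eigenvector of [h_i] for [- a_ij >= 0], while multiples of [f_i] have eigenvalue -2. *)
  have := endo_rel_h false i j HF; rewrite /= expr1 mulN1r.
  have -> : F (gen g false j) = gen g false j + y by rewrite addrC subrK.
  have -> : F (hh i) = hh i + (F (hh i) - hh i) by rewrite addrC subrK.
  move: (F (hh i) - hh i) Rh => s Rs; rewrite bracketDl bracketDr.
  rewrite bracket_h_gen cartan_eval_coroot /= expr1 mulN1r scalerDr -addrA => /addrI.
  rewrite [in X in X = _]Ey bracketDr [in X in _ = X]Ey scalerDr -addrA.
  move=> /add_eq_sub E.
  have Z : bracket (hh i) y1 - - (A i j)%:~R *: y1 = 0.
    apply: (@gr_disjoint _ _ _ _ g height (deg_eq (-1)) (ge 0)).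
    - apply: (lincB (gr_lin_closed _ _ _)).
        apply: (gr_bracket (gr_coroot g height i (erefl : deg_eq 0 0)) y1h).
        by move=> p q -> ->.
      exact: (lincZ (gr_lin_closed _ _ _)).
    - rewrite E; apply: (lincB (gr_lin_closed _ _ _)).
        exact: (lincZ (gr_lin_closed _ _ _)).
      apply: (lincD (gr_lin_closed _ _ _)).
        apply: (gr_bracket (gr_coroot g height i (erefl : deg_eq 0 0)) y2h).
        by move=> p q ->; rewrite add0r.
      apply: (gr_bracket (P := ge 1) (Q := ge (-1)) Rs).
        apply: (lincD (gr_lin_closed _ _ _)); first by apply: gr_gen.
        apply: (lincD (gr_lin_closed _ _ _)).
          by apply: gr_sub y1h => p ->.
        by apply: gr_sub y2h => p; exact: le_trans.
      by rewrite /ge => p q; lia.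
    - by move=> l ->.
  apply: (gr_eigen0 y1f (@coroot_grades i) (l := - A i j)).
    by rewrite rmorphN; apply/eqP; rewrite -subr_eq0; apply/eqP.
  have ij : i != j by rewrite eq_sym.
  by move=> l ->; have := gcm_offdiag hcartan ij; rewrite /=; lia.
rewrite {}Ej {j}; case: b; last first.
  have Hf := R false i; rewrite cii mulr0 add0r in Hf.
  apply: gr_sub (coheight_height (l := 1) _ (dF _ (dg false i)) Hf) => // p.
  exact: le_trans.
set y := F _ - _; have dy : der y by exact: dF.
have gy : gr (coheight i) (ge 1) y by have := R true i; rewrite cii mulr0 add0r.
have [y1 [y2 [Ey y1f y1h y2h]]] : exists y1 y2, [/\ y = y1 + y2,
    gr (coroot_grading i) (fun l => l <= 0) y1, gr height (deg_eq 1) y1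
    & gr height (ge 2) y2].
  have := gr_span dy gy.
  move: {dy gy} y; apply: span_ind.
    split; first exists 0, 0; first by split; rewrite ?addr0 //; exact: (linc0 (gr_lin_closed _ _ _)).
    move=> a u v [u1 [u2 [-> ? ? ?]]] [v1 [v2 [-> ? ? ?]]].
    exists (a *: u1 + v1), (a *: u2 + v2); split; last 3 first.
    - exact: (gr_lin_closed _ _ _).2.
    - exact: (gr_lin_closed _ _ _).2.
    - exact: (gr_lin_closed _ _ _).2.
    by rewrite scalerDr addrACA.
  move=> y [z Hz ->]; move: Hz; case: z => [l|[[b w] l]] //.
  rewrite coheight_deg /ge; case: b => [cnt|]; last by lia.
  case: w cnt => [|a w] cnt.
    exists (gen g true l), 0; split; rewrite ?addr0 //.
    + apply: gr_gen; rewrite /= expr0 mul1r.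
      move: cnt => /=; case: eqP => //= li _.
      by apply: (gcm_offdiag hcartan); apply/eqP => il; apply: li.
    + by have := ghh true l.
    + exact: (linc0 (gr_lin_closed _ _ _)).
  exists 0, (word_val g true (a :: w) l); split; rewrite ?add0r //; try exact: (linc0 (gr_lin_closed _ _ _)).
  by apply: (@gr_monomial _ _ _ _ g _ _ (inr (true, a :: w, l))); rewrite height_deg.
suff y10 : y1 = 0 by rewrite Ey y10 add0r.
(* The same comparison for [[h_i, e_i] = 2 e_i]: in height 1 the vector [y1] would have eigenvalue
   2, but it combines [e_l] with [l] different from [i], whose eigenvalues [a_il] are at most 0. *)
have := endo_rel_h true i i HF; rewrite /= expr0 mul1r.
have -> : F (gen g true i) = gen g true i + y by rewrite addrC subrK.
have -> : F (hh i) = hh i + (F (hh i) - hh i) by rewrite addrC subrK.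
move: (F (hh i) - hh i) Rh => s Rs; rewrite bracketDl bracketDr.
rewrite bracket_h_gen cartan_eval_coroot /= expr0 mul1r scalerDr -addrA => /addrI.
rewrite [in X in X = _]Ey bracketDr [in X in _ = X]Ey scalerDr -addrA.
move=> /add_eq_sub E.
have Z : bracket (hh i) y1 - (A i i)%:~R *: y1 = 0.
  apply: (@gr_disjoint _ _ _ _ g height (deg_eq 1) (ge 2)).
  - apply: (lincB (gr_lin_closed _ _ _)).
      apply: (gr_bracket (gr_coroot g height i (erefl : deg_eq 0 0)) y1h).
      by move=> p q -> ->.
    exact: (lincZ (gr_lin_closed _ _ _)).
  - rewrite E; apply: (lincB (gr_lin_closed _ _ _)).
      exact: (lincZ (gr_lin_closed _ _ _)).
    apply: (lincD (gr_lin_closed _ _ _)).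
      apply: (gr_bracket (gr_coroot g height i (erefl : deg_eq 0 0)) y2h).
      by move=> p q ->; rewrite add0r.
    apply: (gr_bracket (P := ge 1) (Q := ge 1) Rs).
      apply: (lincD (gr_lin_closed _ _ _)); first by apply: gr_gen.
      apply: (lincD (gr_lin_closed _ _ _)).
        by apply: gr_sub y1h => p ->.
      by apply: gr_sub y2h => p; exact: le_trans.
    by rewrite /ge => p q; lia.
  - by move=> l ->.
apply: (gr_eigen0 y1f (@coroot_grades i) (l := A i i)).
  by apply/eqP; rewrite -subr_eq0; apply/eqP.
by move=> l; rewrite (gcm_diag hcartan); lia.
Qed.

End Raising.

(** * Splitting off the root group of a simple root *)

Section Factorization.
Variables (n : nat) (A : 'M[int]_n) (D : root_datum A) (k : numFieldType).
Variable g : kac_moody_algebra D k.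
Hypothesis hcartan : generalized_cartan A.
Local Notation der := (@derived_algebra k g).
Local Notation e i := (gen g true i).
Local Notation f i := (gen g false i).
Local Notation hh i := (km_h g (coroot D k i)).
Local Notation ht := (@height n).
Implicit Types F : g -> g.

Lemma coheight_id (i : 'I_n) : coheight i i = 0.
Proof. by rewrite /coheight eqxx. Qed.

Lemma coheight_neq (i j : 'I_n) : j != i -> coheight i j = 1.
Proof. by rewrite /coheight => /negPf ->. Qed.

Lemma der_coroot i : der (hh i).
Proof. exact: (derived_monomial g hcartan (inl i)). Qed.

Lemma der_diff F x : derived_endo F -> der x -> der (F x - x).
Proof.
by move=> HF dx; apply: (lincB (derived_lin_closed g)) => //; exact: (de_stable HF).
Qed.

Lemma raising_height_gen F b j : raising ht F ->
  gr ht (ge ((-1) ^+ (~~ b) + 1)) (F (gen g b j) - gen g b j).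
Proof.
move=> HR; apply: HR; first exact: derived_gen.
by apply: gr_gen; rewrite mulr1 /ge.
Qed.

Lemma raising_height_nonlowering i F : derived_endo F ->
  raising ht F -> nonlowering (coheight i) F.
Proof.
move=> HF HR; apply: nonlowering_gen => // b j.
have dx := der_diff HF (derived_gen g hcartan b j).
rewrite -[F _](subrK (gen g b j)); apply: (lincD (gr_lin_closed _ _ _)); last first.
  by apply: gr_gen; rewrite /ge.
have := raising_height_gen b j HR; case: b dx => dx H.
  apply: gr_sub (height_ge2_coheight i dx H) => p; apply: le_trans.
  by rewrite expr0 mul1r /coheight; case: eqP.
apply: gr_sub (height_ge0_coheight i dx H) => p; apply: le_trans.
by rewrite expr1 mulN1r oppr_le0 /coheight; case: eqP.
Qed.

Lemma height_ge1_split i x : der x -> gr ht (ge 1) x ->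
  exists (s : k) y, [/\ x = s *: e i + y, gr (coheight i) (ge 1) y & gr ht (ge 1) y].
Proof.
move=> dx gx; have := gr_span dx gx; move: {dx gx} x.
apply: span_ind.
  split; first by exists 0, 0; rewrite scale0r addr0; split=> //; exact: (linc0 (gr_lin_closed _ _ _)).
  move=> a u v [s [u' [-> ? ?]]] [t [v' [-> ? ?]]].
  exists (a * s + t), (a *: u' + v'); split; last 2 first.
  - exact: (gr_lin_closed _ _ _).2.
  - exact: (gr_lin_closed _ _ _).2.
  by rewrite scalerDl scalerDr scalerA addrACA.
move=> x [[l|[[b w] l]] + ->]; rewrite height_deg //=.
case: b => // H; case: (posnP (count (predC1 i) (l :: w))) => [cnt|cnt].
  case: w cnt {H} => [|a w] cnt.
    exists 1, 0; rewrite scale1r addr0; split; try exact: (linc0 (gr_lin_closed _ _ _)).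
    by move: cnt => /=; case: eqP => //= ->.
  exists 0, 0; rewrite scale0r addr0; split; try exact: (linc0 (gr_lin_closed _ _ _)).
  by apply: word_const0 cnt.
exists 0, (word_val g true w l); rewrite scale0r add0r; split=> //.
  by apply: (@gr_monomial _ _ _ _ g _ _ (inr (true, w, l))); rewrite coheight_deg /ge.
by apply: (@gr_monomial _ _ _ _ g _ _ (inr (true, w, l))); rewrite height_deg.
Qed.

Lemma bracket_ef i : bracket (e i) (f i) = - hh i.
Proof. by rewrite /gen (km_ef (km_rel g)) eqxx scale1r. Qed.

Lemma bracket_he i j : bracket (hh i) (e j) = (A i j)%:~R *: e j.
Proof. by rewrite bracket_h_gen cartan_eval_coroot expr0 mul1r. Qed.

Lemma bracket_hf i j : bracket (hh i) (f j) = - (A i j)%:~R *: f j.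
Proof. by rewrite bracket_h_gen cartan_eval_coroot expr1 mulN1r. Qed.

Lemma height_ge0_split x : der x -> gr ht (ge 0) x ->
  exists h y, [/\ x = h + y, forall i, bracket (hh i) h = 0, gr ht (deg_eq 0) h
    & gr ht (ge 1) y].
Proof.
move=> dx gx; have := gr_span dx gx; move: {dx gx} x.
apply: span_ind.
  split.
    exists 0, 0; split; rewrite ?addr0 // => *; rewrite ?bracket0r //;
    exact: (linc0 (gr_lin_closed _ _ _)).
  move=> a u v [s [u' [-> Hs ? ?]]] [t [v' [-> Ht ? ?]]].
  exists (a *: s + t), (a *: u' + v'); split; last 2 first.
  - exact: (gr_lin_closed _ _ _).2.
  - exact: (gr_lin_closed _ _ _).2.
  - by rewrite scalerDr addrACA.
  - by move=> i; rewrite bracket_linear_r Hs Ht scaler0 addr0.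
move=> x [[l|[[b w] l]] + ->]; rewrite height_deg.
  move=> _; exists (hh l), 0; rewrite addr0; split=> //.
  - by move=> i; rewrite (km_hh (km_rel g)).
  - exact: gr_coroot.
  - exact: (linc0 (gr_lin_closed _ _ _)).
case: b; last by rewrite /ge oppr_ge0.
move=> _; exists 0, (word_val g true w l); rewrite add0r; split => //.
- by move=> i; rewrite bracket0r.
- exact: (linc0 (gr_lin_closed _ _ _)).
- by apply: (@gr_monomial _ _ _ _ g _ _ (inr (true, w, l))); rewrite height_deg.
Qed.

(** To first order [F] acts on the rank-one subalgebra of [i] like [exp (- r ad e_i)]. That [f_i]
    and [h_i] see the same [r] follows from the relation [[h_i, f_i] = - 2 f_i], transported by [F]
    and read in height 0. *)
Lemma factor_parameter i F : derived_endo F -> raising ht F ->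
  exists r : k, gr ht (ge 1) (F (f i) - f i - r *: hh i) /\
    gr (coheight i) (ge 1) (F (hh i) - hh i - (2 * r) *: e i).
Proof.
move=> HF HR.
have dh := der_coroot i.
have Hh : gr ht (ge 1) (F (hh i) - hh i).
  by rewrite -[1]add0r; apply: HR => //; apply: gr_coroot; rewrite /ge.
have [s [y [Ey yi yh]]] := height_ge1_split i (der_diff HF dh) Hh.
have Hf := raising_height_gen false i HR.
rewrite /= expr1 subrr in Hf.
have [h [z [Ez hcomm h0 z1]]] := height_ge0_split (der_diff HF (derived_gen g hcartan false i)) Hf.
have E := endo_rel_h hcartan false i i HF.
have FhE : F (hh i) = hh i + (s *: e i + y) by rewrite -Ey addrC subrK.
have FfE : F (f i) = f i + (h + z) by rewrite -Ez addrC subrK.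
rewrite FhE FfE (gcm_diag hcartan) expr1 mulN1r in E.
rewrite bracketDl bracketDr bracket_hf (gcm_diag hcartan) scalerDr -addrA in E.
move/addrI: E; rewrite bracketDr hcomm add0r bracketDl bracketDr.
rewrite bracketZl bracket_ef scalerN scalerDr => E.
(* [- s h_i] and [- 2 h] are the terms of height 0 *)
have E2 : s *: hh i - 2 *: h = 2 *: z + (bracket (hh i) z
    + (bracket (s *: e i) (h + z) + bracket y (f i + (h + z)))).
  move: E; set a := bracket (hh i) z; set b := bracket (s *: e i) _.
  set d := bracket y _; set sh := s *: hh i.
  rewrite !scaleNr -addrA addrCA [- sh + _]addrC => /eqP; rewrite subr_eq => /eqP ->.
  by rewrite [X in X + sh]addrC addrA addNKr addrC.
have gl := gr_lin_closed g ht (ge 1).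
have e1 : gr ht (deg_eq 1) (e i) by apply: gr_gen.
have Z : s *: hh i - 2 *: h = 0.
  apply: (@gr_disjoint _ _ _ _ g ht (deg_eq 0) (ge 1)) => [||l -> //].
    apply: (lincB (gr_lin_closed _ _ _)); apply: (lincZ (gr_lin_closed _ _ _)) => //.
    exact: gr_coroot.
  rewrite E2; apply: (lincD gl); first exact: (lincZ gl).
  apply: (lincD gl).
    by apply: (gr_bracket (gr_coroot g ht i (erefl : deg_eq 0 0)) z1) => p q ->; rewrite add0r.
  have hz : gr ht (ge 0) (h + z).
    apply: (lincD (gr_lin_closed _ _ _)); first by apply: gr_sub h0 => l ->; rewrite /ge.
    by apply: gr_sub z1 => p; exact: le_trans.
  apply: (lincD gl).
    rewrite bracketZl; apply: (lincZ gl).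
    by apply: (gr_bracket e1 hz) => p q ->; rewrite /ge; lia.
  rewrite bracketDr; apply: (lincD gl).
    apply: (@coheight_height _ _ _ _ _ i 1) => //; first exact: derived_bracket.
    have fi : gr (coheight i) (deg_eq 0) (f i).
      by apply: gr_gen; rewrite coheight_id mulr0.
    by apply: (gr_bracket yi fi) => p q Hp ->; rewrite addr0.
  by apply: (gr_bracket yh hz); rewrite /ge => p q; lia.
have two0 : 2 != 0 :> k by rewrite pnatr_eq0.
have hE : h = (s / 2) *: hh i.
  move/subr0_eq: Z => Z; apply: (scalerI two0).
  by rewrite -Z scalerA mulrCA mulfV ?mulr1.
exists (s / 2); split; first by rewrite Ez hE addrAC subrr add0r.
by rewrite mulrCA mulfV // mulr1 Ey addrAC subrr add0r.
Qed.

Definition string (i j : 'I_n) (p : nat) : g := iter p (bracket (e i)) (e j).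

(** The usual sl_2 computation for a string starting at the lowest vector [e_j]; the sign reflects
    the convention [[f_i, e_i] = h_i]. *)
Lemma string_lower i j p : j != i ->
  bracket (f i) (string i j p.+1)
  = ((p.+1)%:R * ((A i j)%:~R + p%:R)) *: string i j p.
Proof.
move=> ji; have ij : i != j by rewrite eq_sym.
have hw q : bracket (hh i) (string i j q) = ((A i j)%:~R + 2 * q%:R) *: string i j q.
  elim: q => [|q IH]; first by rewrite mulr0 addr0; exact: bracket_he.
  rewrite /string iterS -/(string i j q) leibniz IH bracket_he bracketZl bracketZr.
  by rewrite (gcm_diag hcartan) -scalerDl; congr (_ *: _); rewrite mulrSr; ring.
have fe : bracket (f i) (e i) = hh i by rewrite bracketC bracket_ef opprK.
have fej : bracket (f i) (e j) = 0.
  by rewrite bracketC /gen (km_ef (km_rel g)) eq_sym (negPf ij) scale0r !oppr0.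
elim: p => [|p IH]; rewrite [string i j _.+1]/string iterS -/(string i j _) leibniz fe hw.
  by rewrite /string /= fej bracket0r addr0; congr (_ *: _); ring.
rewrite IH bracketZr -scalerDl; congr (_ *: _).
by rewrite !mulrSr; ring.
Qed.

(** The lowering coefficient vanishes at [p = - a_ij] only, and exactly there the Serre relation
    kills the next vector of the string. *)
Lemma string_serre i j p : j != i -> (A i j)%:~R + p%:R = 0 :> k ->
  string i j p.+1 = 0.
Proof.
move=> ji E; have ij : i != j by rewrite eq_sym.
have : A i j + p%:Z = 0 by apply/eqP; rewrite -(intr_eq0 k) rmorphD /= E.
move=> /eqP; rewrite addr_eq0 => /eqP Aij.
have := km_serre_e (km_rel g) ij; rewrite Aij opprK.
by rewrite (_ : absz (1 + p%:Z) = p.+1).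
Qed.

(** A crude common bound for all Serre exponents, so that [string_span] has a finite index set. *)
Definition string_bound : nat := \sum_i \sum_j `|1 - A i j|%N.

Lemma string_vanish i j p : j != i -> (string_bound <= p)%N -> string i j p = 0.
Proof.
move=> ji le; have ij : i != j by rewrite eq_sym.
have lep : (`|1 - A i j|%N <= p)%N.
  apply: leq_trans le; rewrite /string_bound (bigD1 i) //= (bigD1 j) //= -addnA.
  exact: leq_addr.
rewrite /string -(subnK lep) iterD (km_serre_e (km_rel g) ij).
by elim: (p - _)%N => //= q ->; rewrite bracket0r.
Qed.

Lemma string_self i p : string i i p.+1 = 0.
Proof.
by elim: p => [|p IH]; rewrite /string iterS -/(string i i _) ?IH ?bracket0r ?bracketxx.
Qed.

Lemma homogeneous_string d i j p :
  homogeneous (g := g) d (p%:Z * d i + d j) (string i j p).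
Proof.
have hg l : homogeneous (g := g) d (d l) (e l).
  by have := @homogeneous_monomial _ _ _ _ g d (inr (true, [::], l)); rewrite /= big_seq1 expr0 mul1r.
elim: p => [|p IH]; first by rewrite mul0r add0r; exact: hg.
have -> : p.+1%:Z * d i + d j = d i + (p%:Z * d i + d j) by rewrite intS; ring.
rewrite /string iterS -/(string i j p); exact: homogeneous_bracket.
Qed.

Definition string_span i (x : g) : Prop :=
  exists a : 'I_n * 'I_string_bound -> k, x = \sum_q a q *: string i q.1 q.2.+1.

Lemma string_span_lin_closed i : lin_closed (string_span i).
Proof.
split; first by exists (fun=> 0); rewrite big1 // => q _; rewrite scale0r.
move=> c x y [a ->] [b ->]; exists (fun q => c * a q + b q).
rewrite scaler_sumr -big_split; apply: eq_bigr => q _ /=.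
by rewrite scalerDl scalerA.
Qed.

Lemma string_span_in i j p : string_span i (string i j p.+1).
Proof.
have lc := string_span_lin_closed i.
have [->|ji] := eqVneq j i; first by rewrite string_self; exact: linc0 lc.
case: (ltnP p string_bound) => [lt|le]; last first.
  by rewrite string_vanish //; [exact: linc0 lc|exact: leqW].
exists (fun q => (q == (j, Ordinal lt))%:R).
rewrite (bigD1 (j, Ordinal lt)) //= eqxx scale1r big1 ?addr0 //.
by move=> q /negPf ->; rewrite scale0r.
Qed.

(* The lowest weight vectors of the i-strings are the e_j. *)
Lemma string_span_lowest i x : string_span i x -> bracket (f i) x = 0 -> x = 0.
Proof.
move=> [a ->]; rewrite bracket_sumr => Z.
pose N := string_bound.
(* A grading that separates all strings: [p] copies of [i] above [j] get the degree [N (j + 1) + p]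
   with [p < N], from which division by [N] recovers [j] and [p]. The string through [i] itself
   vanishes. *)
pose d (j : 'I_n) : int := if j == i then 1 else (N * j.+1)%N%:Z.
pose lam (q : 'I_n * 'I_N) : int := (N * q.1.+1 + q.2)%N%:Z.
have inj : injective lam.
  move=> [j p] [j' p'] /(congr1 absz) /= E; have N0 : (0 < N)%N by apply: leq_ltn_trans (ltn_ord p).
  have Ej : j = j' :> nat.
    have := congr1 (divn^~ N) E; rewrite /= ![(N * _)%N]mulnC !divnMDl //.
    by rewrite !divn_small // !addn0 => -[].
  have Ep : p = p' :> nat by move/eqP: E; rewrite Ej eqn_add2l => /eqP.
  by congr pair; apply: val_inj.
have F0 q : bracket (f i) (a q *: string i q.1 q.2.+1) = 0.
  apply: (homogeneous_family0 inj _ Z (d := d)) => {}q.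
  have [E|ji] := eqVneq q.1 i.
    by rewrite E string_self scaler0 bracket0r; exact: linc0 (homogeneous_lin_closed _ _ _).
  rewrite bracketZr string_lower // scalerA.
  apply: (lincZ (homogeneous_lin_closed _ _ _)).
  have := @homogeneous_string d i q.1 q.2.
  by rewrite /d eqxx (negPf ji) mulr1 addrC -PoszD.
apply: big1 => q _; have [E|ji] := eqVneq q.1 i.
  by rewrite E string_self scaler0.
have := F0 q; rewrite bracketZr string_lower // scalerA mulrA => /eqP.
have [E|ne] := eqVneq ((A i q.1)%:~R + q.2%:R) (0 : k).
  by rewrite string_serre ?scaler0.
rewrite scaler_eq0 !mulf_eq0 (negPf ne) orbF pnatr_eq0 orbF => /orP[/eqP ->|/eqP s0].
  by rewrite scale0r.
by rewrite /string iterS -/(string i q.1 q.2) s0 bracket0r scaler0.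
Qed.

(** If the exceptional letter stands inside, the word already is a string up to sign; if it stands
    further out, the inner part is a repeated bracket of [e_i] and vanishes. *)
Lemma word_string i w j : count (predC1 i) (j :: w) = 1%N ->
  exists (a : k) l, word_val g true w j = a *: string i l (size w).
Proof.
elim: w => [_|x w IH] /=; first by exists 1, j; rewrite scale1r.
have [->|xi] := eqVneq x i => /= cnt.
  have [|a [l E]] := IH; first by rewrite /= -cnt add0n.
  by exists a, l; rewrite E bracketZr.
case: w IH cnt => [_|y w _] /=.
  case: eqP => // -> _; exists (-1), x.
  by rewrite scaleN1r bracketC.
rewrite addnCA => /eqP; rewrite add1n eqSS => /eqP cnt.
exists 0, j; rewrite scale0r.
rewrite -[bracket (gen g true y) _]/(word_val g true (y :: w) j).
by rewrite (@word_const0 _ _ _ _ g true i) ?bracket0r.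
Qed.

Lemma height_ge2_split i x : der x -> gr ht (ge 2) x ->
  exists z y, [/\ x = z + y, string_span i z, gr (coheight i) (deg_eq 1) z
    & gr (coheight i) (ge 2) y].
Proof.
move=> dx gx; have := gr_span dx gx; move: {dx gx} x.
apply: span_ind.
  split; first by exists 0, 0; rewrite addr0; split;
    [|exact: linc0 (string_span_lin_closed _)|exact: (linc0 (gr_lin_closed _ _ _))..].
  move=> a u v [s [u' [-> ? ? ?]]] [t [v' [-> ? ? ?]]].
  exists (a *: s + t), (a *: u' + v'); split.
  - by rewrite scalerDr addrACA.
  - exact: (string_span_lin_closed _).2.
  - exact: (gr_lin_closed _ _ _).2.
  - exact: (gr_lin_closed _ _ _).2.
move=> x [[l|[[b w] l]] + ->]; rewrite height_deg //=.
case: b => // H.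
have E0 : forall y, gr (coheight i) (ge 2) y -> exists z y0, [/\ y = z + y0, string_span i z,
    gr (coheight i) (deg_eq 1) z & gr (coheight i) (ge 2) y0].
  move=> y gy; exists 0, y; rewrite add0r; split => //.
    exact: linc0 (string_span_lin_closed _).
  exact: (linc0 (gr_lin_closed _ _ _)).
case: (ltngtP (count (predC1 i) (l :: w)) 1) => cnt.
- rewrite (@word_const0 _ _ _ _ g true i); first by apply: E0; exact: (linc0 (gr_lin_closed _ _ _)).
    by case: w H {cnt}.
  by move: cnt; rewrite ltnS leqn0 => /eqP.
- apply: E0; apply: (@gr_monomial _ _ _ _ g _ _ (inr (true, w, l))).
  by rewrite coheight_deg /ge.
exists (word_val g true w l), 0; rewrite addr0; split=> //.
- have [a [j ->]] := word_string cnt; apply: (lincZ (string_span_lin_closed _)).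
  by case: w H {cnt} => // y w _; exact: string_span_in.
- apply: (@gr_monomial _ _ _ _ g _ _ (inr (true, w, l))).
  by rewrite coheight_deg /= [X in X%:Z]cnt.
- exact: (linc0 (gr_lin_closed _ _ _)).
Qed.

(** Once [f_i] acquires no coroot component, [F] has no part along the simple root [i] and lies in
    the radical. The relations [[h_i, f_i] = - 2 f_i] and [[f_i, e_j] = 0] rule out the remaining
    terms of too small coheight. *)
Lemma raising_height_coheight i F : derived_endo F -> raising ht F ->
  gr ht (ge 1) (F (f i) - f i) -> raising (coheight i) F.
Proof.
move=> HF HR Hf1.
have dg b j := derived_gen g hcartan b j.
have gl := gr_lin_closed g (coheight i).
have ei : gr (coheight i) (deg_eq 0) (e i) by apply: gr_gen; rewrite coheight_id mulr0.
have fi : gr (coheight i) (deg_eq 0) (f i) by apply: gr_gen; rewrite coheight_id mulr0.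
have hi d : gr d (deg_eq 0) (hh i) by apply: gr_coroot.
have Hfi : gr (coheight i) (ge 1) (F (f i) - f i).
  have [s [y [Ey yi _]]] := height_ge1_split i (der_diff HF (dg false i)) Hf1.
  have Hh : gr ht (ge 1) (F (hh i) - hh i).
    by rewrite -[1]add0r; apply: HR; [exact: der_coroot|apply: gr_coroot; rewrite /ge].
  have [t [z [Ez zi _]]] := height_ge1_split i (der_diff HF (der_coroot i)) Hh.
  (* In coheight 0 the transported relation says [4 s e_i = t h_i]; the two sides have heights 1 and
     0, so [s e_i] is 0. *)
  have := endo_rel_h hcartan false i i HF.
  have -> : F (hh i) = hh i + (t *: e i + z) by rewrite -Ez addrC subrK.
  have -> : F (f i) = f i + (s *: e i + y) by rewrite -Ey addrC subrK.
  rewrite (gcm_diag hcartan) expr1 mulN1r.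
  rewrite bracketDl bracketDr bracket_hf (gcm_diag hcartan) scalerDr -addrA => /addrI.
  rewrite [bracket (hh i) _]bracketDr bracketZr bracket_he (gcm_diag hcartan).
  rewrite scalerDr -addrA => /add_eq_sub.
  rewrite !scalerA -scalerBl mulNr opprK [s * _]mulrC -mulrDl.
  set C := bracket (t *: e i + z) _ => E.
  have CE : gr (coheight i) (ge 1) (C + t *: hh i).
    rewrite /C bracketDl [bracket (t *: e i) _]bracketDr !bracketZl bracket_ef scalerN.
    rewrite addrAC [- _ + _]addrC subrK.
    rewrite [bracket (e i) _]bracketDr [bracket (e i) (s *: _)]bracketZr bracketxx.
    rewrite scaler0 add0r; apply: (lincD (gl _)).
      apply: (lincZ (gl _)).
      by apply: (gr_bracket ei yi) => p q ->; rewrite add0r.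
    apply: (gr_bracket (Q := ge 0) zi); last by rewrite /ge => p q; lia.
    apply: (lincD (gl _)); first by apply: gr_sub fi => p ->; rewrite /ge.
    apply: (lincD (gl _)); last by apply: gr_sub yi => p; exact: le_trans.
    by apply: (lincZ (gl _)); apply: gr_sub ei => p ->; rewrite /ge.
  have Z1 : ((2%:~R + 2%:~R) * s) *: e i - t *: hh i = 0.
    apply: (@gr_disjoint _ _ _ _ g (coheight i) (deg_eq 0) (ge 1)) => [||p -> //].
      by apply: (lincB (gl _)); apply: (lincZ (gl _)).
    rewrite E -addrA -opprD -addrA; apply: (lincB (gl _)); first exact: (lincZ (gl _)).
    apply: (lincD (gl _)) => //.
    by apply: (gr_bracket (hi _) yi) => p q ->; rewrite add0r.
  have Z2 : ((2%:~R + 2%:~R) * s) *: e i = 0.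
    apply: (@gr_disjoint _ _ _ _ g ht (deg_eq 1) (deg_eq 0)) => [||p -> //].
      by apply: (lincZ (gr_lin_closed _ _ _)); apply: gr_gen.
    by rewrite (subr0_eq Z1); apply: (lincZ (gr_lin_closed _ _ _)).
  have Z3 : s *: e i = 0.
    apply/eqP; move/eqP: Z2; rewrite -scalerA scaler_eq0 -intrD intr_eq0.
    by move=> /orP[].
  by rewrite Z3 add0r addrC addKr.
apply: raise_gen => // b j.
have dx := der_diff HF (dg b j).
have H := raising_height_gen b j HR.
have [ji|ji] := eqVneq j i.
  rewrite {}ji coheight_id mulr0 add0r in dx H *; case: b dx H => dx H; last exact: Hfi.
  exact: (height_ge2_coheight i dx H).
rewrite (coheight_neq ji); case: b dx H => dx H; last first.
  by rewrite expr1 mulr1; exact: (height_ge0_coheight i dx H).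
have [z [y [Ey zs z1 y2]]] := height_ge2_split i dx H.
suff z0 : z = 0 by rewrite Ey z0 add0r.
apply: (string_span_lowest zs).
have fe0 : bracket (f i) (e j) = 0.
  by rewrite bracketC /gen (km_ef (km_rel g)) (negPf ji) scale0r !oppr0.
(* Applying [F] to [[f_i, e_j] = 0] and keeping coheight 1 leaves [[f_i, z] = 0], so [z] would be a
   lowest weight vector strictly inside the strings. *)
have := de_bracket HF (dg false i) (dg true j); rewrite fe0 endo0 //.
have -> : F (e j) = e j + (z + y) by rewrite -Ey addrC subrK.
have -> : F (f i) = f i + (F (f i) - f i) by rewrite addrC subrK.
move: (F (f i) - f i) Hfi => w Hw.
rewrite bracketDl [bracket (f i) _]bracketDr fe0 add0r bracketDr -addrA => E.
apply: (@gr_disjoint _ _ _ _ g (coheight i) (deg_eq 1) (ge 2)) => [||p -> //].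
  by apply: (gr_bracket fi z1) => p q -> ->; rewrite add0r.
move/esym/eqP: E; rewrite addr_eq0 => /eqP ->; apply: (lincN (gl _)).
apply: (lincD (gl _)); first by apply: (gr_bracket fi y2) => p q ->; rewrite add0r.
apply: (gr_bracket (Q := ge 1) Hw); last by rewrite /ge => p q; lia.
apply: (lincD (gl _)); first by apply: gr_gen; rewrite coheight_neq.
apply: (lincD (gl _)); first by apply: gr_sub z1 => p ->; rewrite /ge.
by apply: gr_sub y2 => p; exact: le_trans.
Qed.

End Factorization.

(** * Exponentials and semilinear involutions *)

Section ExponentialOnGenerators.
Variables (n : nat) (A : 'M[int]_n) (D : root_datum A) (k : numFieldType).
Variable g : kac_moody_algebra D k.
Hypothesis hcartan : generalized_cartan A.
Local Notation der := (@derived_algebra k g).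
Local Notation hh i := (km_h g (coroot D k i)).
Local Notation ht := (@height n).

Lemma iter_bracketZ (z : k) (x y : g) N :
  iter N (bracket (z *: x)) y = z ^+ N *: iter N (bracket x) y.
Proof.
elim: N => [|N IH] /=; first by rewrite scale1r.
by rewrite IH bracketZl bracketZr scalerA exprS.
Qed.

Lemma bracket_gen_opposite b i j :
  bracket (gen g b i) (gen g (~~ b) j) = ((-1) ^+ b * (i == j)%:R) *: hh j.
Proof.
case: b; rewrite /gen /= ?expr0 ?mul1r ?expr1 ?mulN1r.
  rewrite (km_ef (km_rel g)) scaleNr.
  by case: eqP => [->|]; rewrite ?scale0r.
by rewrite bracketC (km_ef (km_rel g)) opprK eq_sym.
Qed.

Lemma gen_nilpotent b i b' j : exists N, iter N (bracket (gen g b i)) (gen g b' j) = 0.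
Proof.
have [->|neq] := eqVneq b' b.
  have [->|ji] := eqVneq j i; first by exists 1%N; rewrite /= bracketxx.
  exists `|1 - A i j|%N; have ij : i != j by rewrite eq_sym.
  by case: b; [exact: (km_serre_e (km_rel g) ij)|exact: (km_serre_f (km_rel g) ij)].
have -> : b' = ~~ b by case: b b' neq => [] [].
exists 3%N; rewrite /= bracket_gen_opposite !bracketZr.
by rewrite [bracket _ (hh j)]bracketC bracket_h_gen bracketNr bracketZr bracketxx !(scaler0, oppr0).
Qed.

(** The number of terms does not depend on [z], so the exponential is polynomial in the parameter.
    The upper limit [N.+2] guarantees a term [p = 1] that can be split off. *)
Lemma exp_ad_gen b i b' j : exists N, forall z : k,
  exp_ad (z *: gen g b i) (gen g b' j)
  = gen g b' j + \sum_(1 <= p < N.+2)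
      ((p`!%:R)^-1 * z ^+ p) *: iter p (bracket (gen g b i)) (gen g b' j).
Proof.
have [N HN] := gen_nilpotent b i b' j; exists N => z.
rewrite (@exp_adE _ _ _ _ N.+2); last first.
  by rewrite iter_bracketZ !iterS HN !bracket0r scaler0.
rewrite -(big_mkord xpredT
  (fun p => (p`!%:R)^-1 *: iter p (bracket (z *: gen g b i)) (gen g b' j))).
rewrite big_nat_recl // big_add1 /= fact0 invr1 scale1r; congr (_ + _).
by apply: eq_bigr => p _; rewrite -iterS iter_bracketZ scalerA.
Qed.

Lemma gr_iter d b i b' j p : gr d
  (deg_eq ((-1) ^+ (~~ b) * d i *+ p + (-1) ^+ (~~ b') * d j))
  (iter p (bracket (gen g b i)) (gen g b' j)).
Proof.
elim: p => [|p IH]; first by rewrite mulr0n add0r; exact: gr_gen.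
rewrite mulrS -addrA; apply: (gr_bracket _ IH (P := deg_eq ((-1) ^+ (~~ b) * d i))).
  exact: gr_gen.
by move=> x y -> ->.
Qed.

Lemma exp_ad_gr d l (z : k) b i b' j :
  (forall p, (0 < p)%N -> l <= (-1) ^+ (~~ b) * d i *+ p + (-1) ^+ (~~ b') * d j) ->
  gr d (ge l) (exp_ad (z *: gen g b i) (gen g b' j) - gen g b' j).
Proof.
move=> H; have [N ->] := exp_ad_gen b i b' j.
rewrite addrC addKr big_nat_cond; under eq_bigl => p do rewrite andbT.
rewrite -big_filter; apply: (linc_sum (gr_lin_closed _ _ _)) => p.
rewrite mem_filter => /andP[/andP[p0 _] _].
apply: (lincZ (gr_lin_closed _ _ _)).
by apply: gr_sub (gr_iter d b i b' j p) => q ->; exact: H.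
Qed.

Lemma exp_ad_ef (z : k) i :
  gr ht (ge 1) (exp_ad (z *: gen g true i) (gen g false i) - gen g false i + z *: hh i).
Proof.
have gl := gr_lin_closed g ht (ge 1).
have [N ->] := exp_ad_gen true i false i.
have eh : bracket (gen g true i) (gen g false i) = - hh i.
  by rewrite (bracket_gen_opposite true) eqxx expr1 mulr1 scaleN1r.
rewrite [gen _ _ _ + _]addrC addrK big_ltn //=.
rewrite (_ : 1`! = 1%N) // invr1 mul1r expr1 eh scalerN addrAC addNr add0r.
rewrite big_nat_cond; under eq_bigl => p do rewrite andbT.
rewrite -big_filter; apply: (linc_sum gl) => p.
rewrite mem_filter => /andP[/andP[p0 _] _]; apply: (lincZ gl).
apply: gr_sub (gr_iter ht true i false i p) => q ->.
by rewrite /ge /= expr0 expr1 !mulr1; lia.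
Qed.

End ExponentialOnGenerators.

Section Semimorphisms.
Variables (R : realType) (n : nat) (A : 'M[int]_n) (D : root_datum A).
Variable g : kac_moody_algebra D R[i].
Hypothesis hcartan : generalized_cartan A.
Local Notation C := R[i].
Local Notation m := (lattice_rank A).
Local Notation conj := (@conjc R : {rmorphism C -> C}).
Local Notation der := (@derived_algebra C g).

Definition conj_cv (x : 'cV[C]_m) : 'cV[C]_m := map_mx conj x.

Lemma cartan_eval_conj lam x : cartan_eval lam (conj_cv x) = conj (cartan_eval lam x).
Proof.
rewrite /cartan_eval !mxE rmorph_sum; apply: eq_bigr => j _.
by rewrite !mxE rmorphM rmorph_int.
Qed.

Lemma conj_cv_linear a x y : conj_cv (a *: x + y) = conj a *: conj_cv x + conj_cv y.
Proof. by rewrite /conj_cv map_mxD map_mxZ. Qed.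

Lemma conj_cv_coroot i : conj_cv (coroot D C i) = coroot D C i.
Proof. by apply/colP => j; rewrite !mxE rmorph_int. Qed.

(* The conjugate-linear Chevalley involution (s = true), respectively the
   conjugation of the split real form (s = false). *)
Lemma semi_chevalley (s : bool) : exists w : g -> g, [/\ semi_morphism conj w,
  forall b i, w (gen g b i) = gen g (b (+) s) i
  & forall i, w (km_h g (coroot D C i)) = (-1) ^+ s *: km_h g (coroot D C i)].
Proof.
pose h' x := (-1) ^+ s *: km_h g (conj_cv x).
have [||x i|x i|i j|i j ij|i j ij|w [sw wh we wf]] :=
    @km_semi_extend n A D C g conj g h'
    (fun i => gen g (~~ s) i) (fun i => gen g s i).
- move=> a x y; rewrite /h' conj_cv_linear km_hD km_hZ scalerDr !scalerA.
  by rewrite mulrC.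
- by move=> x y; rewrite /h' bracketZl bracketZr (km_hh (km_rel g)) !scaler0.
- rewrite /h' bracketZl bracket_h_gen cartan_eval_conj scalerA mulrA negbK.
  by rewrite -expr2 sqrr_sign mul1r.
- rewrite /h' bracketZl bracket_h_gen cartan_eval_conj scalerA mulrA.
  by congr (_ *: _); case: (s); rewrite /= ?expr0 ?expr1 ?mul1r ?mulr1 ?mulN1r.
- have := bracket_gen_opposite g (~~ s) i j; rewrite negbK => ->.
  rewrite /h' conj_cv_coroot -scaleNr scalerA.
  case: eqP => [->|_]; last by rewrite mulr0 oppr0 mul0r !scale0r.
  by congr (_ *: _); case: (s); rewrite /= ?expr0 ?expr1 ?mul1r ?mulr1 ?mulN1r ?opprK.
- by case: (s); [exact: (km_serre_f (km_rel g) ij)|exact: (km_serre_e (km_rel g) ij)].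
- by case: (s); [exact: (km_serre_e (km_rel g) ij)|exact: (km_serre_f (km_rel g) ij)].
exists w; split=> // [b i|i].
  by case: b; rewrite /gen ?we ?wf /gen; case: (s).
by rewrite wh /h' conj_cv_coroot.
Qed.

Section Semi.
Variable w : g -> g.
Hypothesis sw : semi_morphism conj w.

Lemma semi0 : w 0 = 0.
Proof.
by have := sw.1 1 0 0; rewrite scaler0 addr0 rmorph1 scale1r -{1}[w 0]addr0 => /addrI.
Qed.

Lemma semiD x y : w (x + y) = w x + w y.
Proof. by have := sw.1 1 x y; rewrite !scale1r rmorph1 scale1r. Qed.

Lemma semiZ a x : w (a *: x) = conj a *: w x.
Proof. by have := sw.1 a x 0; rewrite !addr0 semi0 addr0. Qed.

Lemma semiN x : w (- x) = - w x.
Proof. by rewrite -scaleN1r semiZ rmorphN1 scaleN1r. Qed.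

Lemma semi_sum (I : Type) (s : seq I) (P : pred I) (F : I -> g) :
  w (\sum_(i <- s | P i) F i) = \sum_(i <- s | P i) w (F i).
Proof. exact: (big_morph w semiD semi0). Qed.

Lemma semi_iter N x y : w (iter N (bracket x) y) = iter N (bracket (w x)) (w y).
Proof. by elim: N => //= N IH; rewrite sw.2 IH. Qed.

Lemma semi_exp_ad x y N : iter N (bracket x) y = 0 ->
  w (exp_ad x y) = exp_ad (w x) (w y).
Proof.
move=> HN; rewrite (exp_adE HN) (@exp_adE _ _ _ _ N); last first.
  by rewrite -semi_iter HN semi0.
rewrite semi_sum; apply: eq_bigr => j _.
by rewrite semiZ fmorphV rmorph_nat semi_iter.
Qed.

Lemma semi_der x : der x -> der (w x).
Proof.
move=> [s ->]; rewrite semi_sum; exists [seq (w p.1, w p.2) | p <- s].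
by rewrite big_map; apply: eq_bigr => p _; rewrite sw.2.
Qed.

End Semi.
End Semimorphisms.

(** * Iwasawa decomposition *)

Section SL2Matrices.
Variable F : fieldType.
Implicit Types (a b c d : F) (M N : 'M[F]_2).

Lemma ord2_cases (i : 'I_2) : (i == 0) || (i == 1).
Proof. by case: i => [[|[|]]]. Qed.

Lemma mx22_eta M : M = mx22 (M 0 0) (M 0 1) (M 1 0) (M 1 1).
Proof.
apply/matrixP => i j; rewrite mxE.
by case/orP: (ord2_cases i) => /eqP ->; case/orP: (ord2_cases j) => /eqP ->.
Qed.

Lemma mx22_mul a b c d a' b' c' d' :
  mx22 a b c d *m mx22 a' b' c' d'
  = mx22 (a * a' + b * c') (a * b' + b * d') (c * a' + d * c') (c * b' + d * d').
Proof.
apply/matrixP => i j; rewrite !mxE !big_ord_recl big_ord0 addr0 !mxE /=.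
by case/orP: (ord2_cases i) => /eqP ->; case/orP: (ord2_cases j) => /eqP ->.
Qed.

Lemma det_mx22 a b c d : \det (mx22 a b c d) = a * d - b * c.
Proof.
rewrite (expand_det_row _ 0) !big_ord_recl big_ord0 addr0 /cofactor.
rewrite !det_mx11 !mxE /= expr0 mul1r /bump /= addn0 expr1.
by rewrite mulN1r mulrN.
Qed.

Lemma SL2_mx22 a b c d : a * d - b * c = 1 -> SL2 (mx22 a b c d).
Proof. by rewrite /SL2 /= det_mx22. Qed.

Lemma SL2_det a b c d : SL2 (mx22 a b c d) -> a * d - b * c = 1.
Proof. by rewrite /SL2 /= det_mx22. Qed.

Lemma SL2_mul M N : SL2 M -> SL2 N -> SL2 (M *m N).
Proof. by rewrite /SL2 /= det_mulmx => -> ->; rewrite mulr1. Qed.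

(** A matrix with non-zero lower left entry is an upper, lower, upper product of elementary
    matrices. If that entry is 0, a column operation replaces it by the non-zero entry [d]. *)
Lemma SL2_ind (P : 'M[F]_2 -> Prop) :
  (forall r, P (mx22 1 r 0 1)) -> (forall r, P (mx22 1 0 r 1)) ->
  (forall M N, SL2 M -> SL2 N -> P M -> P N -> P (M *m N)) ->
  forall M, SL2 M -> P M.
Proof.
move=> Pu Pl Pm.
have Su (r : F) : SL2 (mx22 1 r 0 1) by apply: SL2_mx22; ring.
have Sl (r : F) : SL2 (mx22 1 0 r 1) by apply: SL2_mx22; ring.
have Pc (a b c d : F) : a * d - b * c = 1 -> c != 0 -> P (mx22 a b c d).
  move=> E c0.
  have -> : mx22 a b c d = mx22 1 ((a - 1) / c) 0 1 *m mx22 1 0 c 1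
      *m mx22 1 ((d - 1) / c) 0 1.
    have b_eq : b = (a * d - 1) / c.
      by apply: (mulIf c0); rewrite mulfVK // -E; ring.
    by rewrite !mx22_mul b_eq; congr mx22; field.
  by apply: (Pm) => //; [exact: SL2_mul|apply: (Pm)].
move=> M; rewrite (mx22_eta M); move: (M 0 0) (M 0 1) (M 1 0) (M 1 1) => a b c d.
move=> /SL2_det E; have [c0|c0] := eqVneq c 0; last exact: Pc.
rewrite c0 mulr0 subr0 in E *.
have d0 : d != 0 by apply: contra_eq_neq E => ->; rewrite mulr0 eq_sym oner_eq0.
have -> : mx22 a b 0 d = mx22 (a + b) b d d *m mx22 1 0 (-1) 1.
  by rewrite mx22_mul; congr mx22; ring.
have S : SL2 (mx22 (a + b) b d d) by apply: SL2_mx22; rewrite -E; ring.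
by apply: (Pm) => //; apply: Pc => //; rewrite -E; ring.
Qed.

End SL2Matrices.

Section Unitary.
Variables (F : fieldType) (bar : {rmorphism F -> F}).
Hypothesis barK : involutive bar.

(** The inverse of the conjugate transpose, for determinant 1, written through the adjugate; its
    fixed points in [SL2] form the compact group of the rank-one Iwasawa decomposition. *)
Definition inv_conj_tr (M : 'M[F]_2) : 'M[F]_2 :=
  mx22 (bar (M 1 1)) (- bar (M 1 0)) (- bar (M 0 1)) (bar (M 0 0)).

Lemma inv_conj_trE a b c d :
  inv_conj_tr (mx22 a b c d) = mx22 (bar d) (- bar c) (- bar b) (bar a).
Proof. by rewrite /inv_conj_tr !mxE. Qed.

Lemma inv_conj_trM M N : inv_conj_tr (M *m N) = inv_conj_tr M *m inv_conj_tr N.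
Proof.
rewrite (mx22_eta M) (mx22_eta N) mx22_mul !inv_conj_trE mx22_mul !rmorphD !rmorphM.
by congr mx22; ring.
Qed.

Lemma inv_conj_tr_SL2 M : SL2 M -> SL2 (inv_conj_tr M).
Proof.
rewrite (mx22_eta M) inv_conj_trE => /SL2_det E; apply: SL2_mx22.
by rewrite -(rmorph1 bar) -E rmorphB !rmorphM; ring.
Qed.

Lemma SL2_iwasawa : (forall a c, (a, c) != (0, 0) ->
    exists2 r, r != 0 & bar r = r /\ r * r = a * bar a + c * bar c) ->
  forall M, SL2 M -> exists N r z, [/\ SL2 N, inv_conj_tr N = N, r != 0
    & M = N *m mx22 r 0 0 r^-1 *m mx22 1 z 0 1].
Proof.
move=> sq M; rewrite (mx22_eta M); move: (M 0 0) (M 0 1) (M 1 0) (M 1 1) => a b c d.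
move=> /SL2_det E.
have [|r r0 [br rr]] := sq a c.
  apply: contra_eq_neq E => -[-> ->]; rewrite mul0r mulr0 subr0 eq_sym.
  exact: oner_neq0.
have E2 : r * r != 0 by rewrite mulf_neq0.
(* Gram--Schmidt: the unitary factor is determined by the normalized first column of [M], whose
   length is [r]; the next witness is the inner product of the two columns divided by [r * r]. *)
exists (mx22 (a / r) (- (bar c / r)) (c / r) (bar a / r)), r.
exists ((bar a * b + bar c * d) / (r * r)).
have brV : bar r^-1 = r^-1 by rewrite fmorphV br.
split=> //.
- by apply: SL2_mx22; apply: (mulIf E2); rewrite mul1r [RHS]rr; field.
- by rewrite inv_conj_trE rmorphN !rmorphM brV !barK opprK.
rewrite !mx22_mul !mulr0 !mulr1 ?mul0r ?addr0 ?add0r.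
have rr' : bar a * a + bar c * c = r * r by rewrite rr; ring.
congr mx22.
- by field.
- have : a * d = 1 + b * c by rewrite -E; ring.
  move=> ad; apply: (mulIf E2); rewrite mulrDl.
  have -> : a / r * r * ((bar a * b + bar c * d) / (r * r)) * (r * r)
     = a * (bar a * b + bar c * d) by field.
  have -> : - (bar c / r) * r^-1 * (r * r) = - bar c by field.
  rewrite rr; transitivity (a * bar a * b + bar c * (a * d) - bar c).
    by rewrite ad; ring.
  by ring.
- by field.
- have : a * d = 1 + b * c by rewrite -E; ring.
  move=> ad; apply: (mulIf E2); rewrite mulrDl.
  have -> : c / r * r * ((bar a * b + bar c * d) / (r * r)) * (r * r)
     = c * (bar a * b + bar c * d) by field.
  have -> : bar a / r * r^-1 * (r * r) = bar a by field.
  rewrite rr; transitivity (bar a * (1 + b * c) + c * bar c * d); last by ring.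
  by rewrite -ad; ring.
Qed.

End Unitary.

Section Iwasawa.
Variables (R : realType) (n : nat) (A : 'M[int]_n) (D : root_datum A).
Variables (g : kac_moody_algebra D R[i]) (G : tits_functor g).
Hypothesis hcartan : generalized_cartan A.
Variable Ad : G R[i] -> g -> g.
Hypothesis HAd : is_adjoint Ad.
(** [K] is to be either the reals or the complex numbers. The descent hypothesis lists the two
    situations: [j] is onto, or [bar] is trivial and [K] is the fixed field of conjugation. *)
Variables (K : numFieldType) (j : {rmorphism K -> R[i]}).
Variable bar : {rmorphism K -> K}.
Hypothesis barK : involutive bar.
Local Notation C := R[i].
Local Notation m := (lattice_rank A).
Local Notation conj := (@conjc R : {rmorphism C -> C}).
Local Notation der := (@derived_algebra C g).
Local Notation hh i := (km_h g (coroot D C i)).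
Local Notation ht := (@height n).
Hypothesis j_bar : forall z, conj (j z) = j (bar z).
Hypothesis j_descent : (forall z, exists r, j r = z) \/
  ((forall r, bar r = r) /\ forall z, conj z = z -> exists r, j r = z).
Hypothesis bar_sqrt : forall a c : K, (a, c) != (0, 0) ->
  exists2 r, r != 0 & bar r = r /\ r * r = a * bar a + c * bar c.

Definition act (u : G K) (x : g) : g := Ad (gf_map G j u) x.

Lemma act_endo u : derived_endo (act u).
Proof.
split; [exact: (ad_stable HAd)|exact: (ad_linear HAd)|exact: (ad_bracket HAd)].
Qed.

Lemma gf_map1 (S S' : comUnitRingType) (f : {rmorphism S -> S'}) :
  gf_map G f 1%g = 1%g.
Proof. by apply: (@mulgI _ (gf_map G f 1%g)); rewrite -gf_mapM !mulg1. Qed.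

Lemma act1 x : der x -> act 1%g x = x.
Proof. by move=> dx; rewrite /act gf_map1 (ad_one HAd). Qed.

Lemma actM u v x : der x -> act (u * v)%g x = act u (act v x).
Proof. by move=> dx; rewrite /act gf_mapM (ad_mul HAd). Qed.

Lemma actK u x : der x -> act u^-1%g (act u x) = x.
Proof. by move=> dx; rewrite -actM // mulVg act1. Qed.

Lemma actKV u x : der x -> act u (act u^-1%g x) = x.
Proof. by move=> dx; rewrite -actM // mulgV act1. Qed.

Lemma act_der u x : der x -> der (act u x).
Proof. exact: (ad_stable HAd). Qed.

Definition x_gen (F : comUnitRingType) (b : bool) (i : 'I_n) (r : F) : G F :=
  if b then x_pos G i r else x_neg G i r.

Lemma map_mx22 (S S' : comUnitRingType) (f : {rmorphism S -> S'}) (a b c d : S) :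
  map_mx f (mx22 a b c d) = mx22 (f a) (f b) (f c) (f d).
Proof. by apply/matrixP => k l; rewrite !mxE; do 2 case: ifP. Qed.

Lemma SL2_upper (F : comUnitRingType) (r : F) : SL2 (mx22 1 r 0 1).
Proof.
rewrite /SL2 /= (expand_det_row _ 0) !big_ord_recl big_ord0 addr0 /cofactor.
by rewrite !det_mx11 !mxE /= expr0 mul1r /bump /= mulr0 mulr0 addr0 mul1r.
Qed.

Lemma SL2_lower (F : comUnitRingType) (r : F) : SL2 (mx22 1 0 r 1).
Proof.
rewrite /SL2 /= (expand_det_row _ 0) !big_ord_recl big_ord0 addr0 /cofactor.
by rewrite !det_mx11 !mxE /= expr0 mul1r /bump /= mul0r addr0 mul1r.
Qed.

Lemma gf_map_x (S S' : comUnitRingType) (f : {rmorphism S -> S'}) b i (r : S) :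
  gf_map G f (x_gen b i r) = x_gen b i (f r).
Proof.
case: b; rewrite /x_gen /x_pos /x_neg td_phi_natural ?map_mx22 ?rmorph1 ?rmorph0 ?rmorphN //.
  exact: SL2_upper.
exact: SL2_lower.
Qed.

Lemma act_x b i r x : der x -> act (x_gen b i r) x = exp_ad (j r *: gen g b i) x.
Proof.
move=> dx; rewrite /act gf_map_x /x_gen /x_pos /x_neg.
case: b; first exact: (ad_upper HAd).
by rewrite (ad_lower HAd) // opprK.
Qed.

Lemma torus_map (S S' : comUnitRingType) (f : {rmorphism S -> S'}) (t : 'rV[S]_m) :
  torus t -> torus (map_mx f t).
Proof. by move=> Ht l; rewrite mxE rmorph_unit. Qed.

Lemma act_torus t b i : torus t ->
  act (td_eta G t) (gen g b i)
  = torus_eval (map_mx j t) ((-1) ^+ (~~ b) *: rd_c D i) *: gen g b i.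
Proof.
move=> Ht; rewrite /act td_eta_natural //; have Ht' := torus_map j Ht.
case: b; rewrite /gen /= ?expr0 ?scale1r ?expr1 ?scaleN1r.
  exact: (ad_torus_e HAd).
exact: (ad_torus_f HAd).
Qed.

Lemma torus_eval_neq0 (F : fieldType) (t : 'rV[F]_m) lam : torus t -> torus_eval t lam != 0.
Proof.
move=> Ht; apply/prodf_neq0 => l _; apply: expfz_neq0.
by rewrite -unitfE; exact: Ht.
Qed.

(** The inverse is included because inverting a raising map directly would call for an infinite
    geometric series. *)
Definition unipotent (d : 'I_n -> int) (u : G K) : Prop :=
  raising d (act u) /\ raising d (act u^-1%g).

Definition parabolic (d : 'I_n -> int) (u : G K) : Prop :=
  nonlowering d (act u) /\ nonlowering d (act u^-1%g).

Lemma raising_actM d u v : raising d (act u) -> raising d (act v) ->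
  raising d (act (u * v)%g).
Proof.
move=> Hu Hv l x dx gx; have dv := act_der v dx.
have gv := raising_nonlowering Hv dx gx.
rewrite actM // -(subrK (act v x) (act u _)) -addrA.
by apply: (lincD (gr_lin_closed _ _ _)); [exact: Hu|exact: Hv].
Qed.

Lemma unipotent1 d : unipotent d 1%g.
Proof.
have H : raising d (act 1%g).
  by move=> l x dx gx; rewrite act1 // subrr; exact: linc0 (gr_lin_closed _ _ _).
by split; rewrite ?invg1.
Qed.

Lemma unipotentM d u v : unipotent d u -> unipotent d v -> unipotent d (u * v)%g.
Proof.
move=> [u1 u2] [v1 v2]; split; first exact: raising_actM.
by rewrite invgM; exact: raising_actM.
Qed.

Lemma unipotentV d u : unipotent d u -> unipotent d u^-1%g.
Proof. by move=> [u1 u2]; split; rewrite ?invgK. Qed.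

Lemma parabolicM d u v : parabolic d u -> parabolic d v -> parabolic d (u * v)%g.
Proof.
move=> [u1 u2] [v1 v2]; split=> l x dx gx; rewrite ?invgM actM //.
  by apply: u1; [exact: act_der|exact: v1].
by apply: v2; [exact: act_der|exact: u2].
Qed.

Lemma parabolicV d u : parabolic d u -> parabolic d u^-1%g.
Proof. by move=> [u1 u2]; split; rewrite ?invgK. Qed.

(** Preserving the filtration suffices: [p v p^-1 x - x] is [p] applied to the excess of [v] at
    [p^-1 x]. *)
Lemma unipotent_conj d p u : parabolic d p -> unipotent d u ->
  unipotent d (p * u * p^-1)%g.
Proof.
move=> [p1 p2] [u1 u2].
have conj_raising v : raising d (act v) -> raising d (act (p * v * p^-1)%g).
  move=> Hv l x dx gx.
  have dpx := act_der p^-1%g dx; have gpx := p2 l x dx gx.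
  have -> : act (p * v * p^-1)%g x - x
      = act p (act v (act p^-1%g x) - act p^-1%g x).
    rewrite actM // actM //.
    have := de_linear (act_endo p) (-1) dpx (act_der v dpx).
    by rewrite !scaleN1r actKV // [- x + _]addrC [- _ + _]addrC => ->.
  apply: p1; last exact: Hv.
  by apply: (lincB (derived_lin_closed g)) => //; exact: act_der.
split; first exact: conj_raising.
by rewrite !invgM invgK mulgA; exact: conj_raising.
Qed.

Lemma tits_relK : tits_relations g (x_pos G (F := K)) (x_neg G (F := K))
  (fun t => td_eta G t).
Proof. exact: (tf_nondegenerate G K).1. Qed.

Lemma x_genD b i (r s : K) : x_gen b i (r + s) = (x_gen b i r * x_gen b i s)%g.
Proof. by case: b; [exact: (tits_xD tits_relK)|exact: (tits_yD tits_relK)]. Qed.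

Lemma x_gen0 b i : x_gen b i (0 : K) = 1%g.
Proof. by apply: (@mulgI _ (x_gen (F := K) b i 0)); rewrite -x_genD !addr0 mulg1. Qed.

Lemma x_genN b i (r : K) : x_gen b i (- r) = (x_gen b i r)^-1%g.
Proof. by apply: (@mulgI _ (x_gen b i r)); rewrite -x_genD subrr x_gen0 mulgV. Qed.

Lemma phi_upper i (r : K) : td_phi G i (mx22 1 r 0 1) = x_gen true i r.
Proof. by []. Qed.

Lemma phi_lower i (r : K) : td_phi G i (mx22 1 0 r 1) = x_gen false i (- r).
Proof. by rewrite /x_gen /x_neg opprK. Qed.

Lemma eta_conj_x b i (t : 'rV[K]_m) (r : K) : torus t ->
  exists s : K, (td_eta G t * x_gen b i r)%g = (x_gen b i s * td_eta G t)%g.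
Proof.
move=> Ht; case: b.
  exists (torus_eval t (rd_c D i) * r).
  by rewrite /x_gen -(tits_tx tits_relK) // mulgVK.
exists (torus_eval t (- rd_c D i) * r).
by rewrite /x_gen -(tits_ty tits_relK) // mulgVK.
Qed.

Lemma x_raising_height i r : raising ht (act (x_gen true i r)).
Proof.
apply: raise_gen => //; first exact: act_endo.
move=> b i'; rewrite act_x; last exact: derived_gen.
apply: exp_ad_gr => p p0; by rewrite /height expr0 !mulr1 addrC lerD2r ler1n.
Qed.

Lemma x_unipotent_height i r : unipotent ht (x_gen true i r).
Proof. by split; rewrite -?x_genN; exact: x_raising_height. Qed.

Lemma x_nonlowering i b r : nonlowering (coheight i) (act (x_gen b i r)).
Proof.
apply: nonlowering_gen => //; first exact: act_endo.
move=> b' i'; rewrite act_x; last exact: derived_gen.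
rewrite -(subrK (gen g b' i') (exp_ad _ _)); apply: (lincD (gr_lin_closed _ _ _)).
  by apply: exp_ad_gr => p p0; rewrite coheight_id mulr0 mul0rn add0r.
by apply: gr_gen; rewrite /ge.
Qed.

(** Both [e_i] and [f_i] have coheight 0, so their exponentials add only terms of the same
    coheight. *)
Lemma phi_parabolic i M : SL2 M -> parabolic (coheight i) (td_phi G i M).
Proof.
have Hx b r : parabolic (coheight i) (x_gen b i r).
  by split; rewrite -?x_genN; exact: x_nonlowering.
move: M; apply: SL2_ind => [r|r|M N SM SN HM HN].
- by rewrite phi_upper.
- by rewrite phi_lower.
by rewrite td_phiM //; exact: parabolicM.
Qed.

Lemma unipotent_height_parabolic i u : unipotent ht u -> parabolic (coheight i) u.
Proof.
by move=> [u1 u2]; split; apply: raising_height_nonlowering => //; exact: act_endo.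
Qed.

Lemma unipotent_coheight_height i u : unipotent (coheight i) u -> unipotent ht u.
Proof.
move=> [u1 u2]; split.
  exact: (raising_coheight_height hcartan (act_endo u) u1).
exact: (raising_coheight_height hcartan (act_endo u^-1%g) u2).
Qed.

Lemma torus_evalN (F : fieldType) (t : 'rV[F]_m) lam : torus t ->
  torus_eval t (- lam) = (torus_eval t lam)^-1.
Proof.
move=> Ht; rewrite /torus_eval -prodfV; apply: eq_bigr => l _.
by rewrite mxE invr_expz.
Qed.

Lemma torus_eval_map (S S' : fieldType) (f : {rmorphism S -> S'}) (t : 'rV[S]_m) lam :
  torus_eval (map_mx f t) lam = f (torus_eval t lam).
Proof.
rewrite /torus_eval rmorph_prod; apply: eq_bigr => l _.
by rewrite mxE fmorphXz.
Qed.

(* [bar] on the group side, complex conjugation on the Lie algebra side; s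
   tells whether the two maps exchange positive and negative root vectors. *)
Section Equivariance.
Variables (s : bool) (w : g -> g) (T : G K -> G K).
Hypothesis sw : semi_morphism conj w.
Hypothesis w_gen : forall b i, w (gen g b i) = gen g (b (+) s) i.
Hypothesis TM : forall u v, T (u * v)%g = (T u * T v)%g.
Hypothesis T_x : forall b i r, T (x_gen b i r) = x_gen (b (+) s) i (bar r).
Hypothesis T_eta : forall t, torus t -> exists2 t', torus t' &
  T (td_eta G t) = td_eta G t' /\
  forall i, torus_eval t' ((-1) ^+ s *: rd_c D i) = bar (torus_eval t (rd_c D i)).

Definition equivariant (u : G K) : Prop :=
  forall x, der x -> act (T u) (w x) = w (act u x).

Lemma equivariant_gen u :
  (forall b i, act (T u) (w (gen g b i)) = w (act u (gen g b i))) -> equivariant u.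
Proof.
move=> H; have e1 := act_endo u; have e2 := act_endo (T u).
apply: derived_ind => //.
- move=> a x y dx dy Hx Hy.
  rewrite sw.1 (de_linear e2) ?Hx ?Hy; try exact: (semi_der sw).
  by rewrite (de_linear e1) // sw.1.
- move=> x y dx dy Hx Hy.
  rewrite sw.2 (de_bracket e2) ?Hx ?Hy; try exact: (semi_der sw).
  by rewrite (de_bracket e1) // sw.2.
- by rewrite (endo0 e1) !(semi0 sw) (endo0 e2).
Qed.

Lemma equivariant_x b i r : equivariant (x_gen b i r).
Proof.
apply: equivariant_gen => b' i'; rewrite T_x w_gen.
rewrite !act_x; try exact: derived_gen.
have [N HN] := gen_nilpotent g b i b' i'.
rewrite (semi_exp_ad sw (N := N)); last by rewrite iter_bracketZ HN scaler0.
by rewrite (semiZ sw) !w_gen j_bar.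
Qed.

Lemma equivariantM u v : equivariant u -> equivariant v -> equivariant (u * v)%g.
Proof.
move=> Hu Hv x dx; rewrite TM actM; last exact: (semi_der sw).
by rewrite Hv // Hu ?actM //; exact: act_der.
Qed.

Lemma equivariantV u : equivariant u -> equivariant u^-1%g.
Proof.
have T1 : T 1%g = 1%g by apply: (@mulgI _ (T 1%g)); rewrite -TM !mulg1.
have TV : T u^-1%g = (T u)^-1%g by apply: (@mulgI _ (T u)); rewrite -TM !mulgV T1.
move=> Hu x dx; have dy := act_der u^-1%g dx.
by rewrite TV -{1}(actKV u dx) -Hu // actK //; exact: (semi_der sw).
Qed.

Lemma equivariant_eta t : torus t -> equivariant (td_eta G t).
Proof.
move=> Ht; apply: equivariant_gen => b i; have [t' Ht' [-> Et]] := T_eta Ht.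
have Hj := torus_map j Ht'; have Hjt := torus_map j Ht.
rewrite w_gen !act_torus // (semiZ sw) w_gen; congr (_ *: _).
have E : torus_eval (map_mx j t') ((-1) ^+ s *: rd_c D i)
    = conj (torus_eval (map_mx j t) (rd_c D i)).
  by rewrite !torus_eval_map Et j_bar.
have Es : torus_eval (map_mx j t') ((-1) ^+ (~~ s) *: rd_c D i)
    = conj (torus_eval (map_mx j t) (- rd_c D i)).
  rewrite torus_evalN // fmorphV -E -torus_evalN // -scaleNr.
  by case: (s); rewrite ?opprK.
by case: b; rewrite /= ?addbT ?addbF ?addFb ?addTb ?negbK ?expr0 ?expr1 ?scale1r ?scaleN1r.
Qed.

(** Both sides are multiplicative in [u], so the root groups and the torus decide. *)
Lemma equivariant_all u : equivariant u.
Proof.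
have eqv1 : equivariant 1%g.
  by rewrite -(mulgV (td_eta G (const_mx 1 : 'rV[K]_m))); apply: equivariantM;
    [|apply: equivariantV]; apply: equivariant_eta => l; rewrite mxE unitr1.
apply: (tf_generated (F := K) u).
  by split=> // x y Hx Hy; apply: equivariantM => //; exact: equivariantV.
move=> x [[i [M [SM ->]]]|[t Ht ->]]; last exact: equivariant_eta.
move: M SM; apply: SL2_ind => [r|r|M N SM SN HM HN].
- by rewrite phi_upper; exact: equivariant_x.
- by rewrite phi_lower; exact: equivariant_x.
by rewrite td_phiM //; exact: equivariantM.
Qed.

End Equivariance.

Lemma semi_gr (s : bool) (w : g -> g) d P x : semi_morphism conj w ->
  (forall b i, w (gen g b i) = gen g (b (+) s) i) ->
  (forall i, w (hh i) = (-1) ^+ s *: hh i) -> der x -> gr d P x ->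
  gr d (fun l => P ((-1) ^+ s * l)) (w x).
Proof.
move=> sw w_gen w_h dx /(gr_span dx); move: {dx} x.
have gl := gr_lin_closed g d (fun l => P ((-1) ^+ s * l)).
have w_word b q i : w (word_val g b q i) = word_val g (b (+) s) q i.
  by elim: q => [|l q IH] /=; rewrite ?w_gen // sw.2 w_gen IH.
apply: span_ind.
  split=> [|a x y Hx Hy]; first by rewrite (semi0 sw); exact: (linc0 gl).
  by rewrite sw.1; exact: gl.2.
move=> x [[i|[[b q] i]] /= Pz ->].
  by rewrite w_h; apply: (lincZ gl); apply: gr_coroot; rewrite mulr0.
rewrite w_word; apply: (@gr_monomial _ _ _ _ g d _ (inr (b (+) s, q, i))) => /=.
rewrite mulrA; congr (P (_ * _)): Pz.
by case: b (s) => [] [].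
Qed.

(** The parameter found over the complex numbers must come from [K]. In the real case the action of
    [u] commutes with the conjugation of the split form, so [(conj r - r) e_i] lies both in coheight
    0 and in coheight at least 1. The conclusion is about multiples of [e_i] so as to allow for
    [e_i = 0]. *)
Lemma factor_parameter_descent i u r : unipotent ht u ->
  gr (coheight i) (ge 1) (act u (hh i) - hh i - (2 * r) *: gen g true i) ->
  exists r0, j r0 *: gen g true i = r *: gen g true i.
Proof.
move=> [Hu _] Hr.
case: j_descent => [jsur|[bar_id jreal]]; first by have [r0 <-] := jsur r; exists r0.
have [w [sw w_gen w_h]] := semi_chevalley g false.
have T_x b i' q : x_gen b i' q = x_gen (b (+) false) i' (bar q).
  by rewrite addbF bar_id.
have T_eta t : torus t -> exists2 t', torus t' &
    td_eta G t = td_eta G t' /\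
    forall i', torus_eval t' ((-1) ^+ false *: rd_c D i') = bar (torus_eval t (rd_c D i')).
  by move=> Ht; exists t => //; split=> // i'; rewrite bar_id scale1r.
have eqv := @equivariant_all false w id sw w_gen (fun _ _ => erefl) T_x T_eta u.
have dh := der_coroot g hcartan i.
have E := eqv _ dh; rewrite w_h scale1r in E.
set z := act u (hh i) - hh i - _ in Hr.
have dz : der z.
  apply: (lincB (derived_lin_closed g)); first exact: (der_diff (act_endo u)).
  by apply: (lincZ (derived_lin_closed g)); exact: derived_gen.
have Ez : act u (hh i) = hh i + (2 * r) *: gen g true i + z.
  have -> : z = act u (hh i) - (hh i + (2 * r) *: gen g true i) by rewrite opprD addrA.
  by rewrite addrC subrK.
clearbody z; have Hwz := semi_gr sw w_gen w_h dz Hr.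
have Z : (conj r - r) *: gen g true i = 0.
  have two0 : 2 != 0 :> C by rewrite pnatr_eq0.
  apply: (scalerI two0); rewrite scaler0 scalerA.
  apply: (@gr_disjoint _ _ _ _ g (coheight i) (deg_eq 0) (ge 1)) => [||l -> //].
    apply: (lincZ (gr_lin_closed _ _ _)); apply: gr_gen.
    by rewrite coheight_id mulr0.
  have -> : (2 * (conj r - r)) *: gen g true i = z - w z.
    rewrite Ez !(semiD sw) (semiZ sw) w_h w_gen scale1r addbF -!addrA in E.
    move/addrI/add_eq_sub: E => /(congr1 -%R); rewrite !opprB => <-.
    by rewrite rmorphM rmorph_nat -scalerBl mulrBr.
  apply: (lincB (gr_lin_closed _ _ _)) => //.
  by apply: gr_sub Hwz => l; rewrite mul1r.
move/eqP: Z; rewrite scaler_eq0 subr_eq0 => /orP[/eqP /jreal[r0 <-]|/eqP ->].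
  by exists r0.
by exists 0; rewrite !scaler0.
Qed.

(** The analogue of the decomposition of [U_+] into the root group of a simple root and the radical
    of its minimal parabolic, obtained from two relations of the Lie algebra instead of the
    structure of root groups. *)
Lemma factor_unipotent i u : unipotent ht u ->
  exists s, unipotent (coheight i) (x_gen true i s * u)%g.
Proof.
move=> Hu; have eu := act_endo u.
have [r [Hf Hh]] := factor_parameter hcartan i eu Hu.1.
have [s Es] := factor_parameter_descent Hu Hh.
exists s; set v := (_ * u)%g.
have Hv : unipotent ht v by apply: unipotentM => //; exact: x_unipotent_height.
have df := derived_gen g hcartan false i; have dh := der_coroot g hcartan i.
have Esh : j s *: hh i = r *: hh i.
  by rewrite coroot_bracket !scalerN -!bracketZl -/(gen g true i) Es.
have vf : gr ht (ge 1) (act v (gen g false i) - gen g false i).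
  set z := act u _ - _ - _ in Hf.
  have dz : der z.
    apply: (lincB (derived_lin_closed g)); first exact: (der_diff eu).
    exact: (lincZ (derived_lin_closed g)).
  have Ez : act u (gen g false i) = r *: hh i + (1 *: gen g false i + z).
    rewrite scale1r addrA.
    have -> : z = act u (gen g false i) - (r *: hh i + gen g false i).
      by rewrite /z opprD addrA addrAC.
    by rewrite addrC subrK.
  clearbody z; have dr : der (1 *: gen g false i + z) by exact: (derived_lin_closed g).2.
  have ex := act_endo (x_gen true i s).
  rewrite /v actM // Ez (de_linear ex) // (de_linear ex) // scale1r.
  have H1 := exp_ad_ef g (j s) i; rewrite -act_x // in H1.
  have H2 : gr ht (ge 1) (act (x_gen true i s) (hh i) - hh i).
    rewrite -[1]add0r; apply: (x_raising_height i s) => //.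
    by apply: gr_coroot; rewrite /ge.
  have H3 := raising_nonlowering (x_raising_height i s) dz Hf.
  have gl := gr_lin_closed g ht (ge 1).
  have := lincD gl (lincD gl (lincZ gl r H2) H1) H3.
  rewrite Esh scalerBr [in X in X -> _]addrA [X in X + act _ z]addrAC subrK.
  by rewrite -addrA [_ - _ + act _ z]addrAC addrA.
split.
  exact: (raising_height_coheight hcartan (act_endo v) Hv.1 vf).
have [_ pv] := unipotent_height_parabolic i Hv.
have rv := raising_height_coheight hcartan (act_endo v) Hv.1 vf.
move=> l x dx gx.
(* The inverse is handled without a series: it preserves the coheight filtration, and its excess is
   minus its image of the excess of [v]. *)
have -> : act v^-1%g x - x = - act v^-1%g (act v x - x).
  have := de_linear (act_endo v^-1%g) (-1) dx (act_der v dx).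
  by rewrite actK // !scaleN1r [- x + _]addrC => ->; rewrite opprD opprK.
apply: (lincN (gr_lin_closed _ _ _)); apply: pv; last exact: rv.
exact: (der_diff (act_endo v)).
Qed.

Lemma torus_mul_torus (F : comUnitRingType) (s t : 'rV[F]_m) :
  torus s -> torus t -> torus (torus_mul s t).
Proof. by move=> Hs Ht l; rewrite mxE unitrM Hs Ht. Qed.

Lemma torus_pow_torus (r : K) v : r != 0 -> torus (torus_pow r v : 'rV[K]_m).
Proof. by move=> r0 l; rewrite mxE unitfE expfz_neq0. Qed.

Section Involution.
Variable Th : G K -> G K.
Hypothesis ThM : forall u v, Th (u * v)%g = (Th u * Th v)%g.
Hypothesis Th_pos : forall i r, Th (x_pos G i r) = x_neg G i (bar r).
Hypothesis Th_neg : forall i r, Th (x_neg G i r) = x_pos G i (bar r).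
Hypothesis Th_basis : forall l (r : K), r != 0 ->
  Th (td_eta G (torus_pow r (rd_v D l))) = td_eta G (torus_pow (bar r) (- rd_v D l)).

Lemma eta1 : td_eta G (const_mx 1 : 'rV[K]_m) = 1%g.
Proof.
have T1 : torus (const_mx 1 : 'rV[K]_m) by move=> l; rewrite mxE unitr1.
apply: (@mulgI _ (td_eta G (const_mx 1))); rewrite -td_etaM // mulg1.
by congr td_eta; apply/rowP => l; rewrite !mxE mulr1.
Qed.

Lemma Th1 : Th 1%g = 1%g.
Proof. by apply: (@mulgI _ (Th 1%g)); rewrite -ThM !mulg1. Qed.

Definition torus_prod (r : 'I_m -> K) (v : 'I_m -> 'cV[int]_m) (s : seq 'I_m) :
  'rV[K]_m := \row_q \prod_(l <- s) r l ^ v l q 0.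

Lemma torus_prod_torus r v s : (forall l, r l != 0) -> torus (torus_prod r v s).
Proof.
by move=> r0 q; rewrite mxE unitfE prodf_seq_neq0; apply/allP => l _; rewrite expfz_neq0.
Qed.

Lemma eta_torus_prod r v l s : (forall l, r l != 0) ->
  td_eta G (torus_prod r v (l :: s))
  = (td_eta G (torus_pow (r l) (v l)) * td_eta G (torus_prod r v s))%g.
Proof.
move=> r0; rewrite -td_etaM; [|exact: torus_pow_torus|exact: torus_prod_torus].
by congr td_eta; apply/rowP => q; rewrite !mxE big_cons.
Qed.

Lemma Th_basis_prod r s : (forall l, r l != 0) ->
  Th (td_eta G (torus_prod r (rd_v D) s))
  = td_eta G (torus_prod (fun l => bar (r l)) (fun l => - rd_v D l) s).
Proof.
move=> r0; elim: s => [|l s IH].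
  have E1 r' v : torus_prod r' v [::] = const_mx 1.
    by apply/rowP => q; rewrite !mxE big_nil.
  by rewrite !E1 eta1 Th1.
rewrite !eta_torus_prod //; last by move=> q; rewrite fmorph_eq0.
by rewrite ThM IH Th_basis.
Qed.

Definition inv_conj_torus (t : 'rV[K]_m) : 'rV[K]_m := \row_q (bar (t 0 q))^-1.

Lemma inv_conj_torus_torus t : torus t -> torus (inv_conj_torus t).
Proof. by move=> Ht l; rewrite mxE unitrV rmorph_unit. Qed.

(** The involution is prescribed on the one-parameter elements of the basis [rd_v] only; the inverse
    of the basis matrix, used as exponents, writes every torus element as a product of those. *)
Lemma Th_eta t : torus t -> Th (td_eta G t) = td_eta G (inv_conj_torus t).
Proof.
move=> Ht; have t0 q : t 0 q != 0 by rewrite -unitfE; exact: Ht.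
pose V : 'M[int]_m := \matrix_(i, l) rd_v D l i 0.
pose r (l : 'I_m) : K := \prod_q t 0 q ^ invmx V l q.
have r0 l : r l != 0 by apply/prodf_neq0 => q _; rewrite expfz_neq0.
have prod_expz (I : finType) (x : K) (a : I -> int) : x != 0 ->
    \prod_i x ^ a i = x ^ (\sum_i a i).
  by move=> x0; rewrite (big_morph (exprz x) (fun a b => expfzDr a b x0) (expr0z x)).
have expz_prod (I : finType) (x : I -> K) (a : int) :
    (\prod_i x i) ^ a = \prod_i x i ^ a.
  exact: (big_morph (fun x => x ^ a) (fun x y => expfzMl x y a) (exp1rz _ a)).
have rE q : \prod_l r l ^ rd_v D l q 0 = t 0 q.
  transitivity (\prod_l \prod_p t 0 p ^ (V q l * invmx V l p)).
    apply: eq_bigr => l _; rewrite expz_prod; apply: eq_bigr => p _.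
    by rewrite exprz_exp mulrC [V q l]mxE.
  rewrite exchange_big /=.
  transitivity (\prod_p t 0 p ^ (V *m invmx V) q p).
    by apply: eq_bigr => p _; rewrite prod_expz // [(_ *m _) _ _]mxE.
  rewrite mulmxV ?(rd_v_basis D) // (bigD1 q) //= mxE eqxx expr1z big1 ?mulr1 //.
  by move=> l; rewrite eq_sym mxE => /negPf ->; rewrite expr0z.
have tE : t = torus_prod r (rd_v D) (index_enum 'I_m).
  by apply/rowP => q; rewrite mxE rE.
rewrite [in LHS]tE Th_basis_prod //; congr td_eta; apply/rowP => q; rewrite !mxE.
rewrite -[t 0 q]rE rmorph_prod -prodfV; apply: eq_bigr => l _.
by rewrite mxE fmorphXz invr_expz.
Qed.

Lemma Th_x b i r : Th (x_gen b i r) = x_gen (b (+) true) i (bar r).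
Proof. by rewrite addbT; case: b; [exact: Th_pos|exact: Th_neg]. Qed.

Lemma Th_equivariant_eta t : torus t -> exists2 t', torus t' &
  Th (td_eta G t) = td_eta G t' /\
  forall i, torus_eval t' ((-1) ^+ true *: rd_c D i) = bar (torus_eval t (rd_c D i)).
Proof.
move=> Ht; exists (inv_conj_torus t); first exact: inv_conj_torus_torus.
split=> [|i]; first exact: Th_eta.
rewrite expr1 scaleN1r /torus_eval rmorph_prod; apply: eq_bigr => l _.
by rewrite !mxE fmorphXz -exprz_inv invrK.
Qed.

Lemma Th_phi i M : SL2 M -> Th (td_phi G i M) = td_phi G i (inv_conj_tr bar M).
Proof.
move: M; apply: SL2_ind => [r|r|M N SM SN HM HN].
- by rewrite inv_conj_trE rmorph1 rmorph0 oppr0 phi_upper Th_x.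
- rewrite inv_conj_trE rmorph1 rmorph0 oppr0 phi_lower Th_x phi_upper.
  by rewrite rmorphN.
rewrite td_phiM // ThM HM HN inv_conj_trM td_phiM //; exact: inv_conj_tr_SL2.
Qed.

(** The set of decomposable elements contains 1 and is stable under right multiplication by
    generators. Only a negative root element needs work; there the problem is moved into the
    rank-one subgroup of [i]. *)
Lemma iwasawa h : exists kappa u t, [/\ Th kappa = kappa, unipotent ht u, torus t
  & h = (kappa * u * td_eta G t)%g].
Proof.
pose IW h := exists kappa u t, [/\ Th kappa = kappa, unipotent ht u, torus t
  & h = (kappa * u * td_eta G t)%g].
have T1 : torus (const_mx 1 : 'rV[K]_m) by move=> l; rewrite mxE unitr1.
have IW1 : IW 1%g.
  exists 1%g, 1%g, (const_mx 1); split; rewrite ?Th1 ?eta1 ?mulg1 //.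
  exact: unipotent1.
have IW_eta h' t : torus t -> IW h' -> IW (h' * td_eta G t)%g.
  move=> Ht [kap [u [t' [Hk Hu Ht' ->]]]]; exists kap, u, (torus_mul t' t).
  by split=> //; [exact: torus_mul_torus|rewrite -mulgA -td_etaM].
have IW_pos h' i r : IW h' -> IW (h' * x_gen true i r)%g.
  move=> [kap [u [t' [Hk Hu Ht' ->]]]]; have [s Es] := eta_conj_x true i r Ht'.
  exists kap, (u * x_gen true i s)%g, t'; split=> //.
    by apply: unipotentM => //; exact: x_unipotent_height.
  by rewrite -mulgA Es !mulgA.
have IW_neg h' i r : IW h' -> IW (h' * x_gen false i r)%g.
  move=> [kap [u [t' [Hk Hu Ht' ->]]]]; have [s Es] := eta_conj_x false i r Ht'.
  (* Applied to the inverse so that the root-group factor of [u] comes last, next to the negative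
     root element with which it forms a matrix of [SL2]. *)
  have [q Hq] := factor_unipotent i (unipotentV Hu).
  pose v := ((x_gen true i q * u^-1)^-1)%g.
  have Hv : unipotent (coheight i) v by exact: unipotentV.
  have Eu : u = (v * x_gen true i q)%g by rewrite /v invgM invgK mulgVK.
  have Sl : SL2 (mx22 1 0 (- s) 1) by exact: SL2_lower.
  have Su : SL2 (mx22 1 q 0 1) by exact: SL2_upper.
  have [N [rho [z [SN fixN rho0 E]]]] := SL2_iwasawa barK bar_sqrt (SL2_mul Su Sl).
  have Sd : SL2 (mx22 rho 0 0 rho^-1).
    by apply: SL2_mx22; rewrite mulr0 subr0 mulfV.
  have Sz : SL2 (mx22 1 z 0 1) by exact: SL2_upper.
  have Ex : (x_gen true i q * x_gen false i s)%g = (td_phi G i N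
      * td_eta G (torus_pow rho (rd_h D i)) * x_gen true i z)%g.
    transitivity (td_phi G i (mx22 1 q 0 1 *m mx22 1 0 (- s) 1)).
      by rewrite td_phiM // phi_lower opprK.
    have SNd := SL2_mul SN Sd.
    by rewrite E td_phiM // td_phiM // tf_phi_diag // unitfE.
  set p := td_phi G i N in Ex.
  (* The matrix factor [p] normalizes the radical, so it can be moved to the left of [v]; being
     fixed by [Th], it is absorbed by [kappa]. *)
  pose v' := (p^-1 * v * p)%g.
  have Hv' : unipotent ht v'.
    apply: (@unipotent_coheight_height i); rewrite /v' -{2}[p]invgK.
    by apply: unipotent_conj => //; apply: parabolicV; exact: phi_parabolic.
  have -> : (kap * u * td_eta G t' * x_gen false i r)%g
      = (kap * p * v' * td_eta G (torus_pow rho (rd_h D i)) * x_gen true i z * td_eta G t')%g.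
    rewrite -mulgA Es Eu /v' !mulgA mulgK; congr (_ * _)%g.
    by rewrite -!mulgA Ex !mulgA.
  apply: (IW_eta _ _ Ht'); apply: IW_pos; exists (kap * p)%g, v', (torus_pow rho (rd_h D i)).
  split=> //; first by rewrite ThM Hk /p Th_phi // fixN.
  exact: torus_pow_torus.
(* [IW] is not visibly a subgroup; the elements whose right multiplications, in both directions,
   preserve it are. *)
pose S x := (forall h, IW h -> IW (h * x)%g) /\ (forall h, IW h -> IW (h * x^-1)%g).
have SM x y : S x -> S y -> S (x * y)%g.
  move=> [x1 x2] [y1 y2]; split=> h' Hh; first by rewrite mulgA; apply: y1; exact: x1.
  by rewrite invgM mulgA; apply: x2; exact: y2.
have Sx b i r : S (x_gen b i r).
  have H r' h' : IW h' -> IW (h' * x_gen b i r')%g.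
    by case: b; [exact: IW_pos|exact: IW_neg].
  by split; rewrite -?x_genN; exact: H.
have : S h.
  apply: (tf_generated (F := K) h).
    split; first by split=> h' Hh; rewrite ?invg1 mulg1.
    move=> x y Hx [y1 y2]; apply: SM => //; split=> //.
    by rewrite invgK.
  move=> x [[i [M [SLM ->]]]|[t Ht ->]].
    move: M SLM; apply: SL2_ind => [r|r|M N SM' SN HM HN].
    - by rewrite phi_upper; exact: Sx.
    - by rewrite phi_lower; exact: Sx.
    by rewrite td_phiM //; exact: SM.
  split=> h' Hh; first exact: IW_eta.
  have Ht' : torus (\row_q (t 0 q)^-1) by move=> q; rewrite mxE unitrV.
  have <- : td_eta G (\row_q (t 0 q)^-1) = (td_eta G t)^-1%g.
    apply: (@mulgI _ (td_eta G t)); rewrite mulgV -td_etaM // -eta1.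
    by congr td_eta; apply/rowP => q; rewrite !mxE mulrV.
  exact: IW_eta.
by move=> [/(_ _ IW1)]; rewrite mul1g.
Qed.

Lemma Th_unipotent u b i : unipotent ht u ->
  gr ht (fun l => l <= (-1) ^+ (~~ b) - 1) (act (Th u) (gen g b i) - gen g b i).
Proof.
move=> [Hu _]; have [w [sw w_gen w_h]] := semi_chevalley g true.
have eqv := @equivariant_all true w Th sw w_gen ThM Th_x Th_equivariant_eta u.
have dg := derived_gen g hcartan (~~ b) i.
have -> : gen g b i = w (gen g (~~ b) i) by rewrite w_gen addbT negbK.
rewrite eqv // -(semiN sw) -(semiD sw).
have H := raising_height_gen hcartan (~~ b) i Hu.
have := semi_gr sw w_gen w_h (der_diff (act_endo u) dg) H.
apply: gr_sub => l; rewrite /ge expr1 mulN1r negbK.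
by case: b {w_gen H dg eqv}; rewrite /= ?expr0 ?expr1; lia.
Qed.

(** On a generator [x] the equation gives [chi (u x - x) = chi' Th(u) x - chi x]. The left side has
    heights above that of [x]; the right side has none above it, as [Th u] is unipotent in the
    opposite direction. *)
Lemma fixed_diagonal_gen u t k b i : unipotent ht u -> torus t ->
  Th (u * td_eta G t)%g = (u * td_eta G t * k)%g ->
  act k (gen g b i) = gen g b i -> act u (gen g b i) = gen g b i.
Proof.
move=> Hu Ht E Hk; have dg := derived_gen g hcartan b i.
have tor t' : torus t' -> exists2 chi, chi != 0 & act (td_eta G t') (gen g b i) = chi *: gen g b i.
  move=> Ht'; rewrite act_torus //; eexists; last by [].
  by apply: torus_eval_neq0; exact: torus_map.
have [chi chi0 Ec] := tor t Ht.
have [chi' _ Ec'] := tor _ (inv_conj_torus_torus Ht).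
have actZ v a : act v (a *: gen g b i) = a *: act v (gen g b i).
  have d0 : der 0 by exact: linc0 (derived_lin_closed g).
  by have := de_linear (act_endo v) a dg d0; rewrite !addr0 endo0 ?addr0 //; exact: act_endo.
have := congr1 (act^~ (gen g b i)) E.
rewrite /= ThM Th_eta // actM // [RHS]actM // Hk actM // Ec Ec' !actZ.
move=> F; apply/eqP; rewrite -subr_eq0; apply/eqP; apply: (scalerI chi0).
rewrite scaler0; apply: (@gr_disjoint _ _ _ _ g ht (ge ((-1) ^+ (~~ b) + 1))
  (fun l => l <= (-1) ^+ (~~ b))).
- by apply: (lincZ (gr_lin_closed _ _ _)); exact: (raising_height_gen hcartan b i Hu.1).
- have gl := gr_lin_closed g ht (fun l => l <= (-1) ^+ (~~ b)).
  have gg : gr ht (fun l => l <= (-1) ^+ (~~ b)) (gen g b i).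
    by apply: gr_gen; rewrite mulr1.
  rewrite scalerBr -F; apply: (lincB gl); last exact: (lincZ gl).
  apply: (lincZ gl); rewrite -(subrK (gen g b i) (act _ _)); apply: (lincD gl) => //.
  by apply: gr_sub (Th_unipotent b i Hu) => l; lia.
by rewrite /ge => l; lia.
Qed.

(** In the real case the image of [u] is fixed by the conjugation of the complex points; by
    injectivity of [eta] the torus coordinates are then real. *)
Lemma torus_descent (u : G K) : torus_subgroup (gf_map G j u) -> torus_subgroup u.
Proof.
move=> [s Hs Es].
have jinj : injective j by exact: fmorph_inj.
have lift (s0 : 'rV[K]_m) : map_mx j s0 = s -> torus_subgroup u.
  move=> E; have Hs0 : torus s0.
    by move=> q; have := Hs q; rewrite -E mxE !unitfE fmorph_eq0.
  exists s0 => //; apply: (tf_map_inj jinj).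
  by rewrite Es td_eta_natural // E.
have real_lift : (forall q, exists r, j r = s 0 q) -> torus_subgroup u.
  move=> H; pose f q := projT1 (cid (H q)).
  apply: (lift (\row_q f q)); apply/rowP => q; rewrite !mxE.
  by rewrite /f; case: cid.
case: j_descent => [jsur|[bar_id jreal]]; first by apply: real_lift => q; exact: jsur.
apply: real_lift => q; apply: jreal.
have jj : j =1 conj \o j by move=> z /=; rewrite j_bar bar_id.
have E2 : gf_map G conj (gf_map G j u) = gf_map G j u.
  exact: esym (@gf_map_comp G _ _ _ j conj j jj u).
have Hc := torus_map conj Hs.
move: E2; rewrite Es td_eta_natural // => /(tf_eta_inj Hc Hs) /rowP /(_ q).
by rewrite mxE.
Qed.

Lemma adjoint_trivial_fixed h (k := (h^-1 * Th h)%g) : (k * k)%g = 1%g ->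
  (forall x, der x -> act k x = x) -> k = 1%g.
Proof.
move=> kk act_k.
have [kap [u [t [fixk Hu Ht Eh]]]] := iwasawa h.
have Ek : Th (u * td_eta G t)%g = (u * td_eta G t * k)%g.
  rewrite -mulgA in Eh; rewrite /k Eh (ThM kap) fixk; move: (u * td_eta G t)%g => b.
  by rewrite invgM -mulgA mulKg mulVKg.
have act_u x : der x -> act u x = x.
  move: x; apply: (derived_ind (P := fun x => act u x = x) hcartan).
  - by move=> a y z dy dz Hy Hz; rewrite (de_linear (act_endo u)) // Hy Hz.
  - by move=> y z dy dz Hy Hz; rewrite (de_bracket (act_endo u)) // Hy Hz.
  - by rewrite endo0 //; exact: act_endo.
  move=> b i; apply: (fixed_diagonal_gen Hu Ht Ek).
  by apply: act_k; exact: derived_gen.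
have [s Hs Es] : torus_subgroup u by apply: torus_descent; apply: (ad_kernel HAd).
have Hst := torus_mul_torus Hs Ht.
(* For [h = kappa eta(st)] the element [k = h^-1 Theta(h)] is toral, with the inverse squared moduli
   of [st] as coordinates. Their positivity excludes the sign -1 that [k * k = 1] alone would
   allow. *)
pose tau : 'rV[K]_m := \row_q (torus_mul s t 0 q * bar (torus_mul s t 0 q))^-1.
have nz q : torus_mul s t 0 q != 0 by rewrite -unitfE; exact: Hst.
have Htau : torus tau.
  by move=> q; rewrite mxE unitrV unitfE mulf_neq0 ?fmorph_eq0.
have k_tau : k = td_eta G tau.
  apply: (@mulgI _ (td_eta G (torus_mul s t))); rewrite -td_etaM //.
  have -> : torus_mul (torus_mul s t) tau = inv_conj_torus (torus_mul s t).
    by apply/rowP => q; rewrite [LHS]mxE [tau _ _]mxE [RHS]mxE invfM mulVKf.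
  by rewrite -Th_eta // td_etaM // -Es Ek.
have tau2 : torus_mul tau tau = const_mx 1.
  apply: (@tf_eta_inj _ _ _ _ _ G K); rewrite ?eta1 ?td_etaM -?k_tau ?kk //.
    exact: torus_mul_torus.
  by move=> q; rewrite mxE unitr1.
rewrite k_tau -eta1; congr td_eta; apply/rowP => q; rewrite [RHS]mxE.
have sq : j (tau 0 q) ^+ 2 = 1.
  by rewrite -rmorphXn expr2 -(rmorph1 j); congr (j _); have /rowP/(_ q) := tau2; rewrite !mxE.
have pos : 0 <= j (tau 0 q).
  by rewrite mxE fmorphV rmorphM -j_bar invr_ge0; exact: mulcJ_ge0.
apply: (fmorph_inj j); rewrite rmorph1.
by apply/eqP; rewrite -(@eqrXn2 _ 2) ?sq ?expr1n ?ler01.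
Qed.

End Involution.

End Iwasawa.

(** * Ultralimits *)

Section ComplexUltralimits.
Variable R : realType.
Local Notation C := (Num.NumField.sort (R[i] : numFieldType)).
Local Open Scope classical_set_scope.

(** The norm of [R[i]] takes its values in [R[i]]; a real-valued version is needed for compactness
    and for comparison with real bounds. *)
Definition modulus (z : C) : R := complex.Re `|z|.

Lemma modulusE z : `|z| = (modulus z)%:C%C.
Proof. by rewrite /modulus RRe_real // normr_real. Qed.

Lemma gt0c (e : R) : (0 < e%:C%C :> C) = (0 < e).
Proof. exact: (ltcR 0 e). Qed.

Lemma modulus_le z (c : R) : (modulus z <= c) = (`|z| <= c%:C%C).
Proof. by rewrite modulusE lecR. Qed.

Lemma modulus_lt z (c : R) : (modulus z < c) = (`|z| < c%:C%C).
Proof. by rewrite modulusE ltcR. Qed.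

Lemma modulus_ge0 z : 0 <= modulus z.
Proof. by have := normr_ge0 z; rewrite modulusE ler0c. Qed.

Lemma modulus0 : modulus 0 = 0. Proof. by rewrite /modulus normr0. Qed.

Lemma modulus1 : modulus 1 = 1. Proof. by rewrite /modulus normr1. Qed.

Lemma modulus_eq0 z : (modulus z == 0) = (z == 0).
Proof. by rewrite -(normr_eq0 z) modulusE (inj_eq (@complexI R) _ 0). Qed.

Lemma modulusD x y : modulus (x + y) <= modulus x + modulus y.
Proof. by rewrite modulus_le rmorphD /= -!modulusE ler_normD. Qed.

Lemma modulusM x y : modulus (x * y) = modulus x * modulus y.
Proof. by apply: (@complexI R); rewrite rmorphM /= -!modulusE normrM. Qed.

Lemma modulusN x : modulus (- x) = modulus x.
Proof. by rewrite /modulus normrN. Qed.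

Lemma modulusV x : modulus x^-1 = (modulus x)^-1.
Proof. by apply: (@complexI R); rewrite fmorphV /= -!modulusE normfV. Qed.

Lemma modulus_ReIm z : modulus z <= `|complex.Re z| + `|complex.Im z|.
Proof.
rewrite modulus_le [X in `|X|]complexE (le_trans (ler_normD _ _)) //.
rewrite normrM rmorphD /= !modulusE.
have i1 : modulus 'i%C = 1.
  by rewrite /modulus normc_def /= expr0n expr1n add0r sqrtr1.
rewrite i1 mul1r -!rmorphD lecR /modulus !normc_def /= !expr0n !addr0.
by rewrite !sqrtr_sqr.
Qed.

Lemma Re_le_modulus z : `|complex.Re z| <= modulus z.
Proof.
rewrite /modulus normc_def /= -sqrtr_sqr ler_wsqrtr // lerDl; exact: sqr_ge0.
Qed.

Lemma Im_le_modulus z : `|complex.Im z| <= modulus z.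
Proof.
rewrite /modulus normc_def /= -sqrtr_sqr ler_wsqrtr // lerDr; exact: sqr_ge0.
Qed.

Lemma cvg_modulusP (T : Type) (F : set_system T) (FF : Filter F) (z : T -> C) (l : C) :
  (z @ F --> l) <-> forall e : R, 0 < e -> \forall q \near F, modulus (l - z q) < e.
Proof.
split.
  move/cvgrPdist_lt => H e e0; have := H e%:C%C; rewrite gt0c => /(_ e0).
  by apply: filterS => q; rewrite modulus_lt.
move=> H; apply/cvgrPdist_lt => e e0.
have er : e = (complex.Re e)%:C%C by rewrite RRe_real // gtr0_real.
rewrite er gt0c in e0; move: (H _ e0); apply: filterS => q.
by rewrite modulus_lt -er.
Qed.

Lemma fmap_ultra (S T : Type) (f : S -> T) (F : set_system S) :
  UltraFilter F -> UltraFilter (f @ F).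
Proof.
move=> FU; split; first exact: fmap_proper_filter.
move=> H HH sub; rewrite predeqE => A; split=> [HA|]; last exact: sub.
have [//|nA] := in_ultra_setVsetC (f @^-1` A) FU.
have : H (A `&` ~` A) by apply: filterI => //; apply: sub.
by rewrite setICr => /filter_not_empty.
Qed.

Variables (U : set_system nat) (UU : UltraFilter U).

Lemma ultra_bounded_cvg (x : nat -> R) (c : R) : U [set q | `|x q| <= c] ->
  exists l : R, x @ U --> l.
Proof.
move=> Ux; have cpt := @segment_compact R (- c) c.
rewrite compact_ultra in cpt.
have [|l [_ xl]] := cpt (x @ U) (fmap_ultra x UU).
  by move: Ux; apply: (@filterS _ U) => q /=; rewrite in_itv /= -ler_norml.
by exists l.
Qed.

Lemma ultra_modulus_cvg (z : nat -> C) (c : R) : U [set q | modulus (z q) <= c] ->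
  exists l : C, z @ U --> l.
Proof.
move=> Uz.
have [|a za] := @ultra_bounded_cvg (fun q => complex.Re (z q)) c.
  by move: Uz; apply: filterS => q; apply: le_trans; exact: Re_le_modulus.
have [|b zb] := @ultra_bounded_cvg (fun q => complex.Im (z q)) c.
  by move: Uz; apply: filterS => q; apply: le_trans; exact: Im_le_modulus.
exists (a +i* b)%C; apply/cvg_modulusP => e e0.
have e2 : 0 < e / 2 by rewrite divr_gt0.
move/cvgrPdist_lt: za => /(_ _ e2) za; move/cvgrPdist_lt: zb => /(_ _ e2) zb.
apply: filterS2 za zb => q Ha Hb; apply: le_lt_trans (modulus_ReIm _) _.
rewrite [e]splitr; apply: ltrD; rewrite raddfB /=; [exact: Ha|exact: Hb].
Qed.

Lemma ultra_modulus_le (z : nat -> C) (l : C) (c : R) : z @ U --> l ->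
  U [set q | modulus (z q) <= c] -> modulus l <= c.
Proof.
move=> /cvg_modulusP zl Uz; apply/ler_addgt0Pr => e e0.
have [q [H1 H2]] := filter_ex (filterI (zl e e0) Uz).
rewrite -(subrK (z q) l) addrC (le_trans (modulusD _ _)) // lerD //.
exact: ltW.
Qed.

Lemma ultra_modulus_ge (z : nat -> C) (l : C) (c : R) : z @ U --> l ->
  U [set q | c <= modulus (z q)] -> c <= modulus l.
Proof.
move=> /cvg_modulusP zl Uz; apply/ler_addgt0Pr => e e0.
have [q [H1 H2]] := filter_ex (filterI (zl e e0) Uz).
apply: le_trans H2 _; rewrite -(subKr l (z q)) (le_trans (modulusD _ _)) // modulusN lerD //.
exact: ltW.
Qed.

(** Freezes the discrete data of a sequence; otherwise the ultrafilter would contain every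
    complement of a fibre, and so their empty intersection. *)
Lemma ultra_const (I : finType) (f : nat -> I) : exists i, U [set q | f q = i].
Proof.
apply: contrapT => H.
have Hc i : U [set q | f q <> i].
  have [Ui|//] := in_ultra_setVsetC [set q | f q = i] UU.
  by case: H; exists i.
have HF : U [set q | forall i, f q <> i].
  exact: (@filter_forall _ _ (fun i => [set q | f q <> i])).
have [q Hq] := filter_ex HF.
exact: (Hq (f q)).
Qed.

End ComplexUltralimits.

Section FiniteConvergence.
Variables (R : realType) (n : nat) (A : 'M[int]_n) (D : root_datum A).
Variable g : kac_moody_algebra D R[i].
Hypothesis hcartan : generalized_cartan A.
Local Notation C := (Num.NumField.sort (R[i] : numFieldType)).
Local Notation der := (@derived_algebra R[i] g).
Variables (U : set_system nat) (UU : UltraFilter U).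
Local Open Scope classical_set_scope.

(* Convergence along U inside a finite-dimensional subspace of the derived
   algebra, for the standard topology of that subspace. *)
Definition fconv (y : nat -> g) (l : g) : Prop :=
  exists (I : finType) (v : I -> g) (a : nat -> I -> C) (b : I -> C),
  [/\ forall i, der (v i), forall i, (fun q => a q i) @ U --> b i,
      U [set q | y q = \sum_i a q i *: v i] & l = \sum_i b i *: v i].

Lemma fconv_eq y y' l : fconv y l -> U [set q | y q = y' q] -> fconv y' l.
Proof.
move=> + E; move=> [I [v [a [b [dv ab yE lE]]]]]; exists I, v, a, b; split=> //.
by move: E yE; apply: filterS2 => q /= <-.
Qed.

Lemma fconv_scale (a : nat -> C) (b : C) v : der v -> a @ U --> b ->
  fconv (fun q => a q *: v) (b *: v).
Proof.
move=> dv ab; exists 'I_1, (fun=> v), (fun q _ => a q), (fun=> b).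
split=> //; first by apply: filterE => q /=; rewrite big_ord1.
by rewrite big_ord1.
Qed.

Lemma fconv_cst v : der v -> fconv (fun=> v) v.
Proof.
move=> dv; have H1 : (fun=> 1 : C) @ U --> (1 : C) by exact: cvg_cst.
have := fconv_scale dv H1.
by rewrite scale1r.
Qed.

Lemma fconvD y y' l l' : fconv y l -> fconv y' l' ->
  fconv (fun q => y q + y' q) (l + l').
Proof.
move=> [I [v [a [b [dv ab yE ->]]]]] [J [w [c [d [dw cd wE ->]]]]].
exists (I + J)%type, (fun s => match s with inl i => v i | inr i => w i end),
  (fun q s => match s with inl i => a q i | inr i => c q i end),
  (fun s => match s with inl i => b i | inr i => d i end).
split; [by case|by case| |by rewrite big_sumType].
by move: yE wE; apply: filterS2 => q /= -> ->; rewrite big_sumType.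
Qed.

Lemma fconv_scaler (c : nat -> C) (d : C) y l : c @ U --> d -> fconv y l ->
  fconv (fun q => c q *: y q) (d *: l).
Proof.
move=> cd [I [v [a [b [dv ab yE ->]]]]].
exists I, v, (fun q i => c q * a q i), (fun i => d * b i); split.
- exact: dv.
- move=> i; apply: cvgM; [exact: cd|exact: ab].
- move: yE; apply: filterS => q /= ->; rewrite scaler_sumr.
  by apply: eq_bigr => i _; rewrite scalerA.
- by rewrite scaler_sumr; apply: eq_bigr => i _; rewrite scalerA.
Qed.

Lemma fconv_sum (I : finType) (y : I -> nat -> g) (l : I -> g) :
  (forall i, fconv (y i) (l i)) -> fconv (fun q => \sum_i y i q) (\sum_i l i).
Proof.
move=> H; suff Hs s : fconv (fun q => \sum_(i <- s) y i q) (\sum_(i <- s) l i) by exact: Hs.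
elim: s => [|i s IH].
  rewrite big_nil; have := fconv_cst (linc0 (derived_lin_closed g)).
  by move/fconv_eq; apply; apply: filterE => q /=; rewrite big_nil.
rewrite big_cons; have := fconvD (H i) IH; move/fconv_eq; apply.
by apply: filterE => q /=; rewrite big_cons.
Qed.

Lemma fconv_map (F : nat -> g -> g) (F0 : g -> g) y l :
  (forall q, derived_endo (F q)) -> derived_endo F0 ->
  (forall v, der v -> fconv (fun q => F q v) (F0 v)) ->
  fconv y l -> fconv (fun q => F q (y q)) (F0 l).
Proof.
move=> HF HF0 H [I [v [a [b [dv ab yE ->]]]]].
have endo_sum F1 (x : I -> C) : derived_endo F1 ->
    F1 (\sum_i x i *: v i) = \sum_i x i *: F1 (v i).
  move=> e1; suff [_ ->] : der (\sum_(i <- index_enum I) x i *: v i) /\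
     F1 (\sum_(i <- index_enum I) x i *: v i) = \sum_(i <- index_enum I) x i *: F1 (v i) by [].
  elim: (index_enum I) => [|i s [ds Es]].
    by rewrite !big_nil endo0 //; split=> //; exact: linc0 (derived_lin_closed g).
  rewrite !big_cons (de_linear e1) // Es; split=> //.
  exact: (derived_lin_closed g).2.
rewrite endo_sum //.
have := @fconv_sum I (fun i q => a q i *: F q (v i)) (fun i => b i *: F0 (v i)).
have Hi i : fconv (fun q => a q i *: F q (v i)) (b i *: F0 (v i)).
  by apply: fconv_scaler; [exact: ab|exact: H].
move=> /(_ Hi) /fconv_eq; apply; move: yE; apply: filterS => q /= ->.
by rewrite endo_sum.
Qed.

Lemma fconv_der y l : fconv y l -> der l.
Proof.
move=> [I [v [a [b [dv ab yE ->]]]]]; apply: (linc_sum (derived_lin_closed g)) => i _.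
exact: (lincZ (derived_lin_closed g)).
Qed.

Lemma fconv_bracket y y' l l' : fconv y l -> fconv y' l' ->
  fconv (fun q => bracket (y q) (y' q)) (bracket l l').
Proof.
move=> [I [v [a [b [dv ab yE ->]]]]] [J [w [c [d [dw cd wE ->]]]]].
have E (x : I -> C) (z : J -> C) : bracket (\sum_i x i *: v i) (\sum_i z i *: w i)
    = \sum_i \sum_j (x i * z j) *: bracket (v i) (w j).
  rewrite bracket_suml; apply: eq_bigr => i _; rewrite bracket_sumr.
  by apply: eq_bigr => j _; rewrite bracketZl bracketZr scalerA.
rewrite E; have H i : fconv (fun q => \sum_j (a q i * c q j) *: bracket (v i) (w j))
    (\sum_j (b i * d j) *: bracket (v i) (w j)).
  apply: fconv_sum => j; apply: fconv_scale; first exact: derived_bracket.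
  by apply: cvgM; [exact: ab|exact: cd].
have /fconv_eq := fconv_sum H; apply; move: yE wE; apply: filterS2 => q /= -> ->.
by rewrite E.
Qed.

Definition independent (N : nat) (v : 'I_N -> g) : Prop :=
  forall c : 'I_N -> C, \sum_i c i *: v i = 0 -> forall i, c i = 0.

(** A dependent vector is eliminated by a relation that does not vary with [q], so the new
    coefficients still converge. Coefficients are then determined by the vectors, which uniqueness
    of limits and normalization require. *)
Lemma fconv_independent y l : fconv y l ->
  exists N (v : 'I_N -> g) (a : nat -> 'I_N -> C) (b : 'I_N -> C),
  [/\ forall i, der (v i), forall i, (fun q => a q i) @ U --> b i,
      U [set q | y q = \sum_i a q i *: v i], l = \sum_i b i *: v i
    & independent v].
Proof.
move=> [I [v [a [b [dv ab yE lE]]]]].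
have : exists (v : 'I_#|I| -> g) (a : nat -> 'I_#|I| -> C) (b : 'I_#|I| -> C),
  [/\ forall i, der (v i), forall i, (fun q => a q i) @ U --> b i,
      U [set q | y q = \sum_i a q i *: v i] & l = \sum_i b i *: v i].
  exists (fun i => v (enum_val i)), (fun q i => a q (enum_val i)), (fun i => b (enum_val i)).
  split=> //.
    move: yE; apply: filterS => q /= ->.
    by rewrite (reindex _ (onW_bij _ (enum_val_bij I))).
  by rewrite lE (reindex _ (onW_bij _ (enum_val_bij I))).
move: #|I| => N {I v a b dv ab yE lE}.
elim: N => [|N IH] [v [a [b [dv ab yE lE]]]].
  by exists 0%N, v, a, b; split=> // c _ [].
have [ind|dep] := pselect (independent v).
  by exists N.+1, v, a, b.
have [c [cv [p cp]]] : exists c : 'I_N.+1 -> C, \sum_i c i *: v i = 0 /\ exists p, c p != 0.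
  apply: contrapT => H; apply: dep => c cv i; apply: contrapT => ci.
  by apply: H; exists c; split=> //; exists i; apply/eqP.
have red (x : 'I_N.+1 -> C) : \sum_i x i *: v i
    = \sum_i (x (lift p i) - x p / c p * c (lift p i)) *: v (lift p i).
  have vp : v p = - (c p)^-1 *: \sum_i c (lift p i) *: v (lift p i).
    move: cv; rewrite (bigD1_ord p) //= => /eqP; rewrite addr_eq0 => /eqP E.
    by rewrite -[LHS]scale1r -(mulVf cp) -scalerA E scalerN scaleNr.
  rewrite (bigD1_ord p) //= vp scalerA scaler_sumr -big_split /=.
  by apply: eq_bigr => i _; rewrite scalerA -scalerDl; congr (_ *: _); ring.
apply: IH; exists (fun i => v (lift p i)),
  (fun q i => a q (lift p i) - a q p / c p * c (lift p i)),
  (fun i => b (lift p i) - b p / c p * c (lift p i)); split=> //.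
- move=> i; apply: cvgB; first exact: ab.
  by do 2 (apply: cvgM; last exact: cvg_cst); exact: ab.
- by move: yE; apply: filterS => q /= ->; exact: red.
- by rewrite lE red.
Qed.

Lemma fconv_unique0 y l : fconv y l -> U [set q | y q = 0] -> l = 0.
Proof.
move=> /fconv_independent [N [v [a [b [dv ab yE -> ind]]]]] y0.
rewrite big1 // => i _; suff -> : b i = 0 by rewrite scale0r.
have := ab i; have : (fun q => a q i) @ U --> (0 : C).
  apply: cvg_near_cst; move: y0 yE; apply: filterS2 => q /= -> /esym E.
  exact: ind E i.
by move=> H1 H2; exact: (norm_cvg_unique H2 H1).
Qed.

(** Division by the coefficient of largest modulus bounds all coefficients by 1, so they converge.
    Its index is constant along [U], and there the limit coefficient is 1; independence keeps the
    limit non-zero. *)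
Lemma fconv_normalize y l : fconv y l -> U [set q | y q != 0] ->
  exists (c : nat -> C) l', fconv (fun q => c q *: y q) l' /\ l' != 0.
Proof.
move=> /fconv_independent [N [v [a [b [dv ab yE lE ind]]]]] y0.
case: N v a b dv ab yE lE ind => [|N] v a b dv ab yE lE ind.
  have [q [/= E]] := filter_ex (filterI yE y0).
  by rewrite E big_ord0 eqxx.
pose mx q := [arg max_(i > (ord0 : 'I_N.+1)) modulus (a q i)]%O.
have mxP q i : modulus (a q i) <= modulus (a q (mx q)).
  by rewrite /mx; case: arg_maxP => // p _; apply.
have [p Up] := ultra_const UU mx.
have Uap : U [set q | a q p != 0].
  move: Up yE y0; apply: filterS3 => q /= Ep Ey; apply: contraNneq => ap0.
  rewrite Ey big1 // => i _; have := mxP q i; rewrite Ep ap0 modulus0 => le0.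
  have /eqP -> : a q i == 0 by rewrite -modulus_eq0 eq_le le0 modulus_ge0.
  by rewrite scale0r.
pose c q := (a q p)^-1.
have bnd i : U [set q | modulus (c q * a q i) <= 1].
  move: Up Uap; apply: filterS2 => q /= Ep ap; rewrite /c modulusM modulusV.
  rewrite mulrC ler_pdivrMr ?mul1r -?Ep //.
  by rewrite Ep lt_def modulus_eq0 ap modulus_ge0.
have b'P i := ultra_modulus_cvg UU (bnd i).
pose b' i := projT1 (cid (b'P i)).
have b'E i : (fun q => c q * a q i) @ U --> b' i by rewrite /b'; case: cid.
have b'p : b' p = 1.
  have := b'E p; have : (fun q => c q * a q p) @ U --> (1 : C).
    by apply: cvg_near_cst; move: Uap; apply: filterS => q /= ap; rewrite mulVf.
  by move=> H1 H2; exact: (norm_cvg_unique H2 H1).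
exists c, (\sum_i b' i *: v i); split.
  exists 'I_N.+1, v, (fun q i => c q * a q i), b'; split=> //.
  move: yE; apply: filterS => q /= ->; rewrite scaler_sumr.
  by apply: eq_bigr => i _; rewrite scalerA.
apply/eqP => /ind /(_ p) /eqP; rewrite b'p; exact/negP/oner_neq0.
Qed.

End FiniteConvergence.

(** * Small products in a group *)

Section ListConvergence.
Variables (U : set_system nat) (UU : UltraFilter U).
Variables (T : Type) (cv : (nat -> T) -> T -> Prop).
Local Open Scope classical_set_scope.

(** Letterwise convergence of words; along [U] the length is that of the limit. *)
Fixpoint lconv (w : nat -> seq T) (l : seq T) : Prop :=
  match l with
  | [::] => U [set q | w q = [::]]
  | a :: l' => exists (p : nat -> T) (w' : nat -> seq T),
      [/\ U [set q | w q = p q :: w' q], cv p a & lconv w' l']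
  end.

Lemma lconv_eq w w' l : lconv w l -> U [set q | w q = w' q] -> lconv w' l.
Proof.
case: l => [|a l] /=; first by move=> + E; move: E; apply: filterS2 => q /= <-.
move=> [p [v [E pa vl]]] E'; exists p, v; split=> //.
by move: E' E; apply: filterS2 => q /= <-.
Qed.

Lemma lconv_cat w w' l l' : lconv w l -> lconv w' l' ->
  lconv (fun q => w q ++ w' q) (l ++ l').
Proof.
move=> + H'; elim: l w => [|a l IH] w /=.
  by move=> E; apply: lconv_eq H' _; move: E; apply: filterS => q /= ->.
move=> [p [v [E pa vl]]]; exists p, (fun q => v q ++ w' q); split=> //.
  by move: E; apply: filterS => q /= ->.
exact: IH.
Qed.

Lemma lconv_cons p a w l : cv p a -> lconv w l ->
  lconv (fun q => p q :: w q) (a :: l).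
Proof.
by move=> pa wl; exists p, w; split=> //; apply: filterE.
Qed.

(** Bounded length is essential: letters are peeled off one at a time, each by compactness of the
    letter space. [x0] is the default head of an empty word. *)
Lemma lconv_compact (P : nat -> T -> Prop) (Q : T -> Prop) (x0 : T) M :
  (forall p, U [set q | P q (p q)] -> exists2 a, cv p a & Q a) ->
  forall w, U [set q | (size (w q) <= M)%N /\ forall a, List.In a (w q) -> P q a] ->
  exists l, [/\ lconv w l, (size l <= M)%N & forall a, List.In a l -> Q a].
Proof.
move=> H; elim: M => [|M IH] w Uw.
  exists [::]; split=> //=; move: Uw; apply: filterS => q /= [].
  by rewrite leqn0 => /eqP/size0nil.
have [Unil|Ucons] := in_ultra_setVsetC [set q | w q = [::]] UU.
  by exists [::].
pose p q := head x0 (w q); pose w' q := behead (w q).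
have [|a pa Qa] := H p.
  by move: Uw Ucons; apply: filterS2 => q /= [_]; rewrite /p; case: (w q) => //= b s Hb _; apply: Hb; left.
have [|l [wl sl Ql]] := IH w'.
  move: Uw; apply: filterS => q /= [sw Pw]; split; first by rewrite size_behead; case: (w q) sw.
  by move=> b; rewrite /w' => Hb; apply: Pw; case: (w q) Hb => //= c s; right.
exists (a :: l); split=> //; last by move=> b /= [<-|/Ql].
exists p, w'; split=> //.
by move: Ucons; apply: filterS => q /=; rewrite /p /w'; case: (w q).
Qed.

End ListConvergence.

Lemma lconv_map (U : set_system nat) (UU : UltraFilter U) (T T' : Type)
    (cv : (nat -> T) -> T -> Prop) (cv' : (nat -> T') -> T' -> Prop) (h : T -> T') :
  (forall p a, cv p a -> cv' (fun q => h (p q)) (h a)) ->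
  forall w l, lconv U cv w l -> lconv U cv' (fun q => map h (w q)) (map h l).
Proof.
move=> H w l; elim: l w => [|a l IH] w /=.
  by apply: filterS => q /= ->.
move=> [p [v [E pa vl]]]; exists (fun q => h (p q)), (fun q => map h (v q)).
split; [by move: E; apply: filterS => q /= ->|exact: H|exact: IH].
Qed.

Lemma lconv_rev (U : set_system nat) (UU : UltraFilter U) (T : Type)
    (cv : (nat -> T) -> T -> Prop) w l :
  lconv U cv w l -> lconv U cv (fun q => rev (w q)) (rev l).
Proof.
elim: l w => [|a l IH] w /=; first by apply: filterS => q /= ->.
move=> [p [v [E pa vl]]]; rewrite rev_cons -cats1.
have H1 : lconv U cv (fun q => [:: p q]) [:: a].
  by apply: lconv_cons => //; apply: filterE.
apply: lconv_eq (lconv_cat UU (IH v vl) H1) _.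
by move: E; apply: filterS => q /= ->; rewrite rev_cons cats1.
Qed.

Lemma lconv_flatten (U : set_system nat) (UU : UltraFilter U) (T T' : Type)
    (cv : (nat -> T) -> T -> Prop) (cv' : (nat -> T') -> T' -> Prop) (h : T -> seq T') :
  (forall p a, cv p a -> lconv U cv' (fun q => h (p q)) (h a)) ->
  forall w l, lconv U cv w l ->
    lconv U cv' (fun q => flatten (map h (w q))) (flatten (map h l)).
Proof.
move=> H w l; elim: l w => [|a l IH] w /=.
  by apply: filterS => q /= ->.
move=> [p [v [E pa vl]]]; apply: lconv_eq (lconv_cat UU (H _ _ pa) (IH v vl)) _.
by move: E; apply: filterS => q /= ->.
Qed.

(** * Construction of the small products *)

Section SmallProducts.
Variables (R : realType) (H : groupType) (L : finType).
Local Notation C := (Num.NumField.sort (R[i] : numFieldType)).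
Variables (f : L -> C -> H) (W : H -> Prop).
Local Open Scope classical_set_scope.

Definition letter : Type := (L * bool * C)%type.
Definition letter_val (a : letter) : H :=
  if a.1.2 then f a.1.1 a.2 else (f a.1.1 a.2)^-1%g.
Definition word_eval (w : seq letter) : H :=
  foldr (fun a x => letter_val a * x)%g 1%g w.
Definition letter_inv (a : letter) : letter := (a.1.1, ~~ a.1.2, a.2).
Definition word_inv (w : seq letter) : seq letter := rev (map letter_inv w).

Lemma word_eval_cat w w' : word_eval (w ++ w') = (word_eval w * word_eval w')%g.
Proof. by elim: w => [|a w IH] /=; rewrite ?mul1g // IH mulgA. Qed.

Lemma letter_invE a : letter_val (letter_inv a) = (letter_val a)^-1%g.
Proof. by case: a => [[l []] z]; rewrite /letter_val /= ?invgK. Qed.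

Lemma word_invE w : word_eval (word_inv w) = (word_eval w)^-1%g.
Proof.
elim: w => [|a w IH] /=; first by rewrite invg1.
rewrite /word_inv /= rev_cons -cats1 word_eval_cat IH /= mulg1 letter_invE.
by rewrite invgM.
Qed.

Definition letter_conv (U : set_system nat) (p : nat -> letter) (a : letter) : Prop :=
  U [set q | (p q).1 = a.1] /\ (fun q => (p q).2) @ U --> a.2.

(* Letters are invertible for z <> -1 only, because of eta(1 + z); these are
   compact sets of parameters exhausting C minus -1. *)
Definition dom (m : nat) (z : C) : Prop :=
  modulus z <= m.+1%:R /\ m.+1%:R^-1 <= modulus (1 + z).

Hypothesis f0 : forall l, f l 0 = 1%g.
Hypothesis W1 : W 1%g.
(** Openness of [W] for convergence of words. It will be applied to the elements whose adjoint
    action is not a non-trivial involution. *)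
Hypothesis W_open : forall U (UU : UltraFilter U) (w : nat -> seq letter) l,
  lconv U (letter_conv U) w l -> (forall a, List.In a l -> 1 + a.2 != 0) ->
  W (word_eval l) -> U [set q | W (word_eval (w q))].

Lemma domS m m' z : (m <= m')%N -> dom m z -> dom m' z.
Proof.
move=> le [H1 H2]; split.
  by apply: le_trans H1 _; rewrite ler_nat ltnS.
by apply: le_trans H2; rewrite lef_pV2 ?posrE ?ltr0n // ler_nat ltnS.
Qed.

Lemma dom_neq0 m z : dom m z -> 1 + z != 0.
Proof.
move=> [_ H2]; rewrite -modulus_eq0 gt_eqF // (lt_le_trans _ H2) //.
by rewrite invr_gt0 ltr0n.
Qed.

(** This is why every bound [delta i] is kept below one half: small letters stay away from the
    forbidden parameter -1. *)
Lemma small_dom z : modulus z <= 2^-1 -> dom 1 z.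
Proof.
move=> Hz; have := modulusD (1 + z) (- z); rewrite addrK modulus1 modulusN.
by move=> H1; split; lra.
Qed.

Lemma letter_compact U (UU : UltraFilter U) m (p : nat -> letter) :
  U [set q | dom m (p q).2] -> exists2 a, letter_conv U p a & dom m a.2.
Proof.
move=> Ud.
have [l Ul] := ultra_const UU (fun q => (p q).1).
have U1 : U [set q | modulus (p q).2 <= m.+1%:R].
  by move: Ud; apply: filterS => q /= [].
have [z Uz] := ultra_modulus_cvg UU U1.
exists (l, z) => //; split=> /=; first exact: (ultra_modulus_le UU Uz U1).
have U2 : (fun q => 1 + (p q).2) @ U --> (1 + z : C).
  by apply: cvgD; [exact: cvg_cst|exact: Uz].
apply: (ultra_modulus_ge UU U2).
by move: Ud; apply: filterS => q /= [].
Qed.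

(* (n, m, w, a) stands for the conjugate of the letter a by the word w, of
   length at most m; it belongs to the n-th set of small elements when the
   parameter of a is smaller than delta (n + m). *)
Definition factor : Type := (nat * nat * seq letter * letter)%type.
Definition factor_word (x : factor) : seq letter :=
  let: (n, m, w, a) := x in w ++ a :: word_inv w.
Definition factor_rank (x : factor) : nat := let: (n, m, w, a) := x in (n + m)%N.
Definition factor_level (x : factor) : nat := let: (n, m, w, a) := x in n.
(** Dyadic weights: two products of total size at most [2^-(k+1)] multiply to one of total size at
    most [2^-k], as a neighbourhood basis of a group requires. *)
Definition factor_size (x : factor) : R := 2^-1 ^+ factor_level x.
Definition factor_ok (delta : nat -> R) (x : factor) : Prop :=
  let: (n, m, w, a) := x in
  [/\ (size w <= m)%N, forall b, List.In b w -> dom m b.2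
    & modulus a.2 <= delta (n + m)%N].
Definition factors_eval (s : seq factor) : H :=
  word_eval (flatten (map factor_word s)).

Definition factor_conv U (p : nat -> factor) (x : factor) : Prop :=
  [/\ U [set q | (p q).1.1 = x.1.1], lconv U (letter_conv U) (fun q => (p q).1.2) x.1.2
    & letter_conv U (fun q => (p q).2) x.2].

Lemma letter_conv_inv U (UU : UltraFilter U) p a : letter_conv U p a ->
  letter_conv U (fun q => letter_inv (p q)) (letter_inv a).
Proof.
move=> [U1 U2]; split=> //.
by move: U1; apply: filterS => q /=; rewrite /letter_inv => ->.
Qed.

Lemma factor_conv_word U (UU : UltraFilter U) p x : factor_conv U p x ->
  lconv U (letter_conv U) (fun q => factor_word (p q)) (factor_word x).
Proof.
case: x => [[[n m] w] a] [/= U1 U2 U3].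
have U4 : lconv U (letter_conv U) (fun q => word_inv (p q).1.2) (word_inv w).
  apply: lconv_rev; apply: lconv_map U2 => p' a'; exact: letter_conv_inv.
apply: lconv_eq (lconv_cat UU U2 (lconv_cons UU U3 U4)) _.
by apply: filterE => q /=; case: (p q) => [[[]]].
Qed.

Lemma List_In_cat (T : Type) (a : T) s t :
  List.In a (s ++ t) <-> List.In a s \/ List.In a t.
Proof.
elim: s => [|b s IH] /=; first by split; [right|case].
by rewrite IH; split=> [[|[]]|[[]|]]; auto.
Qed.

Lemma factor_word_dom x : (forall b, List.In b x.1.2 -> 1 + b.2 != 0) ->
  1 + x.2.2 != 0 -> forall b, List.In b (factor_word x) -> 1 + b.2 != 0.
Proof.
case: x => [[[n m] w] a] /= Hw Ha b /List_In_cat [/Hw //|/= [<- //|]].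
rewrite /word_inv -map_rev => Hb.
have [c Hc ->] : exists2 c, List.In c w & b = letter_inv c.
  elim: w {Hw} Hb => //= c w IH; rewrite rev_cons map_rcons -cats1.
  by move=> /List_In_cat [/IH [d dw ->]|/= [<-|//]]; [exists d; auto|exists c; auto].
exact: (Hw c).
Qed.

Definition bounded_products (N : nat) (delta : nat -> R) : Prop :=
  forall s, (forall x, List.In x s -> factor_ok delta x /\ (factor_rank x < N)%N) ->
  \sum_(x <- s) factor_size x <= 1 -> W (factors_eval s).

Lemma factor_size_conv U (UU : UltraFilter U) s l : lconv U (factor_conv U) s l ->
  U [set q | \sum_(x <- s q) factor_size x = \sum_(x <- l) factor_size x].
Proof.
elim: l s => [|x l IH] s /=; first by apply: filterS => q /= ->.
move=> [p [v [E [px _ _] vl]]]; move: E px (IH v vl).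
apply: filterS3 => q /= -> px Ev; rewrite !big_cons Ev; congr (_ + _).
by rewrite /factor_size; case: x (p q) px => [[[n m] w] a] [[[n' m'] w'] a'] /= [-> _].
Qed.

Lemma factor_size_rank x N : (factor_rank x <= N)%N -> 2^-1 ^+ N <= factor_size x.
Proof.
move=> le; rewrite /factor_size; apply: ler_wiXn2l; rewrite ?invr_ge0 ?ler0n //.
  by rewrite invf_le1 ?ltr0n // ler1n.
by apply: leq_trans le; case: x => [[[n m] w] a] /=; exact: leq_addr.
Qed.

(** A factor of rank at most [N] has size at least [2^-N], so total size 1 leaves room for [2^N] of
    them. This provides the bounded length that compactness needs. *)
Lemma factors_size_bound N s : (forall x, List.In x s -> (factor_rank x <= N)%N) ->
  \sum_(x <- s) factor_size x <= 1 -> (size s <= 2 ^ N)%N.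
Proof.
move=> Hs S1; have : 2^-1 ^+ N *+ size s <= 1 :> R.
  apply: le_trans S1; elim: s Hs => [|x s IH] Hs; first by rewrite big_nil.
  rewrite big_cons mulrS; apply: lerD; first by apply: factor_size_rank; apply: Hs; left.
  by apply: IH => y Hy; apply: Hs; right.
rewrite -mulr_natr exprVn mulrC ler_pdivrMr ?exprn_gt0 ?ltr0n // mul1r.
by rewrite -natrX ler_nat.
Qed.

(** Level and length bound take finitely many values because the rank is bounded, so they freeze
    along [U]; the letters then vary in compact sets. [d'] is whatever bound survives in the limit
    of the bounds [d q]. *)
Lemma factor_compact U (UU : UltraFilter U) N (d : nat -> nat -> R) (d' : nat -> R)
    (p : nat -> factor) :
  (forall q i, d q i <= 2^-1) ->
  (forall i (z : nat -> C) (l : C), z @ U --> l ->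
     U [set q | modulus (z q) <= d q i] -> modulus l <= d' i) ->
  U [set q | factor_ok (d q) (p q) /\ (factor_rank (p q) < N.+1)%N] ->
  exists2 x, factor_conv U p x & factor_ok d' x /\ (factor_rank x < N.+1)%N.
Proof.
move=> d2 dlim Up.
pose code (x : factor) : 'I_N.+1 * 'I_N.+1 := (inord x.1.1.1, inord x.1.1.2).
have [[i j] Uij] := ultra_const UU (fun q => code (p q)).
pose n : nat := i; pose m : nat := j.
have Unm : U [set q | (p q).1.1 = (n, m)].
  move: Up Uij; apply: filterS2 => q /=; case: (p q) => [[[n' m'] w] a] /= [_ lt] [Hn Hm].
  rewrite /n /m -Hn -Hm !inordK // (leq_ltn_trans _ lt) ?leq_addr ?leq_addl //.
have Uw : U [set q | (size (p q).1.2 <= m)%N /\ forall b, List.In b (p q).1.2 -> dom m b.2].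
  move: Up Unm; apply: filterS2 => q /=; case: (p q) => [[[n' m'] w] a] /= [[H1 H2 _] _] [_ <-].
  by split.
have x0 : letter by case: (p 0%N) => [[_ _] a]; exact: a.
have [w [wl sw Hw]] := lconv_compact UU (cv := letter_conv U) (P := fun=> fun b => dom m b.2)
    (Q := fun b => dom m b.2) x0 (fun p' => @letter_compact U UU m p') Uw.
have Ua : U [set q | modulus (p q).2.2 <= d q (n + m)%N].
  by move: Up Unm; apply: filterS2 => q /=; case: (p q) => [[[n' m'] w'] a] /= [[_ _ ?] _] [<- <-].
have [|a aconv _] := @letter_compact U UU 1 (fun q => (p q).2).
  by move: Ua; apply: filterS => q /= Hq; apply: small_dom; exact: le_trans Hq (d2 _ _).
exists (n, m, w, a); first by split.
split; first by split=> //; exact: (dlim _ _ _ aconv.2 Ua).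
have [q [/= H1 H2]] := filter_ex (filterI Up Unm).
by move: H1; case: (p q) H2 => [[[n' m'] w'] a'] /= [-> ->] [].
Qed.

Lemma factor_eval0 x : x.2.2 = 0 -> word_eval (factor_word x) = 1%g.
Proof.
case: x => [[[n m] w] [[l b] z]] /= ->.
rewrite word_eval_cat /= word_invE /letter_val /= f0 invg1.
by case: b; rewrite mul1g mulgV.
Qed.

Lemma factors_eval_cons x s : factors_eval (x :: s) = (word_eval (factor_word x) * factors_eval s)%g.
Proof. by rewrite /factors_eval /= word_eval_cat. Qed.

Lemma List_In_filter (T : Type) (P : pred T) x s :
  List.In x [seq y <- s | P y] -> List.In x s /\ P x.
Proof.
elim: s => //= y s IH; case: ifP => Py /=; last by move=> /IH [? ?]; split=> //; right.
by move=> [<-|/IH [? ?]]; split=> //; [left|right].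
Qed.

Lemma List_In_flatten (T T' : Type) (h : T -> seq T') (a : T') s :
  List.In a (flatten (map h s)) -> exists2 x, List.In x s & List.In a (h x).
Proof.
elim: s => //= x s IH /List_In_cat [Ha|/IH [y Hy Hay]]; first by exists x; auto.
by exists y; auto.
Qed.

(* If every bound 1/(q+2) on the letters of rank N failed, the letters of rank N
   would become trivial in an ultralimit of counterexamples. *)
Lemma bounded_products_step N (delta : nat -> R) :
  (forall i, 0 < delta i /\ delta i <= 2^-1) -> bounded_products N delta ->
  exists d : R, [/\ 0 < d, d <= 2^-1
    & bounded_products N.+1 (fun i => if i == N then d else delta i)].
Proof.
move=> Hd IH; apply: contrapT => Hno.
pose d (q i : nat) : R := if i == N then q.+2%:R^-1 else delta i.
have d2 q i : d q i <= 2^-1.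
  rewrite /d; case: ifP => _; last by case: (Hd i).
  by rewrite lef_pV2 ?posrE ?ltr0n // ler_nat.
have bad q : exists s, [/\ forall x, List.In x s -> factor_ok (d q) x /\ (factor_rank x < N.+1)%N,
    \sum_(x <- s) factor_size x <= 1 & ~ W (factors_eval s)].
  apply: contrapT => Hq; apply: Hno; exists q.+2%:R^-1; split.
  - by rewrite invr_gt0 ltr0n.
  - by have := d2 q N; rewrite /d eqxx.
  by move=> s Hs S1; apply: contrapT => nW; apply: Hq; exists s.
have [s Hs] := choice bad.
have [U [UU oo_U]] := ultraFilterLemma (F := \oo) _.
(* The bounds [1 / (q + 2)] tend to 0, so in the limit letters of rank [N] have parameter 0; the
   other bounds do not depend on [q]. *)
pose d' (i : nat) : R := if i == N then 0 else delta i.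
have dlim i (z : nat -> C) (l : C) : z @ U --> l ->
     U [set q | modulus (z q) <= d q i] -> modulus l <= d' i.
  rewrite /d /d' => zl; case: ifP => _ Uz; last exact: ultra_modulus_le zl Uz.
  apply/ler_addgt0Pr => e e0; rewrite add0r; apply: (ultra_modulus_le UU zl).
  have Ue : U [set q | q.+2%:R^-1 <= e].
    apply: oo_U; exists (Num.bound e^-1) => // q /= Hq.
    rewrite -[e]invrK lef_pV2 ?posrE ?invr_gt0 ?ltr0n //.
    apply: le_trans (ltW (archi_boundP _)) _; first by rewrite invr_ge0 ltW.
    by rewrite ler_nat; apply: leq_trans Hq _; rewrite !leqW.
  by move: Uz Ue; apply: filterS2 => q /=; exact: le_trans.
have x0 : factor.
  case Es : (s 0%N) => [|x t]; last exact: x.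
  by have [_ _] := Hs 0%N; rewrite Es /factors_eval /=.
have Us : U [set q | (size (s q) <= 2 ^ N)%N /\
    forall x, List.In x (s q) -> factor_ok (d q) x /\ (factor_rank x < N.+1)%N].
  apply: filterE => q /=; have [H1 H2 _] := Hs q; split=> //.
  by apply: factors_size_bound H2 => x /H1 [].
have [l [sl _ Hl]] := lconv_compact UU (cv := factor_conv U)
  (P := fun q x => factor_ok (d q) x /\ (factor_rank x < N.+1)%N)
  (Q := fun x => factor_ok d' x /\ (factor_rank x < N.+1)%N) x0
  (fun p => @factor_compact U UU N d d' p d2 dlim) Us.
(* Factors of rank [N] are conjugates of 1 and drop out; those of smaller rank form a product
   covered by the induction hypothesis, of no larger total size. *)
have Wl : W (factors_eval l).
  have -> : factors_eval l = factors_eval [seq x <- l | (factor_rank x < N)%N].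
    elim: l Hl {sl} => //= x l IHl Hl; rewrite factors_eval_cons IHl; last first.
      by move=> y Hy; apply: Hl; right.
    have [ok] := Hl x (or_introl erefl); rewrite ltnS leq_eqVlt => /orP[/eqP rx|->].
      rewrite rx ltnn factor_eval0 ?mul1g //.
      move: ok rx; case: x {Hl} => [[[n m] w] a] /= [_ _ Ha] rx.
      rewrite rx /d' eqxx in Ha; apply/eqP; rewrite -modulus_eq0 eq_le Ha.
      exact: modulus_ge0.
    by rewrite factors_eval_cons.
  apply: IH.
    move=> x Hx; have [xl rx] := List_In_filter Hx; split=> //; have [ok _] := Hl x xl.
    move: rx ok {xl Hx}; case: x => [[[n m] w] a] /= rx [H1 H2 H3]; split=> //.
    by move: H3; rewrite /d' (ltn_eqF rx).
  have [q [/= Eq]] := filter_ex (factor_size_conv UU sl).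
  have [_ S1 _] := Hs q; rewrite Eq in S1; apply: le_trans S1.
  rewrite big_filter [leRHS](bigID (fun x => (factor_rank x < N)%N)) /= lerDl.
  by apply: sumr_ge0 => x _; rewrite exprn_ge0 // invr_ge0.
have UW : U [set q | W (factors_eval (s q))].
  apply: (W_open UU (lconv_flatten UU (fun p x => @factor_conv_word U UU p x) sl)) => // a.
  move=> Ha; have [x xl Hax] := List_In_flatten Ha; have [ok _] := Hl x xl; apply: factor_word_dom Hax.
    by case: x ok {xl} => [[[n m] w] a'] /= [_ Hw _] b /Hw /dom_neq0.
  case: x ok {xl Ha} => [[[n m] w] a'] /= [_ _ Ha]; apply: (@dom_neq0 1); apply: small_dom.
  apply: le_trans Ha _; rewrite /d'; case: ifP => _; first by rewrite invr_ge0.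
  by case: (Hd (n + m)%N).
have [q Hq] := filter_ex UW.
by have [_ _] := Hs q.
Qed.

(** Stage [N] changes the value at [N] only, so the diagonal of the recursion agrees with stage [N]
    below [N], and these are the only values that [bounded_products N] reads. *)
Lemma bounded_products_exists : exists delta : nat -> R,
  (forall i, 0 < delta i) /\ forall N, bounded_products N delta.
Proof.
pose T N := {d : nat -> R | (forall i, 0 < d i /\ d i <= 2^-1) /\ bounded_products N d}.
have T0 : T 0%N.
  exists (fun=> 2^-1); split=> [i|s Hs _]; first by rewrite invr_gt0 ltr0n.
  by case: s Hs => [_|x s Hs]; [|case: (Hs x (or_introl erefl))].
have step N (t : T N) : {t' : T N.+1 | forall i, (i < N)%N -> sval t' i = sval t i}.
  case: t => d [Hd Hb]; have [e [e0 e2 He]] := cid (bounded_products_step Hd Hb).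
  have Hd' i : 0 < (if i == N then e else d i) /\ (if i == N then e else d i) <= 2^-1.
    by case: ifP.
  pose t' : T N.+1 := exist _ (fun i => if i == N then e else d i) (conj Hd' He).
  exists t' => i /= iN.
  by rewrite ltn_eqF.
pose rec := nat_rect T T0 (fun N t => sval (step N t)).
pose delta i := sval (rec i.+1) i.
have recE N i : (i < N)%N -> sval (rec N) i = delta i.
  elim: N => // N IH; rewrite ltnS leq_eqVlt => /orP[/eqP -> //|iN].
  by rewrite /= (svalP (step N (rec N))) // IH.
exists delta; split=> [i|N]; first by have [] := (svalP (rec i.+1)).1 i.
move=> s Hs; apply: (svalP (rec N)).2 => x xs; have [ok rx] := Hs x xs.
split=> //; case: x rx ok {xs} => [[[n m] w] a] /= rx [H1 H2 H3]; split=> //.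
by rewrite recE.
Qed.

Definition small (delta : nat -> R) (k : nat) (h : H) : Prop := exists s,
  [/\ forall x, List.In x s -> factor_ok delta x,
      \sum_(x <- s) factor_size x <= 2^-1 ^+ k & h = factors_eval s].

Lemma small_exists : exists delta : nat -> R,
  (forall i, 0 < delta i) /\ forall h, small delta 0 h -> W h.
Proof.
have [delta [d0 Hb]] := bounded_products_exists; exists delta; split=> // h [s [ok S1 ->]].
pose N := (\max_(x <- s) factor_rank x).+1.
apply: (Hb N); last by rewrite expr0 in S1.
move=> x xs; split; first exact: ok.
rewrite /N ltnS; elim: s xs {ok S1 N} => //= y s IH [->|/IH le]; rewrite big_cons.
  exact: leq_maxl.
exact: leq_trans le (leq_maxr _ _).
Qed.

Section SmallSets.
Variable delta : nat -> R.
Hypothesis delta0 : forall i, 0 < delta i.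

Lemma small1 k : small delta k 1%g.
Proof. by exists [::]; split=> //; rewrite big_nil exprn_ge0 // invr_ge0. Qed.

Lemma smallM k x y : small delta k.+1 x -> small delta k.+1 y -> small delta k (x * y)%g.
Proof.
move=> [s [sok s1 ->]] [t [tok t1 ->]]; exists (s ++ t); split.
- by move=> z /List_In_cat [/sok|/tok].
- rewrite big_cat /=; apply: le_trans (lerD s1 t1) _.
  have E : 2^-1 + 2^-1 = 1 :> R by lra.
  by rewrite exprS -mulrDl E mul1r.
- by rewrite /factors_eval map_cat flatten_cat word_eval_cat.
Qed.

Definition factor_inv (x : factor) : factor :=
  let: (n, m, w, a) := x in (n, m, w, letter_inv a).

Lemma smallV k x : small delta k x -> small delta k x^-1%g.
Proof.
move=> [s [ok s1 ->]]; exists (rev (map factor_inv s)).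
have inE (z : factor) : List.In z (rev (map factor_inv s)) ->
    exists2 y, List.In y s & z = factor_inv y.
  elim: s {ok s1} => //= y s IH; rewrite rev_cons -cats1.
  by move=> /List_In_cat [/IH [y' ? ->]|/= [<-|//]]; [exists y'; auto|exists y; auto].
split.
- move=> z /inE [y ys ->]; have := ok y ys.
  by case: y {ys} => [[[n m] w] a].
- rewrite big_rev big_map; apply: le_trans s1; apply: ler_sum => y _.
  by case: y => [[[n m] w] a].
elim: s {ok s1 inE} => /= [|y s IH]; first by rewrite invg1.
rewrite rev_cons -cats1 factors_eval_cons invgM IH.
rewrite /factors_eval map_cat flatten_cat word_eval_cat; congr (_ * _)%g.
rewrite /= cats0; case: y => [[[n m] w] a] /=.
by rewrite !word_eval_cat /= !word_invE letter_invE !invgM invgK mulgA.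
Qed.

Lemma small_letter k l b (z : C) : modulus z <= delta k ->
  small delta k (letter_val (l, b, z)).
Proof.
move=> Hz; exists [:: (k, 0%N, [::], (l, b, z))]; split.
- by move=> x [<-|//]; rewrite /= addn0.
- by rewrite big_seq1.
by rewrite /factors_eval /= mulg1.
Qed.

(** Conjugation lengthens each conjugating word by at most [p]. Trading [p] units of level for [p]
    units of length keeps the rank, hence the bound [delta (n + m)], and multiplies sizes by
    [2^p]. *)
Lemma small_conj p w : (size w <= p)%N -> (forall b, List.In b w -> dom p b.2) ->
  forall k x, small delta (k + p) x ->
  small delta k (word_eval w * x * (word_eval w)^-1)%g.
Proof.
move=> sw dw k x [s [ok s1 ->]].
pose h (y : factor) : factor := let: (n, m, v, a) := y in ((n - p)%N, (m + p)%N, w ++ v, a).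
(* A single term is bounded by the total [2^-(k+p)], so every level is at least [k + p] and the
   truncated subtraction [n - p] is exact. *)
have lev y : List.In y s -> (p <= factor_level y)%N.
  move=> ys; have : factor_size y <= 2^-1 ^+ (k + p).
    apply: le_trans s1; elim: s ys {ok} => //= z s IH [->|/IH le]; rewrite big_cons.
      by rewrite lerDl sumr_ge0 // => z' _; rewrite exprn_ge0 // invr_ge0.
    by apply: le_trans le _; rewrite lerDr exprn_ge0 // invr_ge0.
  rewrite /factor_size => le; apply: leq_trans (leq_addl k p) _.
  rewrite leqNgt; apply/negP => lt.
  have : 2^-1 ^+ (k + p) < 2^-1 ^+ factor_level y :> R.
    rewrite ltr_iXn2l ?invr_gt0 ?ltr0n // invf_lt1 ?ltr0n // ltr1n //.
  by rewrite ltNge le.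
exists (map h s); split.
- elim: s lev ok {s1} => //= y s IH lev ok x0 [<-|]; last first.
    by apply: IH => z zs; [apply: lev; right|apply: ok; right].
  have := lev y (or_introl erefl); have := ok y (or_introl erefl).
  case: y {lev ok IH} => [[[n m] v] a] /= [H1 H2 H3] pn; split.
  + by rewrite size_cat addnC leq_add.
  + move=> b /List_In_cat [/dw|/H2]; apply: domS; first exact: leq_addl.
    exact: leq_addr.
  have -> : (n - p + (m + p) = n + m)%N by rewrite addnCA subnK // addnC.
  exact: H3.
- have two0 : 2 != 0 :> R by rewrite pnatr_eq0.
  have E : \sum_(y <- map h s) factor_size y = 2 ^+ p * \sum_(y <- s) factor_size y.
    elim: s lev {ok s1} => /= [|y s IH] lev; first by rewrite !big_nil mulr0.
    rewrite !big_cons IH; last by move=> z zs; apply: lev; right.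
    rewrite mulrDr; congr (_ + _); have := lev y (or_introl erefl).
    case: y {lev IH} => [[[n m] v] a] /= pn; rewrite /factor_size /=.
    rewrite -{2}(subnK pn) exprD mulrCA -exprMn mulfV // expr1n mulr1.
    by [].
  rewrite E; apply: le_trans (ler_wpM2l _ s1) _; first by rewrite exprn_ge0.
  by rewrite exprD mulrCA -exprMn mulfV // expr1n mulr1.
elim: s {ok s1 lev} => /= [|y s IH].
  by rewrite /factors_eval /= mulg1 mulgV.
rewrite !factors_eval_cons -IH.
case: y => [[[n m] v] a] /=; rewrite !word_eval_cat /= !word_invE !word_eval_cat invgM.
by rewrite -!mulgA mulKg.
Qed.

End SmallSets.
End SmallProducts.

(** * Group topologies on the Kac-Moody group *)

Section Powers.
Variables (K : numFieldType) (T : Type) (F : set_system T).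
Hypothesis FF : Filter F.
Local Open Scope classical_set_scope.

Lemma cvg_exprn (z : T -> K) (l : K) p : z @ F --> l ->
  (fun q => z q ^+ p) @ F --> (l ^+ p : K).
Proof.
move=> zl; elim: p => [|p IH].
  rewrite expr0; under eq_fun do rewrite expr0; exact: cvg_cst.
rewrite exprS; under eq_fun do rewrite exprS.
by apply: cvgM; [exact: zl|exact: IH].
Qed.

Lemma cvg_exprz (z : T -> K) (l : K) (p : int) : l != 0 -> z @ F --> l ->
  (fun q => z q ^ p) @ F --> (l ^ p : K).
Proof.
move=> l0 zl; case: p => p; first exact: cvg_exprn.
by apply: cvgV; [exact: expf_neq0|exact: cvg_exprn].
Qed.

End Powers.

Section AdjointTopology.
Variables (R : realType) (n : nat) (A : 'M[int]_n) (D : root_datum A).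
Variables (g : kac_moody_algebra D R[i]) (G : tits_functor g).
Hypothesis hcartan : generalized_cartan A.
Local Notation K := (R[i] : numFieldType).
Local Notation C := (Num.NumField.sort K).
Local Notation m := (lattice_rank A).
Local Notation der := (@derived_algebra R[i] g).
Local Open Scope classical_set_scope.
Variable Ad : G R[i] -> g -> g.
Hypothesis HAd : is_adjoint Ad.

Definition torus_unit_vector (F : comUnitRingType) (q : 'I_m) (a : F) : 'rV[F]_m :=
  \row_p if p == q then a else 1.

Lemma torus_unit_vector_torus (F : comUnitRingType) (q : 'I_m) (a : F) :
  a \is a GRing.unit -> torus (torus_unit_vector q a).
Proof. by move=> Ha p; rewrite mxE; case: ifP => _ //; exact: unitr1. Qed.

Lemma torus_eval_unit_vector (F : fieldType) (q : 'I_m) (a : F) lam :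
  torus_eval (torus_unit_vector q a) lam = a ^ lam 0 q.
Proof.
rewrite /torus_eval (bigD1 q) //= mxE eqxx big1 ?mulr1 // => p /negPf pq.
by rewrite mxE pq exp1rz.
Qed.

Definition letters : finType := (bool * 'I_n + 'I_m)%type.

Definition letter_elt (l : letters) (z : C) : G R[i] :=
  match l with
  | inl (b, i) => x_gen G b i (z : R[i])
  | inr q => td_eta G (torus_unit_vector q (1 + z : R[i]))
  end.

Lemma letter_elt0 l : letter_elt l 0 = 1%g.
Proof.
case: l => [[b i]|q] /=; first exact: (@x_gen0 _ _ _ _ _ G K).
rewrite -(@eta1 _ _ _ _ _ G K); congr td_eta; apply/rowP => p; rewrite !mxE addr0.
by case: ifP.
Qed.

Lemma Ad_endo u : derived_endo (Ad u).
Proof. split; [exact: ad_stable|exact: ad_linear|exact: ad_bracket]. Qed.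

Lemma AdK u x : der x -> Ad u^-1%g (Ad u x) = x.
Proof. by move=> dx; rewrite -(ad_mul HAd) // mulVg (ad_one HAd). Qed.

Definition involution_free (u : G R[i]) : Prop :=
  (forall x, der x -> Ad (u * u)%g x = x) -> forall x, der x -> Ad u x = x.

Section Limits.
Variables (U : set_system nat) (UU : UltraFilter U).

Lemma fconv_exp_ad b i b' j (z : nat -> C) (l : C) : z @ U --> l ->
  fconv U (fun q => exp_ad (z q *: gen g b i) (gen g b' j))
    (exp_ad (l *: gen g b i) (gen g b' j)).
Proof.
move=> zl; have [N EN] := exp_ad_gen g b i b' j.
have dit p : der (iter p (bracket (gen g b i)) (gen g b' j)).
  by case: p => [|p]; [exact: derived_gen|exact: derived_bracket].
rewrite EN; have := fconvD UU (fconv_cst UU (derived_gen g hcartan b' j))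
  (@fconv_sum _ _ _ _ _ _ UU 'I_(N.+1)
     (fun p q => (((lift ord0 p)`!%:R)^-1 * z q ^+ lift ord0 p) *:
        iter (lift ord0 p) (bracket (gen g b i)) (gen g b' j))
     (fun p => (((lift ord0 p)`!%:R)^-1 * l ^+ lift ord0 p) *:
        iter (lift ord0 p) (bracket (gen g b i)) (gen g b' j)) _).
have E (x : C) : \sum_(1 <= p < N.+2)
    ((p`!%:R)^-1 * x ^+ p) *: iter p (bracket (gen g b i)) (gen g b' j)
  = \sum_(p < N.+1) (((lift ord0 p)`!%:R)^-1 * x ^+ lift ord0 p) *:
        iter (lift ord0 p) (bracket (gen g b i)) (gen g b' j).
  by rewrite big_add1 big_mkord; apply: eq_bigr => p _; rewrite lift0.
rewrite E => H; apply: fconv_eq (H _) _; last first.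
  by apply: filterE => q /=; rewrite EN E.
move=> p; apply: (@fconv_scale _ _ _ _ _ _ UU
  (fun q => ((lift ord0 p)`!%:R)^-1 * z q ^+ lift ord0 p)); first exact: dit.
by apply: cvgM; [exact: cvg_cst|exact: cvg_exprn].
Qed.

Lemma fconv_letter p (a : letter R letters) v :
  letter_conv U p a -> 1 + a.2 != 0 -> der v ->
  fconv U (fun q => Ad (letter_val letter_elt (p q)) v) (Ad (letter_val letter_elt a) v).
Proof.
move=> [U1 U2] a0; have dF q := Ad_endo (letter_val letter_elt (p q)).
have dF0 := Ad_endo (letter_val letter_elt a).
move: v; apply: (derived_ind hcartan).
- move=> c x y dx dy Hx Hy; rewrite (de_linear dF0) //.
  have H1 : (fun=> c : C) @ U --> (c : C) by exact: cvg_cst.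
  apply: fconv_eq (fconvD UU (fconv_scaler UU H1 Hx) Hy) _.
  by apply: filterE => q /=; rewrite (de_linear (dF q)).
- move=> x y dx dy Hx Hy; rewrite (de_bracket dF0) //.
  apply: fconv_eq (fconv_bracket UU Hx Hy) _.
  by apply: filterE => q /=; rewrite (de_bracket (dF q)).
- rewrite endo0 //; apply: fconv_eq (fconv_cst UU (linc0 (derived_lin_closed g))) _.
  by apply: filterE => q /=; rewrite endo0.
move=> b' i'; have dg := derived_gen g hcartan b' i'.
case: a U1 U2 a0 {dF0} => [[l s] z] /= U1 U2 a0.
pose zq q : C := (p q).2.
suff : fconv U (fun q => Ad (letter_val letter_elt (l, s, zq q)) (gen g b' i'))
    (Ad (letter_val letter_elt (l, s, z)) (gen g b' i')).
  move/fconv_eq; apply; move: U1; apply: filterS => q /=; rewrite /zq.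
  by case: (p q) => x y /= ->.
case: l {U1} => [[b i]|j]; rewrite /letter_val /=.
  have Ex (x : C) : Ad (x_gen G b i (x : R[i])) (gen g b' i') = exp_ad (x *: gen g b i) (gen g b' i').
    rewrite /x_gen /x_pos /x_neg; case: b; first exact: (ad_upper HAd).
    by rewrite (ad_lower HAd) // opprK.
  case: s; first by under eq_fun do rewrite Ex; rewrite Ex; exact: fconv_exp_ad.
  under eq_fun do rewrite -(@x_genN _ _ _ _ _ G K) Ex.
  rewrite -(@x_genN _ _ _ _ _ G K) Ex; apply: fconv_exp_ad.
  exact: cvgN.
pose e : int := ((-1) ^+ (~~ b') *: rd_c D i') 0 j.
have U3 : (fun q => 1 + zq q) @ U --> (1 + z : C).
  by apply: cvgD; [exact: cvg_cst|exact: U2].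
have Unz : U [set q | 1 + zq q != 0].
  move/cvg_modulusP: U3 => /(_ (modulus (1 + z))).
  rewrite lt_def modulus_eq0 a0 modulus_ge0 => /(_ isT).
  apply: filterS => q /=; apply: contraTneq => ->.
  by rewrite subr0 ltxx.
have Et (x : C) : 1 + x != 0 ->
    Ad (td_eta G (torus_unit_vector j (1 + x : R[i]))) (gen g b' i') = (1 + x) ^ e *: gen g b' i'.
  move=> x0; have T : torus (torus_unit_vector j (1 + x : R[i])).
    by apply: torus_unit_vector_torus; rewrite unitfE.
  rewrite -torus_eval_unit_vector; case: b' {dg} @e => /=; rewrite /gen ?expr0 ?scale1r ?expr1 ?scaleN1r.
    exact: (ad_torus_e HAd).
  exact: (ad_torus_f HAd).
have Et' (x : C) : 1 + x != 0 ->
    Ad (td_eta G (torus_unit_vector j (1 + x : R[i])))^-1%g (gen g b' i')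
    = (1 + x) ^ (- e) *: gen g b' i'.
  move=> x0; have d0 : der 0 by exact: linc0 (derived_lin_closed g).
  set u := td_eta _ _; have xe : (1 + x) ^ e != 0 by exact: expfz_neq0.
  have := AdK u dg; rewrite Et // => H.
  have := de_linear (Ad_endo u^-1%g) ((1 + x) ^ e) dg d0.
  rewrite addr0 endo0 ?addr0 //; last exact: Ad_endo.
  rewrite H => /(congr1 (fun y => ((1 + x) ^ e)^-1 *: y)).
  by rewrite scalerA mulVf // scale1r invr_expz => ->.
case: s.
  rewrite Et //; have H := fconv_scale UU dg (@cvg_exprz K nat U (@ultra_proper _ _ UU) _ _ e a0 U3).
  apply: fconv_eq H _.
  by move: Unz; apply: filterS => q /= H; rewrite Et.
rewrite Et' //; apply: fconv_eq (fconv_scale UU dg (@cvg_exprz K nat U (@ultra_proper _ _ UU) _ _ (- e) a0 U3)) _.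
by move: Unz; apply: filterS => q /= H; rewrite Et'.
Qed.

Lemma fconv_word w (l : seq (letter R letters)) :
  lconv U (letter_conv U) w l -> (forall a, List.In a l -> 1 + a.2 != 0) ->
  forall v, der v -> fconv U (fun q => Ad (word_eval letter_elt (w q)) v)
    (Ad (word_eval letter_elt l) v).
Proof.
elim: l w => [|a l IH] w /=.
  move=> E _ v dv; apply: fconv_eq (fconv_cst UU (de_stable (Ad_endo 1%g) dv)) _.
  by move: E; apply: filterS => q /= ->.
move=> [p [w' [E pa wl]]] Hl v dv.
have Ha := Hl a (or_introl erefl).
have Hw := IH w' wl (fun b Hb => Hl b (or_intror Hb)) v dv.
rewrite (ad_mul HAd) //.
have := fconv_map UU (fun q => Ad_endo (letter_val letter_elt (p q)))
  (Ad_endo (letter_val letter_elt a)) (fun v dv => fconv_letter pa Ha dv) Hw.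
move/fconv_eq; apply; move: E; apply: filterS => q /= ->.
by rewrite /= (ad_mul HAd).
Qed.

Lemma involution_free_open w (l : seq (letter R letters)) :
  lconv U (letter_conv U) w l -> (forall a, List.In a l -> 1 + a.2 != 0) ->
  involution_free (word_eval letter_elt l) ->
  U [set q | involution_free (word_eval letter_elt (w q))].
Proof.
move=> wl Hl free.
have [//|Un] := in_ultra_setVsetC [set q | involution_free (word_eval letter_elt (w q))] UU.
exfalso; pose F q := Ad (word_eval letter_elt (w q)); pose F0 := Ad (word_eval letter_elt l).
have eF q : derived_endo (F q) := Ad_endo _.
have eF0 : derived_endo F0 := Ad_endo _.
have cF v : der v -> fconv U (fun q => F q v) (F0 v) by exact: fconv_word.
have U2 : U [set q | forall x, der x -> F q (F q x) = x].
  move: Un; apply: filterS => q /= nfree x dx; apply: contrapT => H.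
  by apply: nfree => sq; case: H; rewrite /F -(ad_mul HAd) // sq.
(* There are finitely many generators, so one of them is moved by [F q] for almost all [q] at
   once. *)
have Ugen : exists b i, U [set q | F q (gen g b i) != gen g b i].
  apply: contrapT => H.
  have Hall bi : U [set q | F q (gen g bi.1 bi.2) = gen g bi.1 bi.2].
    have [//|Ubi] := in_ultra_setVsetC [set q | F q (gen g bi.1 bi.2) = gen g bi.1 bi.2] UU.
    case: H; exists bi.1, bi.2; move: Ubi; apply: filterS => q /= nE.
    exact/eqP.
  have Hf : U [set q | forall bi : bool * 'I_n, F q (gen g bi.1 bi.2) = gen g bi.1 bi.2].
    exact: (@filter_forall _ _ (fun bi => [set q | F q (gen g bi.1 bi.2) = gen g bi.1 bi.2])).
  have [q [/= nfree Hq]] := filter_ex (filterI Un Hf).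
  apply: nfree => _; apply: (derived_ind (P := fun x => F q x = x) hcartan).
  - by move=> a x y dx dy Hx Hy; rewrite (de_linear (eF q)) // Hx Hy.
  - by move=> x y dx dy Hx Hy; rewrite (de_bracket (eF q)) // Hx Hy.
  - by rewrite endo0.
  - by move=> b i; exact: (Hq (b, i)).
case: Ugen => b [i Ubi]; have dg := derived_gen g hcartan b i.
have F00 x : der x -> F0 (F0 x) = x.
  move=> dx; have Hx := fconv_map UU eF eF0 cF (cF x dx).
  have H1 : (fun=> -1 : C) @ U --> (-1 : C) by exact: cvg_cst.
  have E := fconv_unique0 UU (fconvD UU Hx (fconv_scaler UU H1 (fconv_cst UU dx))).
  apply/eqP; rewrite -subr_eq0; apply/eqP.
  rewrite -scaleN1r; apply: E; move: U2; apply: filterS => q /= ->//.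
  by rewrite scaleN1r subrr.
have F0id x : der x -> F0 x = x.
  by apply: free => {}x dx; rewrite (ad_mul HAd) //; exact: F00.
have H1 : (fun=> -1 : C) @ U --> (-1 : C) by exact: cvg_cst.
have Hy := fconvD UU (fconv_cst UU dg) (fconv_scaler UU H1 (cF _ dg)).
have [c [l' [Hl' l'0]]] : exists (c : nat -> C) l',
    fconv U (fun q => c q *: (gen g b i + -1 *: F q (gen g b i))) l' /\ l' != 0.
  apply: (fconv_normalize UU Hy); move: Ubi; apply: filterS => q /=.
  by rewrite scaleN1r subr_eq0 eq_sym.
have dl' := fconv_der Hl'.
have Z := fconv_unique0 UU (fconvD UU Hl' (fconv_map UU eF eF0 cF Hl')).
rewrite F0id // in Z; move: l'0; apply/negP; rewrite negbK.
have two0 : 2 != 0 :> R[i] by rewrite pnatr_eq0.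
suff : (2 : R[i]) *: l' = 0 by move/eqP; rewrite scaler_eq0 (negPf two0).
rewrite scaler_nat mulr2n; apply: Z.
move: U2; apply: filterS => q /= sq.
have d0 : der 0 by exact: linc0 (derived_lin_closed g).
have dFg : der (F q (gen g b i)) by exact: (de_stable (eF q)).
have dy : der (gen g b i + -1 *: F q (gen g b i)).
  by apply: (lincD (derived_lin_closed g)) => //; exact: (lincZ (derived_lin_closed g)).
(* As [F q] is an involution, it negates [x - F q x] and its multiples; in the limit, [F0 = id] then
   forces [2 l' = 0]. *)
have -> : F q (c q *: (gen g b i + -1 *: F q (gen g b i)))
    = c q *: F q (gen g b i + -1 *: F q (gen g b i)).
  by have := de_linear (eF q) (c q) dy d0; rewrite addr0 endo0 // addr0.
have -> : F q (gen g b i + -1 *: F q (gen g b i)) = F q (gen g b i) - gen g b i.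
  by rewrite addrC (de_linear (eF q)) // sq // scaleN1r addrC.
by rewrite -scalerDr scaleN1r -[X in _ + X]opprB subrr scaler0.
Qed.

End Limits.
End AdjointTopology.

(** * Group topologies from a neighbourhood filter *)

Section GroupFilter.
Variables (H : groupType) (N : nat -> H -> Prop).
Local Open Scope classical_set_scope.

(** A neighbourhood basis of 1, indexed so that multiplication costs one step. Conjugation by [x]
    costs a shift uniform in [k], as [small_conj] provides. *)
Record group_filter : Prop := GroupFilterBase {
  gfb1 : forall k, N k 1%g;
  gfbM : forall k x y, N k.+1 x -> N k.+1 y -> N k (x * y)%g;
  gfbV : forall k x, N k x -> N k x^-1%g;
  gfbJ : forall x, exists p, forall k y, N (k + p)%N y -> N k (x * y * x^-1)%g }.

Definition filter_open (O : set H) : Prop :=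
  forall x, O x -> exists k, forall y, N k y -> O (x * y)%g.

Hypothesis HN : group_filter.

Lemma gfb_anti k l x : (k <= l)%N -> N l x -> N k x.
Proof.
move=> /subnKC <-; elim: (l - k)%N => [|d IH]; rewrite ?addn0 // addnS => Hx.
by apply: IH; rewrite -[x]mulg1; apply: (gfbM HN) => //; exact: (gfb1 HN).
Qed.

Lemma filter_openT : filter_open setT. Proof. by move=> x _; exists 0%N. Qed.

Lemma filter_openI : setI_closed filter_open.
Proof.
move=> O O' HO HO' x [/HO [k Hk] /HO' [l Hl]].
exists (maxn k l) => y Hy; split; [apply: Hk|apply: Hl].
  by apply: gfb_anti Hy; exact: leq_maxl.
by apply: gfb_anti Hy; exact: leq_maxr.
Qed.

Lemma filter_open_bigcup (I : Type) (f : I -> set H) :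
  (forall i, filter_open (f i)) -> filter_open (\bigcup_i f i).
Proof.
move=> Hf x [i _ fx]; have [k Hk] := Hf i x fx.
by exists k => y Hy; exists i => //; exact: Hk.
Qed.

Definition filter_group (_ : group_filter) : Type := H.
HB.instance Definition _ := Choice.copy (filter_group HN) H.
HB.instance Definition _ := isOpenTopological.Build (filter_group HN)
  filter_openT filter_openI filter_open_bigcup.

Definition filter_topology : Topological H := Topological.class (filter_group HN).
Local Notation TH := (Topological.Pack filter_topology).

(** The sets [N k] need not be open; the points around which a translate of some [N l] still fits
    form their interior. *)
Lemma filter_interior k x : filter_open [set y | exists l, forall z, N l z -> N k (x^-1 * (y * z))%g].
Proof.
move=> y [l Hl]; exists l.+1 => z Hz; exists l.+1 => z' Hz'.
by rewrite -(mulgA y); apply: Hl; exact: (gfbM HN).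
Qed.

Lemma nbhs_filter_groupP (x : TH) (O : set TH) :
  nbhs x O <-> exists k, forall y, N k y -> O ((x : H) * y)%g.
Proof.
rewrite nbhsE; split.
  move=> [B [oB Bx] BO]; have [k Hk] := oB x Bx.
  by exists k => y /Hk /BO.
move=> [k Hk]; exists [set y | exists l, forall z, N l z -> N k ((x : H)^-1 * (y * z))%g].
  split; first exact: filter_interior.
  by exists k => z; rewrite mulKg.
move=> y [l /(_ 1%g (gfb1 HN l))]; rewrite mulg1 => /Hk.
by rewrite mulVKg.
Qed.

Lemma filter_group_topology : is_group_topology filter_topology.
Proof.
split.
  move=> [x y] O /= /nbhs_filter_groupP [k Hk].
  have [p Hp] := gfbJ HN (y : H)^-1%g.
  exists ([set u | N (k.+1 + p)%N ((x : H)^-1 * u)%g], [set v | N k.+1 ((y : H)^-1 * v)%g]).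
    by split; apply/nbhs_filter_groupP; [exists (k.+1 + p)%N|exists k.+1] => z /=; rewrite mulKg.
  move=> [u v] /= [Hu Hv].
  have := Hk _ (gfbM HN (Hp _ _ Hu) Hv).
  by rewrite /= invgK -!mulgA mulVKg mulVKg mulVKg.
move=> x O /nbhs_filter_groupP [k Hk].
have [p Hp] := gfbJ HN (x : H).
apply/nbhs_filter_groupP; exists (k + p)%N => y Hy.
have := Hk _ (Hp _ _ (gfbV HN Hy)).
by rewrite /= -!mulgA mulKg -invgM.
Qed.

End GroupFilter.

(** Every admissible group topology is coarser than the final one, so the interior of [N k] belongs
    to the subbase. *)
Lemma nbhs_final_group (H : groupType) (adm : Topological H -> Prop)
    (N : nat -> H -> Prop) (HN : group_filter N) : adm (filter_topology HN) ->
  forall k, nbhs (1%g : final_group adm) [set x | N k x]%classic.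
Proof.
move=> Hadm k; rewrite nbhsE.
exists [set y | exists l, forall z, N l z -> N k ((1%g : H)^-1 * (y * z))%g]%classic.
  split; last by exists k => z; rewrite mulKg.
  rewrite /open /=.
  exists [set [set y | exists l, forall z, N l z -> N k ((1%g : H)^-1 * (y * z))%g]]%classic; last by rewrite bigcup_set1.
  move=> _ ->; apply: finI_from1.
  exists (filter_topology HN); split=> //; first exact: filter_group_topology.
  exact: filter_interior.
move=> y [l /(_ 1%g (gfb1 HN l))].
by rewrite mulg1 invg1 mul1g.
Qed.

Section Generation.
Variables (R : realType) (n : nat) (A : 'M[int]_n) (D : root_datum A).
Variables (g : kac_moody_algebra D R[i]) (G : tits_functor g).
Local Notation C := (Num.NumField.sort (R[i] : numFieldType)).
Local Notation m := (lattice_rank A).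

Lemma eta_unit_vectors (K : numFieldType) (t : 'rV[K]_m) : torus t ->
  td_eta G t = foldr (fun q x => td_eta G (torus_unit_vector q (t 0 q)) * x)%g
    1%g (enum 'I_m).
Proof.
move=> Ht; pose r (s : seq 'I_m) : 'rV[K]_m := \row_q if q \in s then t 0 q else 1.
have Hr s : torus (r s) by move=> q; rewrite mxE; case: ifP => _; [exact: Ht|exact: unitr1].
have {1}-> : t = r (enum 'I_m) by apply/rowP => q; rewrite mxE mem_enum.
elim: (enum 'I_m) (enum_uniq 'I_m) => /= [|q s IH].
  move=> _; rewrite -(@eta1 _ _ _ _ _ G K); congr td_eta.
  by apply/rowP => q; rewrite !mxE.
move=> /andP[qs us]; rewrite -IH // -td_etaM //; last exact: torus_unit_vector_torus.
congr td_eta; apply/rowP => p; rewrite !mxE in_cons.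
have [->|pq] := eqVneq p q; first by rewrite (negPf qs) mulr1.
by rewrite mul1r.
Qed.

Lemma gf_mapV (S S' : comUnitRingType) (f : {rmorphism S -> S'}) (x : G S) :
  gf_map G f x^-1%g = ((gf_map G f x)^-1)%g.
Proof. by apply: (@mulgI _ (gf_map G f x)); rewrite -gf_mapM !mulgV gf_map1. Qed.

Lemma word_generated (u : G R[i]) : exists2 w : seq (letter R (letters A)),
  forall a, List.In a w -> 1 + a.2 != 0 & word_eval (letter_elt G) w = u.
Proof.
pose S : set (G R[i]) := [set u | exists2 w : seq (letter R _),
  forall a, List.In a w -> 1 + a.2 != 0 & word_eval (letter_elt G) w = u]%classic.
have SM x y : S x -> S y -> S (x * y)%g.
  move=> [w Hw <-] [w' Hw' <-]; exists (w ++ w'); last exact: word_eval_cat.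
  by move=> a /List_In_cat [/Hw|/Hw'].
have SV x : S x -> S x^-1%g.
  move=> [w Hw <-]; exists (word_inv w); last exact: word_invE.
  elim: w Hw => //= a w IH Hw b; rewrite /word_inv /= rev_cons -cats1.
  move=> /List_In_cat [|/= [<-|//]]; last exact: (Hw a (or_introl erefl)).
  by apply: IH => c Hc; apply: Hw; right.
have SL l b (z : C) : 1 + z != 0 -> S (letter_val (letter_elt G) (l, b, z)).
  by move=> z0; exists [:: (l, b, z)]; [move=> a [<-|//]|rewrite /= mulg1].
have S1 : S 1%g by exists [::].
have Sx b i (z : R[i]) : S (x_gen G b i z).
  have [z1|z0] := eqVneq (1 + z) 0; last exact: (SL (inl (b, i)) true).
  (* The parameter -1 is excluded for all letters alike; the root element with this parameter is the
     inverse of the one with parameter 1. *)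
  have -> : z = - 1 by apply/eqP; rewrite -addr_eq0 addrC z1.
  rewrite (@x_genN _ _ _ _ _ G (R[i] : numFieldType)).
  apply: (SL (inl (b, i)) false 1).
  by rewrite -[1 + 1]/(2%:R) pnatr_eq0.
have H := @tf_generated _ _ _ _ _ G (R[i] : fieldType) u.
apply: (H S); first by split=> // x y Sx' Sy; apply: SM => //; exact: SV.
move=> _ [[i [M [HM ->]]]|[t Ht ->]].
  move: M HM; apply: (SL2_ind (P := fun M => S (td_phi G i M))) => [r|r|M N HM HN SM1 SN].
  - exact: Sx true i r.
  - rewrite (@phi_lower _ _ _ _ _ G (R[i] : numFieldType)); exact: Sx false i (- r).
  - by rewrite td_phiM //; exact: SM.
rewrite (@eta_unit_vectors (R[i] : numFieldType)) //.
elim: (enum _) => //= q s IH; apply: SM => //.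
have := SL (inr q) true (t 0 q - 1); rewrite /letter_val /= addrC subrK; apply.
by have := Ht q; rewrite unitfE.
Qed.

Lemma dom_exists (z : C) : 1 + z != 0 -> exists p, dom p z.
Proof.
move=> z0; have c0 : 0 < modulus (1 + z) by rewrite lt_def modulus_eq0 z0 modulus_ge0.
pose p := Num.bound (modulus z); pose q := Num.bound (modulus (1 + z))^-1.
exists (maxn p q); split.
  apply: le_trans (ltW (archi_boundP (modulus_ge0 z))) _.
  by rewrite ler_nat -/p (leq_trans (leq_maxl p q)).
rewrite -[leRHS]invrK lef_pV2 ?posrE ?invr_gt0 ?ltr0n //.
apply: le_trans (ltW (archi_boundP _)) _; first by rewrite invr_ge0 ltW.
by rewrite ler_nat -/q (leq_trans (leq_maxr p q)).
Qed.

Lemma word_dom_exists (L : finType) (w : seq (letter R L)) :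
  (forall a, List.In a w -> 1 + a.2 != 0) ->
  exists2 p, (size w <= p)%N & forall a, List.In a w -> dom p a.2.
Proof.
elim: w => [|a w IH] Hw; first by exists 0%N.
have [q Hq] := dom_exists (Hw a (or_introl erefl)).
have [|p sp Hp] := IH; first by move=> b Hb; apply: Hw; right.
exists (maxn p.+1 q) => /=; first by rewrite leq_max ltnS sp.
move=> b [<-|/Hp Hb]; first by apply: domS Hq; exact: leq_maxr.
by apply: domS Hb; rewrite leq_max leqnSn.
Qed.

End Generation.

Section Admissibility.
Variables (R : realType) (n : nat) (A : 'M[int]_n) (D : root_datum A).
Variables (g : kac_moody_algebra D R[i]) (G : tits_functor g).
Variables (K : numFieldType) (j : {rmorphism K -> R[i]}).
Local Notation C := (Num.NumField.sort (R[i] : numFieldType)).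
Local Notation m := (lattice_rank A).
Local Open Scope classical_set_scope.
Hypothesis j_small : forall e : R, 0 < e -> \forall r \near (0 : K), modulus (j r : C) <= e.
Variable delta : nat -> R.
Hypothesis delta0 : forall k, 0 < delta k.

(** Smallness is defined in the complex group and pulled back along [j], so that one construction of
    bounds serves both fields. *)
Definition pulled_small (k : nat) (u : G K) : Prop :=
  small (letter_elt G) delta k (gf_map G j u).

Lemma pulled_small_group_filter : group_filter pulled_small.
Proof.
rewrite /pulled_small; split=> [k|k x y|k x|x].
- by rewrite gf_map1; exact: small1.
- by rewrite gf_mapM; exact: smallM.
- by rewrite gf_mapV; exact: smallV.
have [w Hw Ew] := word_generated (gf_map G j x).
have [p sp Hp] := word_dom_exists Hw.
exists p => k y /(small_conj sp Hp); rewrite Ew.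
by rewrite !gf_mapM gf_mapV.
Qed.

Lemma pulled_small_x k b i (r : K) : modulus (j r : C) <= delta k ->
  pulled_small k (x_gen G b i r).
Proof.
by move=> Hr; rewrite /pulled_small gf_map_x; exact: (@small_letter _ _ _ (letter_elt G) delta k (inl (b, i)) true).
Qed.

(** Each multiplication costs one index, hence the shift by the number of factors. *)
Lemma pulled_small_prod k (T : Type) (s : seq T) (f : T -> G K) :
  (forall q, pulled_small (k + size s)%N (f q)) ->
  pulled_small k (foldr (fun q x => f q * x)%g 1%g s).
Proof.
elim: s k => /= [|q s IH] k Hf; first exact: (gfb1 pulled_small_group_filter).
apply: (gfbM pulled_small_group_filter).
  by apply: (gfb_anti pulled_small_group_filter) (Hf q); rewrite addnS ltnS leq_addr.
by apply: IH => q'; have := Hf q'; rewrite addSnnS.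
Qed.

Lemma pulled_small_eta k (t : 'rV[K]_m) : torus t ->
  (forall q, modulus (j (t 0 q - 1) : C) <= delta (k + m)) ->
  pulled_small k (td_eta G t).
Proof.
move=> Ht Hj; rewrite eta_unit_vectors //; apply: pulled_small_prod => q.
rewrite size_enum_ord /pulled_small td_eta_natural; last exact: torus_unit_vector_torus.
have := @small_letter _ _ _ (letter_elt G) delta (k + m) (inr q) true _ (Hj q).
rewrite /letter_val /= rmorphB rmorph1 addrC subrK.
congr small; congr td_eta; apply/rowP => p; rewrite !mxE.
by case: ifP => _ //; rewrite rmorph1.
Qed.

(** Near the identity a matrix is a lower, diagonal, upper product. The three factors account for
    [k.+2], and the [m] torus coordinates of the diagonal one for the further shift by [m]. *)
Lemma pulled_small_phi k i (a b c d : K) : SL2 (mx22 a b c d) -> a != 0 ->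
  modulus (j (b / a) : C) <= delta k.+2 -> modulus (j (- (c / a)) : C) <= delta k.+2 ->
  (forall q, modulus (j (a ^ rd_h D i q 0 - 1) : C) <= delta (k.+2 + m)) ->
  pulled_small k (td_phi G i (mx22 a b c d)).
Proof.
move=> /SL2_det E a0 Hb Hc Ha.
have -> : mx22 a b c d = mx22 1 0 (c / a) 1 *m mx22 a 0 0 a^-1 *m mx22 1 (b / a) 0 1.
  rewrite !mx22_mul; congr mx22; try by field.
  by apply: (mulfI a0); rewrite -[LHS](subrK (b * c)) E; field.
have S1 := @SL2_lower K (c / a); have S3 := @SL2_upper K (b / a).
have S2 : SL2 (mx22 a 0 0 a^-1) by apply: SL2_mx22; rewrite mulr0 subr0 mulfV.
have S12 := SL2_mul S1 S2.
rewrite td_phiM // td_phiM // tf_phi_diag ?unitfE // phi_lower.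
have GF := pulled_small_group_filter.
apply: (gfbM GF); last by apply: (gfb_anti GF) (leqnSn _) _; exact: (@pulled_small_x _ true).
apply: (gfbM GF); first exact: (@pulled_small_x _ false).
apply: pulled_small_eta; first by move=> q; rewrite mxE unitfE expfz_neq0.
by move=> q; rewrite mxE; exact: Ha.
Qed.

Lemma cvg_modulus_small (T : Type) (F : set_system T) (FF : Filter F) (u : T -> K) (l : K) (e : R) :
  u @ F --> l -> 0 < e -> F [set x | modulus (j (u x - l) : C) <= e].
Proof.
move=> ul e0; have ul0 : (fun x => u x - l) @ F --> (0 : K).
  by rewrite -(subrr l); apply: cvgB; [exact: ul|exact: cvg_cst].
exact: (ul0 _ (j_small e0)).
Qed.

Lemma eta_continuous : {within @torus m K, continuous
  (fun t : 'rV[K]_m => td_eta G t : Topological.Pack (filter_topology pulled_small_group_filter))}.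
Proof.
apply/subspace_continuousP => s Hs O /nbhs_filter_groupP [k Hk].
set F := within _ _; have FF : Filter F by exact: within_filter.
have Hq q : F [set t : 'rV[K]_m | modulus (j (t 0 q / s 0 q - 1) : C) <= delta (k + m)].
  have s0 : s 0 q != 0 by rewrite -unitfE; exact: Hs.
  rewrite -(mulfV s0); apply: cvg_modulus_small => //; apply: cvgM; last exact: cvg_cst.
  by apply: cvg_within_filter; exact: coord_continuous.
have U : F [set t : 'rV[K]_m | torus t] by exact: withinT.
change (F [set t | O (td_eta G t)]).
have V := @filterI _ F FF _ _ (filter_forall FF Hq) U.
apply: (@filterS _ F FF _ _ _ V) => t /= [Hj Ht].
have E : torus_mul s (\row_q (t 0 q / s 0 q)) = t.
  apply/rowP => q; rewrite !mxE mulrC divfK // -unitfE; exact: Hs.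
have Hr : torus (\row_q (t 0 q / s 0 q)) by move=> q; rewrite mxE unitrM unitrV Ht Hs.
rewrite -E td_etaM //; apply: Hk; apply: pulled_small_eta => // q.
rewrite mxE; exact: Hj.
Qed.

Lemma phi_continuous i : {within @SL2 K, continuous
  (fun M : 'M[K]_2 => td_phi G i M : Topological.Pack (filter_topology pulled_small_group_filter))}.
Proof.
apply/subspace_continuousP => M0 HM0 O /nbhs_filter_groupP [k Hk].
set F := within _ _; have FF : Filter F by exact: within_filter.
have U : F [set M : 'M[K]_2 | SL2 M] by exact: withinT.
have M0u : M0 \in unitmx by rewrite unitmxE [\det M0]HM0 unitr1.
(* The topology is invariant under left translations, so continuity at [M0] amounts to smallness of
   the image of [M0^-1 M]. *)
pose p p1 p2 (M : 'M[K]_2) := (invmx M0 *m M) p1 p2.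
have Hp p1 p2 : p p1 p2 @ F --> ((1%:M : 'M[K]_2) p1 p2 : K).
  rewrite -(mulVmx M0u).
  have E M : (invmx M0 *m M) p1 p2 = invmx M0 p1 0 * M 0 p2 + invmx M0 p1 1 * M 1 p2.
    rewrite mxE !big_ord_recl big_ord0 addr0.
    by have -> : lift ord0 ord0 = 1 :> 'I_2 by exact/val_inj.
  rewrite E /p; under eq_fun do rewrite E.
  have H p3 : (fun M : 'M[K]_2 => invmx M0 p1 p3 * M p3 p2) @ F --> (invmx M0 p1 p3 * M0 p3 p2 : K).
    apply: cvgM; first exact: cvg_cst.
    by apply: cvg_within_filter; exact: coord_continuous.
  by apply: cvgD; exact: H.
have Ha : p 0 0 @ F --> (1 : K) by have := Hp 0 0; rewrite mxE.
have Hb : p 0 1 @ F --> (0 : K) by have := Hp 0 1; rewrite mxE.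
have Hc : p 1 0 @ F --> (0 : K) by have := Hp 1 0; rewrite mxE.
have HaV : (fun M => (p 0 0 M)^-1) @ F --> (1 : K).
  by rewrite -invr1; apply: cvgV; [exact: oner_neq0|exact: Ha].
have U1 : F [set M | p 0 0 M != 0].
  by apply: (@cvgr_neq0 K K _ F FF _ 1); [exact: Ha|exact: oner_neq0].
have small_quotient (u : 'M[K]_2 -> K) : u @ F --> (0 : K) ->
    F [set M | modulus (j (u M / p 0 0 M) : C) <= delta k.+2].
  move=> Hu; have H : (fun M => u M / p 0 0 M) @ F --> (0 : K).
    by rewrite -(mul0r (1 : K)); apply: cvgM; [exact: Hu|exact: HaV].
  have := cvg_modulus_small FF H (delta0 k.+2).
  by apply: filterS => M /=; rewrite subr0.
have U2 := small_quotient _ Hb; have U3 := small_quotient _ Hc.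
have U4 q : F [set M | modulus (j (p 0 0 M ^ rd_h D i q 0 - 1) : C) <= delta (k.+2 + m)].
  apply: cvg_modulus_small => //; rewrite -(@exp1rz K (rd_h D i q 0)).
  apply: (cvg_exprz FF); [exact: oner_neq0|exact: Ha].
have V := @filterI _ F FF _ _ (@filterI _ F FF _ _ U U1)
  (@filterI _ F FF _ _ (@filterI _ F FF _ _ U2 U3) (filter_forall FF U4)).
change (F [set M | O (td_phi G i M)]); apply: (@filterS _ F FF _ _ _ V) => M /= [[HM M1] [[M2 M3] M4]].
have HP : SL2 (invmx M0 *m M).
  by apply: SL2_mul => //; rewrite /SL2 /= det_inv [\det M0]HM0 invr1.
rewrite -[M](mulKVmx M0u) td_phiM //; apply: Hk.
rewrite (mx22_eta (invmx M0 *m M)) in HP *.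
by apply: pulled_small_phi => //; rewrite rmorphN modulusN.
Qed.

Lemma nbhs_pulled_small k : nbhs (1%g : kac_peterson G K) [set u | pulled_small k u].
Proof.
apply: (@nbhs_final_group _ _ _ pulled_small_group_filter); split.
  exact: phi_continuous.
exact: eta_continuous.
Qed.

End Admissibility.

(** * Symmetric coset spaces *)

Section TopologicalGroups.
Local Open Scope classical_set_scope.

Definition topological_group (H : groupSpaceType) : Prop :=
  continuous (fun p : H * H => (p.1 * p.2)%g : H) /\
  continuous (fun x : H => (x^-1)%g : H).

Section FinalGroup.
Variables (H : groupType) (adm : Topological H -> Prop).
Local Notation FH := (final_group adm).

Lemma continuous_final_group (T : topologicalType) (f : T -> FH) :
  (forall U, final_subbase adm U -> open (f @^-1` U)) -> continuous f.
Proof.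
move=> Hf; apply/continuousP => _ [B HB <-].
rewrite preimage_bigcup; apply: bigcup_open => U /HB [s Hs <-].
rewrite preimage_bigcap openE => x Hx; apply: filter_bigI => V sV.
have /Hf : final_subbase adm V by have := Hs V sV; rewrite inE.
by rewrite openE; apply; exact: Hx.
Qed.

Lemma open_final_group (U : set FH) : final_subbase adm U -> open U.
Proof.
move=> HU; exists [set U]; last by rewrite bigcup_set1.
by move=> _ ->; exact: finI_from1.
Qed.

Lemma final_group_finer (Tc : Topological H) : is_group_topology Tc -> adm Tc ->
  continuous (id : FH -> Topological.Pack Tc).
Proof.
by move=> HT Ha; apply/continuousP => U oU; apply: open_final_group; exists Tc.
Qed.

(** A subbasic open set is open for one admissible group topology; its preimages under the
    operations are open for that topology, hence for the finer one. *)
Lemma final_group_topological : topological_group FH.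
Proof.
split; apply: continuous_final_group => U [Tc [HT Ha oU]]; have fin := final_group_finer HT Ha.
  pose f (p : FH * FH) : Topological.Pack Tc * Topological.Pack Tc := p.
  have cf : continuous f.
    move=> p W [[W1 W2] [/= HW1 HW2] HW]; exists (W1, W2); last exact: HW.
    by split; [exact: (fin p.1)|exact: (fin p.2)].
  have cm : continuous ((fun p : Topological.Pack Tc * Topological.Pack Tc =>
      ((p.1 : H) * (p.2 : H))%g : Topological.Pack Tc) \o f).
    by move=> p; exact: continuous_comp (cf p) (HT.1 (f p)).
  by move/continuousP: cm => /(_ U oU).
have cv : continuous ((fun x : Topological.Pack Tc =>
    ((x : H)^-1)%g : Topological.Pack Tc) \o (id : FH -> Topological.Pack Tc)).
  by move=> x; exact: continuous_comp (fin x) (HT.2 x).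
by move/continuousP: cv => /(_ U oU).
Qed.
End FinalGroup.

Section Subgroups.
Variables (H : groupSpaceType) (S : subgroup H).

Lemma subgroup_val_continuous : continuous (@subgroup_val H S).
Proof. exact: initial_continuous. Qed.

Lemma continuous_subgroup (T : topologicalType) (f : T -> subgroup_type S) :
  continuous (@subgroup_val H S \o f) -> continuous f.
Proof. exact: continuous_comp_initial. Qed.

Lemma subgroup_topological : topological_group H -> topological_group (subgroup_type S).
Proof.
move=> [cM cV]; split; apply: continuous_subgroup => p.
  pose f (q : subgroup_type S * subgroup_type S) : H * H := (subgroup_val q.1, subgroup_val q.2).
  have cf : continuous f.
    move=> q W [[W1 W2] [/= HW1 HW2] HW]; exists (@subgroup_val H S @^-1` W1, @subgroup_val H S @^-1` W2).
      by split; [exact: (subgroup_val_continuous HW1)|exact: (subgroup_val_continuous HW2)].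
    by move=> z [z1 z2]; exact: HW.
  exact: (continuous_comp (cf p) (cM (f p))).
exact: (@continuous_comp _ _ _ (@subgroup_val H S) (fun x : H => x^-1%g) p
  (@subgroup_val_continuous p) (cV _)).
Qed.
End Subgroups.
End TopologicalGroups.

(** * Loos' axioms on the coset space *)

Section SymmetricCosets.
Variables (H : groupSpaceType) (Theta : group_involution H).
Local Open Scope classical_set_scope.
Hypothesis HT : topological_group H.
Hypothesis Theta_continuous : continuous (Theta : H -> H).
Hypothesis no_small_involution : exists2 V : set H, nbhs (1%g : H) V &
  forall h, V h -> let k := (h^-1 * Theta h)%g in (k * k = 1 -> k = 1)%g.
Local Notation K := (fixed_subgroup Theta).
Local Notation X := (coset_space K).
Local Notation pi := (coset K).

Lemma cvg_mulg (T : Type) (F : set_system T) (FF : Filter F) (f f' : T -> H) (a b : H) :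
  f @ F --> a -> f' @ F --> b -> (fun x => (f x * f' x)%g) @ F --> (a * b)%g.
Proof.
move=> fa gb O /(HT.1 (a, b)) [[P Q] [/= HP HQ] PQ].
change (F [set x | O (f x * f' x)%g]).
apply: (@filterS _ F FF _ _ _ (@filterI _ F FF _ _ (fa _ HP) (gb _ HQ))) => x [Px Qx].
exact: (PQ (f x, f' x)).
Qed.

Lemma cvg_invg (T : Type) (F : set_system T) (FF : Filter F) (f : T -> H) (a : H) :
  f @ F --> a -> (fun x => (f x)^-1%g) @ F --> (a^-1)%g.
Proof. by move=> fa; exact: (cvg_comp _ _ fa (HT.2 a)). Qed.

Lemma cvg_involution (T : Type) (F : set_system T) (FF : Filter F) (f : T -> H) (a : H) :
  f @ F --> a -> (fun x => Theta (f x)) @ F --> Theta a.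
Proof. by move=> fa; exact: (cvg_comp _ _ fa (@Theta_continuous a)). Qed.

Lemma coset_repr x : pi (repr x) = x. Proof. exact: reprK. Qed.

Lemma coset_eqP x y : pi x = pi y <-> Theta (x^-1 * y)%g = (x^-1 * y)%g.
Proof.
by split=> [/eqmodP/asboolP //|H1]; apply/eqmodP; exact/asboolP.
Qed.

Lemma coset_mulr x k : Theta k = k -> pi (x * k)%g = pi x.
Proof.
move=> Hk; symmetry; apply/coset_eqP.
by rewrite mulKg.
Qed.

Lemma repr_coset x : exists2 k, Theta k = k & repr (pi x) = (x * k)%g.
Proof.
exists (x^-1 * repr (pi x))%g; last by rewrite mulVKg.
by apply/coset_eqP; rewrite coset_repr.
Qed.

(** The projection is open, because the saturation of an open set is a union of right translates.
    Continuity of the reflection can then be checked on representatives. *)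
Lemma coset_nbhs x (O : set H) : nbhs x O -> nbhs (pi x) (pi @` O).
Proof.
move=> HO; have [B [oB Bx] BO] : exists2 B, open_nbhs x B & B `<=` O.
  by move: HO; rewrite nbhsE.
rewrite nbhsE; exists (pi @` B).
  split; last by exists x.
  change (open (pi @^-1` (pi @` B))); rewrite openE => y /= [b Bb /coset_eqP Eb].
  set k := (b^-1 * y)%g in Eb.
  have ck : (fun z : H => (z * k^-1)%g) @ y --> (y * k^-1)%g.
    by apply: cvg_mulg; [exact: cvg_id|exact: cvg_cst].
  have : nbhs y [set z | B (z * k^-1)%g].
    apply: ck; rewrite /k invgM invgK mulVKg; exact: open_nbhs_nbhs.
  apply: filterS => z Bz; exists (z * k^-1)%g => //.
  by apply: coset_mulr; rewrite inv_funV Eb.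
by move=> _ [b Bb <-]; exists b => //; exact: BO.
Qed.

Definition coset_mu (x y : X) : X :=
  pi (repr x * (Theta (repr x))^-1 * Theta (repr y))%g.
Definition coset_act (h : H) (x : X) : X := pi (h * repr x)%g.

Lemma coset_muE x y : coset_mu (pi x) (pi y) = pi (x * (Theta x)^-1 * Theta y)%g.
Proof.
rewrite /coset_mu; have [k Hk ->] := repr_coset x; have [l Hl ->] := repr_coset y.
rewrite !inv_funM Hk Hl invgM !mulgA mulgK; exact: coset_mulr.
Qed.

Lemma coset_actE h x : coset_act h (pi x) = pi (h * x)%g.
Proof. by rewrite /coset_act; have [k Hk ->] := repr_coset x; rewrite mulgA coset_mulr. Qed.

Lemma coset_continuous : continuous (pi : H -> X).
Proof. exact: pi_continuous. Qed.

Lemma coset_mu_continuous : continuous (fun p : X * X => coset_mu p.1 p.2).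
Proof.
move=> [x y]; rewrite -[x]coset_repr -[y]coset_repr.
move: (repr x) (repr y) => {}x {}y O /=; rewrite coset_muE => HO.
have c : (fun p : H * H => (p.1 * (Theta p.1)^-1 * Theta p.2)%g) @ (x, y) -->
    (x * (Theta x)^-1 * Theta y)%g.
  have c1 : (fun p : H * H => p.1) @ (x, y) --> x by exact: cvg_fst.
  have c2 : (fun p : H * H => p.2) @ (x, y) --> y by exact: cvg_snd.
  apply: cvg_mulg; last by apply: cvg_involution; exact: c2.
  apply: cvg_mulg; first exact: c1.
  by apply: cvg_invg; apply: cvg_involution; exact: c1.
have [[P Q] [/= HP HQ] PQ] := c _ (coset_continuous HO).
exists (pi @` P, pi @` Q); first by split; exact: coset_nbhs.
move=> [_ _] [/= [p Pp <-] [q Qq <-]]; rewrite coset_muE.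
exact: (PQ (p, q)).
Qed.

(** After translation to the base point, a fixed coset yields [Theta k = k] for [k = v^-1 Theta(v)].
    Always [Theta k = k^-1], so [k] is an involution or 1. *)
Lemma coset_mu_isolated x : exists2 U : set X, nbhs x U &
  forall y, U y -> coset_mu x y = y -> y = x.
Proof.
rewrite -[x]coset_repr; move: (repr x) => {}x.
have [V V1 HV] := no_small_involution.
exists (pi @` [set y | V (x^-1 * y)%g]).
  apply: coset_nbhs.
  have c : (fun y : H => (x^-1 * y)%g) @ x --> (x^-1 * x)%g.
    by apply: cvg_mulg; [exact: cvg_cst|exact: cvg_id].
  by apply: c; rewrite mulVg.
move=> _ [y Vy <-]; rewrite coset_muE => /esym/coset_eqP.
set v := (x^-1 * y)%g in Vy; set k := (v^-1 * Theta v)%g.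
have -> : (y^-1 * (x * (Theta x)^-1 * Theta y))%g = k.
  by rewrite /k /v inv_funM inv_funV invgM invgK !mulgA.
have -> : Theta k = (k^-1)%g by rewrite /k inv_funM inv_funV Defs.inv_funK invgM invgK.
move=> Ek; have k1 : k = 1%g by apply: HV => //; rewrite -/k -{1}Ek mulVg.
have -> : y = (x * v)%g by rewrite mulVKg.
apply: coset_mulr; apply: (@mulgI _ v^-1%g); rewrite mulVg; exact: k1.
Qed.

Lemma coset_act_Sym h : Sym coset_mu (coset_act h).
Proof.
have c h' : continuous (coset_act h').
  apply/quotient_continuous => x.
  change ((fun y => coset_act h' (pi y)) @ x --> coset_act h' (pi x)).
  rewrite coset_actE; under eq_fun do rewrite coset_actE.
  have ch : (fun y : H => (h' * y)%g) @ x --> (h' * x)%g.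
    by apply: cvg_mulg; [exact: cvg_cst|exact: cvg_id].
  exact: (cvg_comp _ _ ch (@coset_continuous _)).
split=> //.
  exists (coset_act h^-1%g); split=> // x; rewrite -[x]coset_repr !coset_actE.
    by rewrite mulKg.
  by rewrite mulVKg.
move=> x y; rewrite -[x]coset_repr -[y]coset_repr !(coset_actE, coset_muE).
by rewrite !inv_funM invgM !mulgA mulgVK.
Qed.

Lemma coset_space_symmetric : symmetric_coset_space Theta.
Proof.
exists coset_mu, coset_act; split.
- exact: coset_muE.
- split.
  + exact: coset_mu_continuous.
  + by move=> x; rewrite -[x]coset_repr coset_muE mulgVK.
  + move=> x y; rewrite -[x]coset_repr -[y]coset_repr !coset_muE; congr pi.
    by rewrite !inv_funM inv_funV !Defs.inv_funK !mulgA mulgVK mulgV mul1g.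
  + move=> x y z; rewrite -[x]coset_repr -[y]coset_repr -[z]coset_repr !coset_muE.
    congr pi; rewrite !inv_funM !inv_funV !Defs.inv_funK !invgM !invgK !mulgA.
    by rewrite !mulgVK mulgK.
  + exact: coset_mu_isolated.
- exact: coset_actE.
- exact: coset_act_Sym.
split=> [x|h h' x] /=; rewrite -[x]coset_repr !coset_actE ?mul1g //.
by rewrite mulgA.
Qed.

End SymmetricCosets.

Section SmallInvolutions.
Variables (R : realType) (n : nat) (A : 'M[int]_n) (D : root_datum A).
Variables (g : kac_moody_algebra D R[i]) (G : tits_functor g).
Hypothesis hcartan : generalized_cartan A.
Local Notation C := (Num.NumField.sort (R[i] : numFieldType)).
Local Notation conj := (@conjc R : {rmorphism R[i] -> R[i]}).
Local Open Scope classical_set_scope.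

Lemma kac_peterson_no_small_involution (K : numFieldType) (j : {rmorphism K -> R[i]})
    (bar : {rmorphism K -> K}) (Theta : cartan_chevalley G bar) :
  involutive bar -> (forall z, conj (j z) = j (bar z)) ->
  (forall z, exists r, j r = z) \/
    ((forall r, bar r = r) /\ forall z, conj z = z -> exists r, j r = z) ->
  (forall a c : K, (a, c) != (0, 0) ->
    exists2 r, r != 0 & bar r = r /\ r * r = a * bar a + c * bar c) ->
  (forall e : R, 0 < e -> \forall r \near (0 : K), modulus (j r : C) <= e) ->
  exists2 V : set (kac_peterson G K), nbhs (1%g : kac_peterson G K) V &
  forall h, V h -> let k := (h^-1 * Theta h)%g in (k * k = 1 -> k = 1)%g.
Proof.
move=> barK j_bar j_descent bar_sqrt j_small.
have [Ad HAd] := tf_adjoint G.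
have free1 : involution_free Ad 1%g by move=> _ x dx; rewrite (ad_one HAd).
have [delta [delta0 Hdelta]] := small_exists (letter_elt0 G) free1
  (fun U UU w l => @involution_free_open _ _ _ _ _ _ hcartan _ HAd U UU w l).
(* Smallness is asked of [h^-1 Theta(h)], not of [h]; continuity of this map and its value 1 at 1
   make the set a neighbourhood. *)
exists [set h : kac_peterson G K | pulled_small j delta 0 (h^-1 * Theta h)%g].
  have HT : topological_group (kac_peterson G K) by exact: final_group_topological.
  have c : (fun h : kac_peterson G K => (h^-1 * Theta h)%g) @ (1%g : kac_peterson G K)
      --> (1^-1 * Theta 1)%g.
    have c1 := HT.2 (1%g : kac_peterson G K).
    have c2 := @cc_continuous _ _ _ _ _ _ _ _ Theta (1%g : kac_peterson G K).
    exact: (@cvg_mulg (kac_peterson G K) HT _ _ _ _ _ _ _ c1 c2).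
  by apply: c; rewrite inv_fun1 mulVg; exact: nbhs_pulled_small.
move=> h /= /Hdelta free kk.
apply: (adjoint_trivial_fixed hcartan HAd barK j_bar j_descent bar_sqrt
  (inv_funM Theta) (cc_pos Theta) (cc_neg Theta) (cc_torus Theta) kk) => x.
move: x; apply: free => x dx.
by rewrite -gf_mapM kk gf_map1 (ad_one HAd).
Qed.

Lemma real_no_small_involution (Theta : cartan_chevalley G (@idfun R)) :
  exists2 V : set (kac_peterson G R), nbhs (1%g : kac_peterson G R) V &
  forall h, V h -> let k := (h^-1 * Theta h)%g in (k * k = 1 -> k = 1)%g.
Proof.
apply: (@kac_peterson_no_small_involution R (real_complex R : {rmorphism R -> R[i]})
  (idfun : {rmorphism R -> R}) Theta) => //.
- by move=> z; exact: conjc_real.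
- right; split=> // -[a b] /eqP; rewrite eq_complex /= => /andP[_ /eqP E].
  exists a; apply/eqP; rewrite eq_complex /= eqxx /=; apply/eqP; lra.
- move=> a c ac; exists (Num.sqrt (a * a + c * c)).
    rewrite sqrtr_eq0 -ltNge lt_def -!expr2 addr_ge0 ?sqr_ge0 // andbT.
    by rewrite paddr_eq0 ?sqr_ge0 // !sqrf_eq0.
  by split=> //; rewrite -expr2 sqr_sqrtr // -!expr2 addr_ge0 ?sqr_ge0.
move=> e e0; near=> r; rewrite modulus_le normc_def /= expr0n addr0 sqrtr_sqr lecR.
near: r.
exact: (@nbhs0_le (R : numFieldType) (R : numFieldType) e e0).
Unshelve. all: by end_near.
Qed.

Lemma complex_no_small_involution (Theta : cartan_chevalley G (@conjc R)) :
  exists2 V : set (kac_peterson G R[i]), nbhs (1%g : kac_peterson G R[i]) V &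
  forall h, V h -> let k := (h^-1 * Theta h)%g in (k * k = 1 -> k = 1)%g.
Proof.
apply: (@kac_peterson_no_small_involution (R[i] : numFieldType) (idfun : {rmorphism R[i] -> R[i]})
  conj Theta) => //.
- exact: conjcK.
- by left=> z; exists z.
- move=> [a b] [c d] ac; pose s := a ^+ 2 + b ^+ 2 + (c ^+ 2 + d ^+ 2).
  have s0 : 0 < s.
    rewrite lt_def !addr_ge0 ?sqr_ge0 // andbT.
    rewrite !paddr_eq0 ?addr_ge0 ?sqr_ge0 // !sqrf_eq0.
    by move: ac; rewrite xpair_eqE !eq_complex.
  exists (Num.sqrt s)%:C%C; first by rewrite eq_complex /= eqxx andbT gt_eqF // sqrtr_gt0.
  split; first exact: conjc_real.
  rewrite -rmorphM -expr2 sqr_sqrtr ?ltW //; apply/eqP; rewrite eq_complex /=.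
  by apply/andP; split; apply/eqP; rewrite /s; ring.
move=> e e0; near=> r; rewrite modulus_le; near: r.
by apply: (@nbhs0_le (R[i] : numFieldType) (R[i] : numFieldType)); rewrite gt0c.
Unshelve. all: by end_near.
Qed.

End SmallInvolutions.

Theorem proposition4p4 (R : realType) (n : nat) (A : 'M[int]_n)
    (hcartan : generalized_cartan A) (hindec : indecomposable A)
    (hsymm : symmetrizable R A)
    (D : root_datum A) (g : kac_moody_algebra D R[i]) (G : tits_functor g) :
  [/\ forall Theta : cartan_chevalley G (@idfun R),
        symmetric_coset_space Theta,
      forall Theta : cartan_chevalley G (@conjc R),
        symmetric_coset_space Theta
    & forall (F : real_form G) (hF : almost_split F)
        (Theta : cartan_chevalley G (@conjc R)) (N : normalization F Theta),
        DCS N ->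
        symmetric_coset_space (almost_split_Theta N)].
Proof.
have HT (K : numFieldType) : topological_group (kac_peterson G K).
  exact: final_group_topological.
split=> [Theta|Theta|F _ Theta N _].
- apply: coset_space_symmetric => //; first exact: cc_continuous.
  exact: real_no_small_involution.
- apply: coset_space_symmetric => //; first exact: cc_continuous.
  exact: complex_no_small_involution.
have [V V1 HV] := complex_no_small_involution hcartan Theta.
have cval := @subgroup_val_continuous _ (almost_split_subgroup N).
apply: coset_space_symmetric; first exact: subgroup_topological.
  apply: continuous_subgroup => x.
  exact: (@continuous_comp _ _ _ (@subgroup_val _ (almost_split_subgroup N)) Theta
    x (@cval x) (@cc_continuous _ _ _ _ _ _ _ _ Theta _)).
exists (@subgroup_val _ (almost_split_subgroup N) @^-1` V)%classic.
  exact: (@cval 1%g).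
move=> h Vh k kk; apply: subgroup_val_inj.
by apply: (HV _ Vh); exact: (congr1 (@subgroup_val _ (almost_split_subgroup N)) kk).
Qed.
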